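(* Let $d\geq 1$, let $J:\mathbb Z^d\times \mathbb Z^d \to [0,\infty)$ be a symmetric, integrable, translation-invariant kernel, and suppose that there exist constants $0<\alpha<d$ and $c>0$ such that $J(x,y) \geq c\|x-y\|_\infty^{-d-\alpha}$ for all distinct $x,y \in \mathbb Z^d$. Then there exists a constant $A=A(d,\alpha)<\infty$ (depending only on $d$ and $\alpha$) such that \[ \frac{1}{|\Lambda_r|}\sum_{x\in \Lambda_r} \mathbf P_{\beta_c}(0\leftrightarrow x) \leq \frac{A}{c\beta_c} r^{-d+\alpha} \] for every $r\geq 1$.
   Context: A kernel $J$ is symmetric if $J(x,y)=J(y,x)$, translation-invariant if $J(x,y)=J(0,y-x)$, and integrable if $\sum_{y\in\mathbb Z^d}J(x,y)<\infty$ for every $x$. For $\beta\geq 0$, long-range percolation on $\mathbb Z^d$ with kernel $J$ and parameter $\beta$ is the random graph with vertex set $\mathbb Z^d$ in which each unordered pair $\{x,y\}$ of distinct points is an edge independently with probability $1-\exp(-\beta J(x,y))$; $\mathbf P_\beta$ denotes its law. Clusters are connected components, $\{x\leftrightarrow y\}$ is the event that $x,y$ are in the same cluster, and $\beta_c=\inf\{\beta\geq 0:\mathbf P_\beta(\text{an infinite cluster exists})>0\}$ (under the hypotheses, $0<\beta_c<\infty$). $\Lambda_r=[-r,r]^d\cap\mathbb Z^d$. *)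

(* Defs.v *)
From HB Require Import structures.
From mathcomp Require Import all_boot all_order all_algebra finmap.
From mathcomp Require Import all_classical all_reals all_analysis.
Set Implicit Arguments. Unset Strict Implicit. Unset Printing Implicit Defensive.
Import Order.TTheory GRing.Theory Num.Theory.
Local Open Scope classical_set_scope.
Local Open Scope ring_scope.

Definition Zd (d : nat) := 'rV[int]_d.

Definition linf (d : nat) (x : Zd d) : nat := \max_(i < d) `|x ord0 i|%N.

Definition box (R : realType) (d : nat) (r : R) : set (Zd d) :=
  [set x | forall i : 'I_d, `|((x ord0 i)%:~R : R)| <= r].

Definition kernel_nonneg (R : realType) d (J : Zd d -> Zd d -> R) :=
  forall x y, 0 <= J x y.
Definition kernel_symmetric (R : realType) d (J : Zd d -> Zd d -> R) :=
  forall x y, J x y = J y x.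
Definition kernel_transl_inv (R : realType) d (J : Zd d -> Zd d -> R) :=
  forall x y, J x y = J 0 (y - x).
Definition kernel_integrable (R : realType) d (J : Zd d -> Zd d -> R) :=
  forall x, (\esum_(y in [set: Zd d]) (J x y)%:E < +oo)%E.

Definition same_edge d (e f : Zd d * Zd d) : bool :=
  (e == f) || (e == (f.2, f.1)).

Definition edge_event d (T : Type) (w : T -> Zd d -> Zd d -> bool)
  (x y : Zd d) : set T := [set t | w t x y].

(* A long-range percolation model on Z^d with kernel J and parameter beta,
   realized on a probability space (T, P) by the edge indicators
   w t x y (= "the edge {x,y} is present in the sample t"):
   the indicators are symmetric, loop-free, measurable, the edge {x,y}
   (x <> y) is open with probability 1 - exp(-beta J(x,y)), and the
   family indexed by unordered pairs is mutually independent (product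
   rule for every finite family of distinct unordered pairs). *)
Definition lrp_model (R : realType) d (J : Zd d -> Zd d -> R) (beta : R)
  (dT : measure_display) (T : measurableType dT) (P : probability T R)
  (w : T -> Zd d -> Zd d -> bool) : Prop :=
  [/\ forall t x y, w t x y = w t y x,
      forall t x, w t x x = false,
      forall x y, measurable (edge_event w x y),
      forall x y, x != y ->
        P (edge_event w x y) = (1 - expR (- (beta * J x y)))%:E &
      forall s : seq (Zd d * Zd d),
        all (fun e => e.1 != e.2) s ->
        pairwise (fun e f => ~~ same_edge e f) s ->
        P (\bigcap_(i in [set i | (i < size s)%N])
             edge_event w (nth (0, 0) s i).1 (nth (0, 0) s i).2)
        = (\prod_(e <- s) P (edge_event w e.1 e.2))%E ].

Definition connected d (T : Type) (w : T -> Zd d -> Zd d -> bool)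
  (t : T) (x y : Zd d) : Prop :=
  exists s : seq (Zd d), path (w t) x s /\ last x s = y.

Definition conn_event d (T : Type) (w : T -> Zd d -> Zd d -> bool)
  (x y : Zd d) : set T := [set t | connected w t x y].

Definition infinite_cluster_event d (T : Type)
  (w : T -> Zd d -> Zd d -> bool) : set T :=
  [set t | exists x : Zd d, ~ finite_set [set y | connected w t x y]].

(* P_beta(an infinite cluster exists) > 0 (the law P_beta is the law of
   any model as above; it is unique). *)
Definition percolates (R : realType) d (J : Zd d -> Zd d -> R) (beta : R)
  : Prop :=
  exists (dT : measure_display) (T : measurableType dT)
         (P : probability T R) (w : T -> Zd d -> Zd d -> bool),
    lrp_model J beta P w /\ (0 < P (infinite_cluster_event w))%E.

Definition beta_c (R : realType) d (J : Zd d -> Zd d -> R) : R :=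
  inf [set beta : R | 0 <= beta /\ percolates J beta].

(* Main.v *)
(* By finite-volume approximation and left-continuity in [beta], it suffices
   to bound the mean number of points of a box of radius n joined to the origin
   at a parameter where the susceptibility is finite, by n^alpha times a
   constant not depending on the susceptibility.  At such a parameter set
   aside, for every scale L^k, a small uniform part of the kernel.  If at some
   scale either the mean cluster of the origin or the largest cluster in the
   box is much larger than the critical order of magnitude, then sprinkling the
   part set aside glues clusters of neighbouring boxes and reproduces the
   situation at the next scale, and so forever, contradicting finiteness of the
   susceptibility.  The concentration needed for this is the universal
   tightness of cluster sizes, obtained by cutting a spanning tree of a cluster
   into two large edge-disjoint pieces and applying the van den Berg--Kesten
   inequality.  The parts set aside are then restored one scale at a time, at
   the price of a convergent sum.  That the susceptibility is finite below
   [beta_c] follows from the dichotomy of Duminil-Copin and Tassion: either the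
   expected number of open edges leaving some finite set containing the origin,
   from points joined to it inside that set, is at most 1/2, or the origin is
   joined to infinity with positive probability at every larger parameter. *)
Require Import Defs.
From HB Require Import structures.
From mathcomp Require Import all_boot all_order all_algebra finmap.
From mathcomp Require Import all_classical all_reals all_analysis.
From mathcomp Require Import ring lra zify.
Set Implicit Arguments. Unset Strict Implicit. Unset Printing Implicit Defensive.
Import Order.TTheory GRing.Theory Num.Theory.
Local Open Scope classical_set_scope.
Local Open Scope ring_scope.

(** * Poisson percolation on finite edge lists *)

(** The susceptibility [X] may only decide how many scales are treated and must never enter the
    constant. Two choices serve this. First, the parts set aside are confined to boxes around a
    centre instead of being translation invariant: restoring one of them then costs products of
    cluster sizes truncated to a box, which the scale bound controls, whereas a
    translation-invariant part would call for the full susceptibility. The price is that the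
    depleted kernel depends on its centre; decreasing radii pay for moving it. Second, the intensity
    at scale [k] decays like [L^(-(d+alpha)k)] and the largest cluster is measured against
    [L^((d+alpha)k/2)], so that the total intensity between two clusters of that size is the same
    number [K2] at all scales. Estimates are made for finite lists of independent clocks, where
    expectation is a recursion: adding intensities is concatenating lists, and the Harris and van
    den Berg--Kesten inequalities are inductions on the list. The model enters only through its
    finite-dimensional law. *)

Definition ind (R : pzSemiRingType) (P : Prop) : R := (`[< P >] : nat)%:R.

Arguments ind : simpl never.

Section Indicator.
Variable R : realType.
Implicit Types P Q : Prop.

Lemma indT P : P -> ind R P = 1.
Proof. by move=> p; rewrite /ind asboolT. Qed.

Lemma indF P : ~ P -> ind R P = 0.
Proof. by move=> p; rewrite /ind asboolF. Qed.

Lemma ind_ge0 P : 0 <= ind R P.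
Proof. exact: ler0n. Qed.

Lemma ind_le1 P : ind R P <= 1.
Proof. by rewrite /ind; case: asbool. Qed.

Lemma ind_le P Q : (P -> Q) -> ind R P <= ind R Q.
Proof.
move=> PQ; have [p|p] := pselect P; first by rewrite !indT //; apply: PQ.
by rewrite (indF p) ind_ge0.
Qed.

Lemma ind_eq P Q : (P <-> Q) -> ind R P = ind R Q.
Proof. by move=> /propext ->. Qed.

Lemma ind_and P Q : ind R (P /\ Q) = ind R P * ind R Q.
Proof. by rewrite /ind asbool_and -natrM mulnb. Qed.

Lemma ind_not P : ind R (~ P) = 1 - ind R P.
Proof.
have [p|p] := pselect P; first by rewrite (indT p) indF ?subrr// => /(_ p).
by rewrite (indF p) indT ?subr0.
Qed.

End Indicator.

Definition incr (R : realType) (E : Type) (f : set E -> R) :=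
  forall v w, v `<=` w -> f v <= f w.

Section Ex.
Variables (R : realType) (E : eqType).
Implicit Types (l : seq (E * R)) (f g : set E -> R) (w : set E).

(* The list [l] describes independent Poisson clocks: an entry [(e, a)] opens
   [e] with probability [1 - exp(-a)]; repeated entries for [e] add up. *)
Fixpoint Ex l f : R :=
  if l is (e, a) :: l' then
    (1 - expR (- a)) * Ex l' (fun w => f (e |` w)) + expR (- a) * Ex l' f
  else f set0.

Definition nneg l := forall p, p \in l -> 0 <= p.2.

Lemma nneg_cons e a l : nneg ((e, a) :: l) -> 0 <= a /\ nneg l.
Proof.
move=> h; split; first exact: (h (e, a) (mem_head _ _)).
by move=> p pl; apply: h; rewrite inE pl orbT.
Qed.

Lemma nneg_cat l1 l2 : nneg (l1 ++ l2) <-> nneg l1 /\ nneg l2.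
Proof.
split=> [h|[h1 h2] p]; last by rewrite mem_cat => /orP[/h1|/h2].
by split=> p pl; apply: h; rewrite mem_cat pl ?orbT.
Qed.

Lemma expRN_itv (a : R) : 0 <= a -> 0 <= expR (- a) <= 1.
Proof. by move=> a0; rewrite expR_ge0/= -expR0 ler_expR oppr_le0. Qed.

Lemma Ex_ext l f g : (forall w, f w = g w) -> Ex l f = Ex l g.
Proof. by move=> fg; congr Ex; apply/funext. Qed.

Arguments Ex_ext {l f} g.

Lemma Ex_cst l c : Ex l (fun=> c) = c.
Proof. by elim: l => //= -[e a] l ->; lra. Qed.

Lemma ExD l f g : Ex l (fun w => f w + g w) = Ex l f + Ex l g.
Proof. by elim: l f g => [|[e a] l IH] f g //=; rewrite !IH; ring. Qed.

Lemma ExZ l c f : Ex l (fun w => c * f w) = c * Ex l f.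
Proof. by elim: l f => [|[e a] l IH] f //=; rewrite !IH; ring. Qed.

Lemma ExZr l c f : Ex l (fun w => f w * c) = Ex l f * c.
Proof. by rewrite mulrC -ExZ; apply: Ex_ext => w; rewrite mulrC. Qed.

Lemma ExN l f : Ex l (fun w => - f w) = - Ex l f.
Proof. by rewrite -mulN1r -ExZ; apply: Ex_ext => w; rewrite mulN1r. Qed.

Lemma ExB l f g : Ex l (fun w => f w - g w) = Ex l f - Ex l g.
Proof. by rewrite (ExD l f (fun w => - g w)) ExN. Qed.

Lemma Ex_sum (T : Type) (s : seq T) (Q : pred T) l (F : T -> set E -> R) :
  Ex l (fun w => \sum_(x <- s | Q x) F x w) = \sum_(x <- s | Q x) Ex l (F x).
Proof.
elim: s => [|x s IH].
  by rewrite big_nil -[RHS](Ex_cst l); apply: Ex_ext => w; rewrite big_nil.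
rewrite big_cons; case: ifPn => Qx; rewrite -IH ?(ExZ, =^~ ExD);
  by apply: Ex_ext => w; rewrite big_cons ?Qx// (negbTE Qx).
Qed.

Lemma Ex_le l f g : nneg l -> (forall w, f w <= g w) -> Ex l f <= Ex l g.
Proof.
elim: l f g => [|[e a] l IH] f g //= /nneg_cons[a0 nl] fg.
have /andP[h0 h1] := expRN_itv a0.
by apply: lerD; apply: ler_wpM2l; rewrite ?subr_ge0//; apply: IH.
Qed.

Lemma Ex_ge0 l f : nneg l -> (forall w, 0 <= f w) -> 0 <= Ex l f.
Proof. by move=> nl f0; rewrite -[leLHS](Ex_cst l); apply: Ex_le. Qed.

Lemma Ex_le_cst l f c : nneg l -> (forall w, f w <= c) -> Ex l f <= c.
Proof. by move=> nl fc; rewrite -[leRHS](Ex_cst l); apply: Ex_le. Qed.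

Lemma Ex_exchange l1 l2 (F : set E -> set E -> R) :
  Ex l1 (fun v => Ex l2 (F v)) = Ex l2 (fun w => Ex l1 (F^~ w)).
Proof.
elim: l1 F => [|[e a] l IH] F //=.
by rewrite ExD !ExZ !IH.
Qed.

Lemma Ex_cat l1 l2 f :
  Ex (l1 ++ l2) f = Ex l1 (fun v => Ex l2 (fun w => f (v `|` w))).
Proof.
elim: l1 f => [|[e a] l IH] f /=.
  by apply: Ex_ext => w; rewrite set0U.
rewrite !IH; congr (_ * _ + _); apply: Ex_ext => v; apply: Ex_ext => w.
by rewrite setUA.
Qed.

Lemma Ex_perm l1 l2 f : perm_eq l1 l2 -> Ex l1 f = Ex l2 f.
Proof.
move=> p12; apply: (catCA_perm_ind (P := fun l => Ex l1 f = Ex l f) _ p12) => //.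
move=> s1 s2 s3 ->.
rewrite !Ex_cat; under Ex_ext do rewrite Ex_cat.
under [RHS]Ex_ext do rewrite Ex_cat.
rewrite Ex_exchange; apply: Ex_ext => v; apply: Ex_ext => w.
by apply: Ex_ext => u; rewrite setUCA.
Qed.

Lemma incr_setU1 f e : incr f -> incr (fun w => f (e |` w)).
Proof. by move=> fi v w vw; apply: fi; apply: setUS. Qed.

Lemma Ex_incr_cat l1 l2 f : nneg l1 -> nneg l2 -> incr f ->
  Ex l1 f <= Ex (l1 ++ l2) f.
Proof.
move=> n1 n2 fi; rewrite Ex_cat; apply: Ex_le => // v.
rewrite -[leLHS](Ex_cst l2); apply: Ex_le => // w.
by apply: fi; apply: subsetUl.
Qed.

Lemma Ex_incr_setU1 l f e : nneg l -> incr f ->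
  Ex l f <= Ex l (fun w => f (e |` w)).
Proof. by move=> nl fi; apply: Ex_le => // w; apply: fi; apply: subsetUr. Qed.

(** Conditioning on the first clock leaves the covariance [q * (1 - q) * (F1 - F0) * (G1 - G0)],
    which is nonnegative because opening an edge increases both functions. *)
Lemma Ex_harris l f g : nneg l -> incr f -> incr g ->
  Ex l f * Ex l g <= Ex l (fun w => f w * g w).
Proof.
elim: l f g => [|[e a] l IH] f g //= /nneg_cons[a0 nl] fi gi.
have /andP[p0 p1] := expRN_itv a0.
have := IH _ _ nl fi gi.
have := IH _ _ nl (incr_setU1 e fi) (incr_setU1 e gi).
have := Ex_incr_setU1 e nl fi.
have := Ex_incr_setU1 e nl gi.
move: (Ex l f) (Ex l g) (Ex l (fun w => f (e |` w)))
  (Ex l (fun w => g (e |` w))) (Ex l (fun w => f w * g w))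
  (Ex l (fun w => f (e |` w) * g (e |` w))) => F0 G0 F1 G1 H0 H1.
move: (expR (- a)) p0 p1 => q q0 q1 hg hf h1 h0.
have : 0 <= (1 - q) * q * ((F1 - F0) * (G1 - G0)).
  by rewrite !mulr_ge0 ?subr_ge0.
have : 0 <= (1 - q) * (H1 - F1 * G1) by rewrite mulr_ge0 ?subr_ge0.
have : 0 <= q * (H0 - F0 * G0) by rewrite mulr_ge0 ?subr_ge0.
nra.
Qed.

Definition incr2 (Phi : set E -> set E -> Prop) :=
  forall v v' w w', v `<=` v' -> w `<=` w' -> Phi v w -> Phi v' w'.

(** For [Phi v1 v2 = P v1 /\ Q v2] this is the disjoint occurrence of [P] and [Q]. A general
    relation is needed because the induction in [Ex_BK] produces unions that are no longer of
    product form. *)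
Definition box_event (Phi : set E -> set E -> Prop) w :=
  exists v1 v2, [/\ v1 `<=` w, v2 `<=` w, v1 `&` v2 = set0 & Phi v1 v2].

Lemma Ex_cons_ge l f e a : nneg ((e, a) :: l) -> incr f ->
  Ex l f <= Ex ((e, a) :: l) f.
Proof.
move=> /nneg_cons[a0 nl] fi; have /andP[p0 p1] := expRN_itv a0.
rewrite /=; have := Ex_incr_setU1 e nl fi.
by move: (expR (- a)) p0 p1 => q q0 q1; nra.
Qed.

(* Van den Berg--Kesten, by giving the two witnesses their own copy of one
   edge at a time. *)
Lemma Ex_BK l (Phi : set E -> set E -> Prop) : nneg l -> incr2 Phi ->
  Ex l (fun w => ind R (box_event Phi w))
    <= Ex l (fun v => Ex l (fun w => ind R (Phi v w))).
Proof.
elim: l Phi => [|[e a] l IH] Phi /=.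
  move=> _ _; apply: ind_le => -[v1 [v2 [h1 h2 _]]].
  by move: h1 h2; rewrite !subset0 => -> ->.
move=> /nneg_cons[a0 nl] inc; have /andP[q0 q1] := expRN_itv a0.
set q := expR (- a) in q0 q1 *.
pose P00 v w := Phi v w.
pose P10 v w := Phi (e |` v) w.
pose P01 v w := Phi v (e |` w).
pose P11 v w := Phi (e |` v) (e |` w).
(* At most one of two disjoint witnesses contains [e]; deleting [e] from it leaves a pair of
   witnesses for [Pm]. *)
pose Pm v w := P10 v w \/ P01 v w.
have im : incr2 Pm.
  move=> v v' w w' vv ww [|] h; [left|right]; apply: inc h => //; exact: setUS.
have D1 : Ex l (fun w => ind R (box_event Phi (e |` w)))
       <= Ex l (fun w => ind R (box_event Pm w)).
  apply: Ex_le => // w; apply: ind_le => -[v1 [v2 [h1 h2 dj ph]]].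
  have [e1|e1] := pselect (v1 e).
  - exists (v1 `\ e), v2; split.
    + by move=> x [/h1[]// ->].
    + move=> x x2; have [xe|//] := h2 _ x2.
      have : (v1 `&` v2) e by split=> //; rewrite -xe.
      by rewrite dj.
    + by apply/seteqP; split=> // x [[x1 _] x2]; rewrite -dj; split.
    + left; apply: inc ph => // x x1; have [->|xe] := pselect (x = e).
        by left.
      by right; split.
  - exists v1, (v2 `\ e); split.
    + by move=> x x1; have [xe|//] := h1 _ x1; case: e1; rewrite -xe.
    + by move=> x [/h2[]// ->].
    + by apply/seteqP; split=> // x [x1 [x2 _]]; rewrite -dj; split.
    + right; apply: inc ph => // x x1; have [->|xe] := pselect (x = e).
        by left.
      by right; split.
have B0 := IH Phi nl inc.
have Bm := le_trans D1 (IH _ nl im).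
have le1 : (1 - q) * Ex l (fun w => ind R (box_event Phi (e |` w))) +
    q * Ex l (fun w => ind R (box_event Phi w)) <=
  (1 - q) * Ex l (fun v => Ex l (fun w => ind R (Pm v w))) +
    q * Ex l (fun v => Ex l (fun w => ind R (Phi v w))).
  by apply: lerD; apply: ler_wpM2l; rewrite ?subr_ge0.
apply: (le_trans le1).
rewrite -!ExZ -!ExD; apply: Ex_le => // v.
rewrite -!ExZ -!ExD -!ExZ -!ExD; apply: Ex_le => // w.
rewrite -/(P10 v w) -/(P01 v w) -/(P11 v w).
have s0 : 0 <= 1 - q by rewrite subr_ge0.
have [h00|h00] := pselect (Phi v w).
  have h10 : P10 v w by apply: inc h00 => //; apply: subsetUr.
  have h01 : P01 v w by apply: inc h00 => //; apply: subsetUr.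
  have h11 : P11 v w by apply: inc h00 => //; apply: subsetUr.
  by rewrite !indT//; [nra | left].
have [hm|hm] := pselect (Pm v w); last first.
  rewrite !(indF _ hm) (indF _ h00) !mulr0 add0r.
  by rewrite !addr_ge0// ?mulr_ge0// ?addr_ge0 ?mulr_ge0// ?ind_ge0.
have h11 : P11 v w.
  by case: hm => h; apply: inc h => //; apply: subsetUr.
rewrite (indT _ hm) (indF _ h00) (indT _ h11).
have i10 := ind_ge0 R (P10 v w); have i01 := ind_ge0 R (P01 v w).
have : 1 <= ind R (P10 v w) + ind R (P01 v w).
  by case: hm => h; rewrite (indT _ h) ?lerDl ?lerDr.
move: (ind R (P10 v w)) (ind R (P01 v w)) i10 i01 => i j i0 j0 ij.
have : 0 <= (1 - q) * q * (i + j - 1) by rewrite !mulr_ge0// subr_ge0.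
nra.
Qed.

Lemma Ex_BK_prod l (P Q : set E -> Prop) : nneg l ->
  (forall v w, v `<=` w -> P v -> P w) -> (forall v w, v `<=` w -> Q v -> Q w) ->
  Ex l (fun w => ind R (box_event (fun v1 v2 => P v1 /\ Q v2) w))
    <= Ex l (fun w => ind R (P w)) * Ex l (fun w => ind R (Q w)).
Proof.
move=> nl Pi Qi; apply: le_trans (Ex_BK nl _) _.
  by move=> v v' w w' vv ww [] /(Pi _ _ vv) p /(Qi _ _ ww).
rewrite -ExZr; apply: Ex_le => // v; rewrite -ExZ; apply: Ex_le => // w.
by rewrite ind_and.
Qed.

(** Clocks of rates [W1] and [W2] on the same edge act as one clock of rate [W1 + W2]. This is what
    turns a raised intensity into an independent sprinkled configuration. *)
Lemma Ex_superpose (s : seq E) (W1 W2 : E -> R) f :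
  Ex [seq (e, W1 e + W2 e) | e <- s] f
  = Ex ([seq (e, W1 e) | e <- s] ++ [seq (e, W2 e) | e <- s]) f.
Proof.
rewrite Ex_cat; elim: s f => [|e s IH] f /=; first by rewrite set0U.
rewrite !IH opprD expRD.
rewrite !ExD !ExZ.
set A := Ex _ (fun v => Ex _ (fun w => f (e |` (v `|` w)))).
set B := Ex _ (fun v => Ex _ (fun w => f (v `|` w))).
have -> : Ex [seq (e0, W1 e0) | e0 <- s] (fun v =>
  Ex [seq (e0, W2 e0) | e0 <- s] (fun w => f (e |` v `|` (e |` w)))) = A.
  by apply: Ex_ext => v; apply: Ex_ext => w; rewrite setUACA setUid.
have -> : Ex [seq (e0, W1 e0) | e0 <- s] (fun v =>
  Ex [seq (e0, W2 e0) | e0 <- s] (fun w => f (v `|` (e |` w)))) = A.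
  by apply: Ex_ext => v; apply: Ex_ext => w; rewrite setUCA.
have -> : Ex [seq (e0, W1 e0) | e0 <- s] (fun v =>
  Ex [seq (e0, W2 e0) | e0 <- s] (fun w => f (e |` v `|` w))) = A.
  by apply: Ex_ext => v; apply: Ex_ext => w; rewrite setUA.
ring.
Qed.

Lemma Ex_mono_weight (s : seq E) (W1 W2 : E -> R) f :
  (forall e, 0 <= W1 e <= W2 e) -> incr f ->
  Ex [seq (e, W1 e) | e <- s] f <= Ex [seq (e, W2 e) | e <- s] f.
Proof.
move=> W12 fi.
have -> : [seq (e, W2 e) | e <- s] = [seq (e, W1 e + (W2 e - W1 e)) | e <- s].
  by apply: eq_map => e; rewrite addrC subrK.
rewrite Ex_superpose; apply: Ex_incr_cat => //.
  by move=> p /mapP[e _ ->] /=; have /andP[] := W12 e.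
by move=> p /mapP[e _ ->] /=; rewrite subr_ge0; have /andP[] := W12 e.
Qed.

Lemma Ex_none l (Q : E -> Prop) :
  Ex l (fun w => ind R (forall e, Q e -> ~ w e))
  = expR (- \sum_(p <- l) ind R (Q p.1) * p.2).
Proof.
elim: l => [|[e a] l IH] /=.
  by rewrite big_nil oppr0 expR0 indT// => e _ [].
rewrite big_cons opprD expRD /= -IH.
have [Qe|Qe] := pselect (Q e).
  rewrite (Ex_ext (fun=> 0)); last first.
    by move=> w; rewrite indF// => /(_ _ Qe); apply; left.
  by rewrite Ex_cst mulr0 add0r (indT _ Qe) mul1r.
rewrite (indF _ Qe) mul0r oppr0 expR0 mul1r.
rewrite (Ex_ext (fun w => ind R (forall e, Q e -> ~ w e))); last first.
  move=> w; apply: ind_eq; split=> h e' Qe' we'; apply: (h e' Qe').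
    by right.
  by case: we' => // ee; case: Qe; rewrite -ee.
by rewrite -mulrDl subrK mul1r.
Qed.

Lemma Ex_some l (Q : E -> Prop) : nneg l ->
  Ex l (fun w => ind R (exists2 e, Q e & w e))
    <= \sum_(p <- l) ind R (Q p.1) * p.2.
Proof.
move=> nl.
rewrite (Ex_ext (fun w => 1 - ind R (forall e, Q e -> ~ w e))); last first.
  move=> w; rewrite -ind_not; apply: ind_eq; split.
    by move=> [e Qe we] /(_ _ Qe).
  by move=> h; apply: contrapT => h'; apply: h => e Qe we; apply: h'; exists e.
rewrite ExB Ex_cst Ex_none lerBlDr.
set S := \sum_(_ <- _) _; have := expR_ge1Dx (- S); lra.
Qed.

Lemma Ex_indep l (T : set E) f g :
  Ex l (fun w => f (w `&` T) * g (w `\` T))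
  = Ex l (fun w => f (w `&` T)) * Ex l (fun w => g (w `\` T)).
Proof.
elim: l f g => [|[e a] l IH] f g //=.
have [Te|Te] := pselect (T e).
  have eI w : (e |` w) `&` T = e |` (w `&` T).
    by rewrite setIUl (setIidl (B := T))// => x ->.
  have eD w : (e |` w) `\` T = w `\` T.
    by rewrite setDUl (_ : [set e] `\` T = set0) ?set0U// setD_eq0 => x ->.
  have -> : Ex l (fun w => g ((e |` w) `\` T)) = Ex l (fun w => g (w `\` T)).
    by apply: Ex_ext => w; rewrite eD.
  have -> : Ex l (fun w => f ((e |` w) `&` T) * g ((e |` w) `\` T))
     = Ex l (fun w => (fun v => f (e |` v)) (w `&` T) * g (w `\` T)).
    by apply: Ex_ext => w; rewrite eI eD.
  have -> : Ex l (fun w => f ((e |` w) `&` T))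
     = Ex l (fun w => (fun v => f (e |` v)) (w `&` T)).
    by apply: Ex_ext => w; rewrite eI.
  rewrite (IH (fun v => f (e |` v)) g) (IH f g); ring.
have eI w : (e |` w) `&` T = w `&` T.
  by rewrite setIUl (_ : [set e] `&` T = set0) ?set0U//; apply/seteqP; split => // x [->].
have eD w : (e |` w) `\` T = e |` (w `\` T).
  rewrite setDUl; congr setU; apply/seteqP; split=> [x []//|x ->].
  by split.
have -> : Ex l (fun w => f ((e |` w) `&` T)) = Ex l (fun w => f (w `&` T)).
  by apply: Ex_ext => w; rewrite eI.
have -> : Ex l (fun w => f ((e |` w) `&` T) * g ((e |` w) `\` T))
   = Ex l (fun w => f (w `&` T) * (fun v => g (e |` v)) (w `\` T)).
  by apply: Ex_ext => w; rewrite eI eD.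
have -> : Ex l (fun w => g ((e |` w) `\` T))
   = Ex l (fun w => (fun v => g (e |` v)) (w `\` T)).
  by apply: Ex_ext => w; rewrite eD.
rewrite (IH f (fun v => g (e |` v))) (IH f g); ring.
Qed.

End Ex.
Arguments Ex_ext {R E l f} g _.

(** * Connectivity and tree splitting *)

Section Connectivity.
Variables (R : realType) (V : eqType).
Implicit Types (w : set (V * V)) (x y z : V) (C : set V) (B : seq V).

Definition adj w x y := w (x, y) \/ w (y, x).

Inductive conn w x : V -> Prop :=
| conn0 : conn w x x
| connS y z : conn w x y -> adj w y z -> conn w x z.

(** [ins w C] and [off w C] never share an edge, which is how disjoint witnesses are produced
    below. *)
Definition ins w C : set (V * V) := [set e | [/\ w e, C e.1 & C e.2]].
Definition off w C : set (V * V) := [set e | [/\ w e, ~ C e.1 & ~ C e.2]].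

Lemma ins_sub w C : ins w C `<=` w. Proof. by move=> e []. Qed.
Lemma adj_sym w x y : adj w x y -> adj w y x.
Proof. by case; [right|left]. Qed.

Lemma adj_sub v w x y : v `<=` w -> adj v x y -> adj w x y.
Proof. by move=> vw [/vw|/vw]; [left|right]. Qed.

Lemma conn_sub v w x y : v `<=` w -> conn v x y -> conn w x y.
Proof.
move=> vw; elim=> [|y' z _ h /(adj_sub vw)]; first exact: conn0.
exact: connS.
Qed.

Lemma conn1 w x y : adj w x y -> conn w x y.
Proof. by apply: connS; apply: conn0. Qed.

Lemma conn_trans w y x z : conn w x y -> conn w y z -> conn w x z.
Proof. by move=> h; elim=> // y' z' _ h' /(connS h'). Qed.

Lemma conn_sym w x y : conn w x y -> conn w y x.
Proof.
elim=> [|y' z _ h /adj_sym]; first exact: conn0.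
by move=> /conn1 /conn_trans; apply.
Qed.

(** The edge [(a, b)] is the last one by which the path leaves [C], so that its remainder avoids [C]
    altogether. *)
Lemma conn_exit w C x y : C x -> conn w x y -> ~ C y ->
  exists a b, [/\ C a, ~ C b, adj w a b & conn (off w C) b y].
Proof.
move=> Cx; elim=> // y' z _ IH yz nCz.
have [Cy|nCy] := pselect (C y').
  by exists y', z; split=> //; apply: conn0.
have [a [b [Ca nCb ab h]]] := IH nCy.
exists a, b; split=> //; apply: connS h _.
by case: yz => ?; [left|right].
Qed.

Lemma conn_ins_cluster w x y : conn w x y -> conn (ins w (conn w x)) x y.
Proof.
elim=> [|y' z h1 h2 yz]; first exact: conn0.
apply: connS h2 _; have h3 := connS h1 yz.
by case: yz => ?; [left|right].
Qed.

(** Take for [C] the cluster of [x] in [w]: the last edge leaving it can only be [e]. One endpoint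
    is reached inside the cluster, and the path continues from the other one outside of it. *)
Lemma conn_setU1_box w e x y : conn (e |` w) x y -> ~ conn w x y ->
  box_event (fun v1 v2 => conn v1 x e.1 /\ conn v2 e.2 y) w \/
  box_event (fun v1 v2 => conn v1 x e.2 /\ conn v2 e.1 y) w.
Proof.
move=> cxy ncxy.
have [a [b [Ca nCb ab h]]] := conn_exit (conn0 w x) cxy ncxy.
have he : e = (a, b) \/ e = (b, a).
  case: ab => -[->|ab]; [by left| |by right|].
    by case: nCb; apply: connS Ca _; left.
  by case: nCb; apply: connS Ca _; right.
have sub : off (e |` w) (conn w x) `<=` w.
  move=> e' [[->|//] h1 h2].
  by case: he => ee; [case: h1|case: h2]; rewrite ee.
have dj : ins w (conn w x) `&` off (e |` w) (conn w x) = set0.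
  by apply/seteqP; split=> // e' [[_ h1 _] [_ h2 _]].
by case: he => -> /=; [left|right];
  exists (ins w (conn w x)), (off (e |` w) (conn w x)); split=> //;
  try exact: ins_sub; split=> //; apply: conn_ins_cluster.
Qed.

Definition cl w B x : R := \sum_(y <- B) ind R (conn w x y).

Lemma cl_ge0 w B x : 0 <= cl w B x.
Proof. by apply: sumr_ge0 => y _; exact: ind_ge0. Qed.

Lemma cl_sub v w B x : v `<=` w -> cl v B x <= cl w B x.
Proof. by move=> vw; apply: ler_sum => y _; apply: ind_le; apply: conn_sub. Qed.

Lemma cl_conn w B x y : conn w x y -> cl w B x = cl w B y.
Proof.
move=> xy; apply: eq_bigr => z _; apply: ind_eq; split=> h.
  exact: conn_trans (conn_sym xy) h.
exact: conn_trans xy h.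
Qed.

Lemma ler_sum_sub (s1 s2 : seq V) (P : pred V) (F : V -> R) :
  uniq s1 -> {in s1, forall x, P x -> x \in s2} ->
  (forall x, 0 <= F x) ->
  \sum_(x <- s1 | P x) F x <= \sum_(x <- s2) F x.
Proof.
move=> u1 s12 F0.
rewrite -big_filter.
have : {subset [seq x <- s1 | P x] <= s2}.
  by move=> x; rewrite mem_filter => /andP[Px xs]; apply: s12.
move: (filter_uniq P u1); move: [seq x <- s1 | P x] => s {u1 s12}.
elim: s s2 => [|x s IH] s2 /=.
  by rewrite big_nil sumr_ge0.
move=> /andP[xs us] ss; rewrite big_cons [leRHS](big_rem x) /=; last first.
  by apply: ss; rewrite mem_head.
apply: lerD => //; apply: IH => // y ys.
have : y \in s2 by apply: ss; rewrite inE ys orbT.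
rewrite (perm_mem (perm_to_rem (x := x) _)); last by apply: ss; rewrite mem_head.
by rewrite inE => /orP[/eqP yx|//]; rewrite -yx ys in xs.
Qed.

Lemma cl_subset w B B' x : uniq B -> {subset B <= B'} -> cl w B x <= cl w B' x.
Proof.
move=> uB BB'; apply: ler_sum_sub => //.
  by move=> y yB _; exact: BB'.
Qed.

(** The list is in order of growth, latest first: the head is a leaf whose parent lies in the tail,
    and the tail is again a tree. Leaves can thus be peeled by induction. *)
Inductive tree w x : seq V -> Prop :=
| tree1 : tree w x [:: x]
| treeS s p c : tree w x s -> p \in s -> c \notin s -> adj w p c ->
    tree w x (c :: s).

Lemma tree_uniq w x s : tree w x s -> uniq s.
Proof. by elim=> //= s' p c _ -> _ ->. Qed.

Lemma tree_conn w x s : tree w x s ->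
  {in s, forall y, conn (ins w [set` s]) x y}.
Proof.
elim=> [y|s' p c _ IH ps cs pc y]; first by rewrite inE => /eqP ->; exact: conn0.
have sub : ins w [set` s'] `<=` ins w [set` c :: s'].
  by move=> e [we h1 h2]; split=> //=; rewrite inE ?(h1 : _ \in s') ?(h2 : _ \in s') orbT.
rewrite inE => /orP[/eqP ->|ys]; last exact: conn_sub sub (IH _ ys).
apply: connS (conn_sub sub (IH _ ps)) _.
have cs' : c \in c :: s' by rewrite mem_head.
have ps' : p \in c :: s' by rewrite inE ps orbT.
by case: pc => ?; [left|right].
Qed.

Lemma tree_ext w x y s : tree w x s -> conn w x y ->
  exists2 s', tree w x s' & {subset s <= s'} /\ y \in s'.
Proof.
move=> ts; elim=> [|y' z _ [s' ts' [ss ys]] yz].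
  exists s => //; split=> //.
  by elim: ts => [|s' p c _ h _ _ _]; rewrite inE ?eqxx// h orbT.
have [zs|zs] := boolP (z \in s'); first by exists s'.
exists (z :: s'); first exact: treeS ys zs yz.
by split=> [v /ss vs|]; rewrite inE ?vs ?orbT ?eqxx.
Qed.

Lemma tree_exists w x B :
  exists2 s, tree w x s & {in B, forall y, conn w x y -> y \in s}.
Proof.
elim: B => [|y B [s ts IH]]; first by exists [:: x] => //; exact: tree1.
have [xy|xy] := pselect (conn w x y); last first.
  by exists s => // z; rewrite inE => /orP[/eqP ->//|]; apply: IH.
have [s' ts' [ss ys]] := tree_ext ts xy.
exists s' => // z; rewrite inE => /orP[/eqP ->//|zB xz].
by apply: ss; apply: IH.
Qed.

Lemma sum_indic (s : seq V) (U : pred V) p (a : R) : uniq s -> p \in s ->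
  \sum_(y <- s | U y) (y == p)%:R * a = (U p)%:R * a.
Proof.
move=> us ps; rewrite big_mkcond (bigD1_seq p)//= eqxx big1 ?addr0.
  by case: (U p); rewrite ?mul1r ?mul0r.
by move=> y /negbTE ->; case: (U y); rewrite ?mul0r.
Qed.

(* Peel leaves off the tree, moving their mass to their parents, until some
   vertex carries mass at least [t]. *)
Lemma tree_split w x s (t : R) (a : V -> R) : tree w x s ->
  {in s, forall v, 0 <= a v < t} -> t <= \sum_(v <- s) a v ->
  exists (A B : set (V * V)) v (U : pred V),
    [/\ A `<=` ins w [set` s], B `<=` ins w [set` s], A `&` B = set0,
       {in s, forall y, if U y then conn A v y else conn B x y} &
       t <= \sum_(y <- s | U y) a y < t + t].
Proof.
move=> ts; elim: ts a => [|s' p c ts IH ps cs pc] a ha.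
  have /andP[_ h] := ha x (mem_head _ _).
  by rewrite big_seq1 leNgt h.
have us := tree_uniq ts.
have pnc : p != c by apply: contraNneq cs => <-.
have hap : 0 <= a p < t by apply: ha; rewrite inE ps orbT.
have hac : 0 <= a c < t by apply: ha; rewrite mem_head.
have insS : ins w [set` s'] `<=` ins w [set` c :: s'].
  by move=> e [we h1 h2]; split=> //=; rewrite inE ?(h1 : _ \in s') ?(h2 : _ \in s') orbT.
have [e [we ecp eadj]] : exists e, [/\ ins w [set` c :: s'] e,
    e = (p, c) \/ e = (c, p) & adj [set e] p c].
  have cs' : c \in c :: s' by rewrite mem_head.
  have ps' : p \in c :: s' by rewrite inE ps orbT.
  by case: pc => h; [exists (p, c)|exists (c, p)]; split=> //;
    [left|left|right|right].
have ne : ~ ins w [set` s'] e.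
  by case: ecp => -> [_ /= h1 h2]; rewrite ?h1 ?h2 in cs.
(* Both masses are below [t], so their sum lies between [t] and [2t]: the heavy piece is [p], [c]
   with the single edge [e], and the tree on [s'] keeps all its edges for the other piece. *)
have [apc _|apc] := leP t (a p + a c).
  exists [set e], (ins w [set` s']), p, (pred2 p c); split=> //.
  - by move=> _ ->.
  - by apply/seteqP; split=> // e' [-> /ne].
  - move=> y; rewrite inE /= => ys; case: ifPn => [/orP[]/eqP ->|].
    + exact: conn0.
    + exact: conn1.
    + rewrite negb_or => /andP[_ yc]; rewrite (negbTE yc) /= in ys.
      exact: (tree_conn ts).
  - rewrite big_cons /= eqxx orbT.
    have -> : \sum_(j <- s' | (j == p) || (j == c)) a j = a p.
      rewrite big_mkcond (bigD1_seq p)//= eqxx /= big_seq_cond big1 ?addr0//.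
      move=> y /andP[ys /negbTE ->] /=; case: eqP => // yc.
      by rewrite yc (negbTE cs) in ys.
    by rewrite addrC apc; lra.
pose a' y := a y + (y == p)%:R * a c.
rewrite big_cons => tot.
have [||A [B [v [U [As Bs AB hU sU]]]]] := IH a'.
- move=> y ys; rewrite /a'; case: eqP => [->|_]; rewrite ?mul1r ?mul0r ?addr0; first lra.
  by apply: ha; rewrite inE ys orbT.
- by rewrite big_split /= sum_indic// mul1r addrC.
have adjU (D : set (V * V)) : adj (e |` D) p c.
  by apply: adj_sub eadj => e' ->; left.
have subU (D : set (V * V)) : D `<=` e |` D by exact: subsetUr.
have [Up|nUp] := boolP (U p).
  exists (e |` A), B, v, (fun y => U y || (y == c)); split.
  - by move=> e' [->//|/As/insS].
  - by move=> e' /Bs/insS.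
  - apply/seteqP; split=> // e' [[->|]] => [/Bs/ne//|Ae Be].
    by rewrite -AB; split.
  - move=> y; rewrite inE; case: (eqVneq y c) => [-> _|yc /= ys].
      rewrite orbT; apply: connS (adjU A).
      by have := hU p ps; rewrite Up; exact: conn_sub.
    by rewrite orbF; have := hU y ys; case: ifP => // _; exact: conn_sub.
  - rewrite big_cons eqxx orbT.
    rewrite [\sum_(j <- s' | _) _](_ : _ = \sum_(j <- s' | U j) a j); last first.
      rewrite big_seq_cond [RHS]big_seq_cond; apply: eq_bigl => y.
      case: (boolP (y \in s')) => //= ys; case: eqP => [yc|]; rewrite ?orbF//.
      by rewrite -yc ys in cs.
    by move: sU; rewrite big_split /= sum_indic// Up mul1r addrC.
exists A, (e |` B), v, (fun y => U y && (y != c)); split.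
- by move=> e' /As/insS.
- by move=> e' [->//|/Bs/insS].
- apply/seteqP; split=> // e' [Ae [ee|Be]]; first by case: ne; rewrite -ee; exact: As.
  by rewrite -AB; split.
- move=> y; rewrite inE; case: (eqVneq y c) => [-> _|yc /= ys].
    rewrite andbF; apply: connS (adjU B).
    by have := hU p ps; rewrite (negbTE nUp); exact: conn_sub.
  by rewrite andbT; have := hU y ys; case: ifP => // _; exact: conn_sub.
- rewrite big_cons eqxx andbF.
  rewrite [\sum_(j <- s' | _) _](_ : _ = \sum_(j <- s' | U j) a j); last first.
    rewrite big_seq_cond [RHS]big_seq_cond; apply: eq_bigl => y.
    case: (boolP (y \in s')) => //= ys; case: eqP => [yc|]; rewrite ?andbT//.
    by rewrite -yc ys in cs.
  by move: sU; rewrite big_split /= sum_indic// (negbTE nUp) mul0r addr0.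
Qed.

(** Each point of [B] gets mass one. The heavy piece carries less than [2t] of the total [3t], so
    more than [t] stays joined to [x] by the other edges. *)
Lemma cl_split w x B (t : R) : uniq B -> 0 < t -> t + t + t <= cl w B x ->
  box_event (fun v1 v2 => t <= cl v1 B x /\ exists v, t <= cl v2 B v) w.
Proof.
move=> uB t0 tcl.
(* For [t <= 1] the unit masses are not below [t] and [tree_split] does not apply, but a single
   point then suffices, joined to itself by no edge. *)
have [t1|t1] := leP t 1.
  have [y [yB xy]] : exists y, y \in B /\ conn w x y.
    apply: contrapT => h; move: tcl; rewrite /cl big_seq big1 => [|y yB]; first lra.
    by rewrite indF// => xy; apply: h; exists y.
  exists w, set0; split=> //; first by rewrite setI0.
  have one D z : conn D z y -> 1 <= cl D B z.
    by move=> zy; rewrite /cl (big_rem y)//= (indT _ zy) lerDl sumr_ge0.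
  split; first exact: le_trans t1 (one _ _ xy).
  by exists y; apply: le_trans t1 (one _ _ _); exact: conn0.
have [s ts sB] := tree_exists w x B.
have us := tree_uniq ts.
have cnt : cl w B x <= \sum_(y <- s) (y \in B)%:R.
  rewrite /cl (bigID (mem s)) /= [X in _ + X]big_seq_cond [X in _ + X]big1 ?addr0; last first.
    by move=> y /andP[yB ys]; rewrite indF// => /(sB y yB); apply/negP.
  apply: le_trans (ler_sum _ (fun y _ => ind_le1 _ _)) _.
  rewrite [leRHS](bigID (mem B)) /= [X in _ <= _ + X]big1 ?addr0; last by move=> y /negbTE ->.
  rewrite -big_filter -[leRHS]big_filter.
  have -> : \sum_(i <- [seq i <- s | i \in B]) (i \in B)%:R
     = \sum_(i <- [seq i <- s | i \in B]) 1 :> R.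
    by rewrite big_filter [RHS]big_filter; apply: eq_bigr => y ->.
  rewrite (perm_big [seq i <- s | i \in B])//; apply: uniq_perm.
  - exact: filter_uniq.
  - exact: filter_uniq.
  - by move=> y; rewrite !mem_filter andbC.
have [||A [D [v [U [As Ds AD hU /andP[U1 U2]]]]]] :=
  @tree_split w x s t (fun y => (y \in B)%:R) ts.
- by move=> y _ /=; case: (y \in B) => //=; rewrite ?ler01 ?t1 ?lexx ?t0.
- by apply: le_trans cnt; lra.
exists D, A; split.
- by move=> e /Ds[].
- by move=> e /As[].
- by rewrite setIC.
have cntB E' z (P : pred V) : {in s, forall y, P y -> conn E' z y} ->
    \sum_(y <- s | P y) (y \in B)%:R <= cl E' B z.
  move=> hP.
  apply: (@le_trans _ _ (\sum_(y <- s | P y && (y \in B)) ind R (conn E' z y))).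
    rewrite big_mkcondr /= big_seq_cond [leRHS]big_seq_cond.
    apply: ler_sum => y /andP[ys Py]; rewrite (indT _ (hP _ ys Py)).
    by case: (y \in B).
  by apply: ler_sum_sub => // y _ /andP[].
have tot : \sum_(y <- s) (y \in B)%:R = \sum_(y <- s | U y) (y \in B)%:R
    + \sum_(y <- s | ~~ U y) (y \in B)%:R :> R by rewrite (bigID U).
split.
  have h : \sum_(y <- s | ~~ U y) (y \in B)%:R <= cl D B x.
    by apply: cntB => y ys /negbTE Uy; have := hU y ys; rewrite Uy.
  by apply: le_trans h; move: cnt; rewrite tot; lra.
exists v; apply: le_trans U1 _.
by apply: cntB => y ys Uy; have := hU y ys; rewrite Uy.
Qed.

End Connectivity.

(** * Universal tightness *)

Section Tightness.
Variables (R : realType) (V : eqType).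
Implicit Types (l h g : seq ((V * V) * R)) (w : set (V * V)) (x y z : V) (B : seq V).
Local Notation cl := (cl R).

Lemma incr_conn x y : incr (fun w => ind R (conn w x y)).
Proof. by move=> v w vw; apply: ind_le; exact: conn_sub. Qed.

Lemma incr_cl B x : incr (fun w => cl w B x).
Proof. by move=> v w; exact: cl_sub. Qed.

Lemma incr_clmax_ge B t : incr (fun w => ind R (exists x, t <= cl w B x)).
Proof.
by move=> v w vw; apply: ind_le => -[x xt]; exists x; apply: le_trans xt (cl_sub _ _ _ vw).
Qed.

Lemma incr_min_cl B x t : incr (fun w => Num.min (cl w B x) t).
Proof.
move=> v w vw; rewrite le_min !ge_min lexx orbT andbT.
by rewrite (cl_sub R B x vw).
Qed.

Lemma tight_at l B x t : nneg l -> uniq B -> 0 < t ->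
  Ex l (fun w => ind R (t + t + t <= cl w B x)) <=
  Ex l (fun w => ind R (t <= cl w B x)) *
  Ex l (fun w => ind R (exists v, t <= cl w B v)).
Proof.
move=> nl uB t0.
apply: (@le_trans _ _ (Ex l (fun w => ind R (box_event (fun v1 v2 =>
    t <= cl v1 B x /\ exists v, t <= cl v2 B v) w)))).
  by apply: Ex_le => // w; apply: ind_le; exact: cl_split.
apply: (@Ex_BK_prod _ _ l (fun v => t <= cl v B x)
    (fun v => exists y, t <= cl v B y)) => // v w vw.
  by move=> /le_trans; apply; exact: cl_sub.
by move=> [y h]; exists y; apply: le_trans h (cl_sub _ _ _ vw).
Qed.

Lemma tight_max l B t : nneg l -> uniq B -> 0 < t ->
  Ex l (fun w => ind R (exists v, t + t + t <= cl w B v)) <=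
  Ex l (fun w => ind R (exists v, t <= cl w B v)) ^+ 2.
Proof.
move=> nl uB t0; rewrite expr2.
apply: (@le_trans _ _ (Ex l (fun w => ind R (box_event (fun v1 v2 =>
    (exists v, t <= cl v1 B v) /\ exists v, t <= cl v2 B v) w)))).
  apply: Ex_le => // w; apply: ind_le => -[x /(cl_split uB t0)].
  move=> [v1 [v2 [h1 h2 dj [p q]]]]; exists v1, v2; split=> //; split=> //.
  by exists x.
apply: (@Ex_BK_prod _ _ l (fun v => exists y, t <= cl v B y)
    (fun v => exists y, t <= cl v B y)) => // v w vw [y h];
  by exists y; apply: le_trans h (cl_sub _ _ _ vw).
Qed.

Lemma cl_le_size w B x : cl w B x <= (size B)%:R.
Proof.
apply: le_trans (ler_sum _ (fun y _ => ind_le1 R _)) _.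
by rewrite big_const_seq count_predT iter_addr_0.
Qed.

(** Tripling the level multiplies the tail by at most [1/4], so passing from level [3^k t] to
    [3^(k+1) t] adds at most [2 * (3/4)^k] times the truncated mean; the series gives
    [1 + 2 * 4 = 9]. The levels eventually exceed [size B], where truncation has no effect. *)
Lemma tight_truncate l B x t : nneg l -> uniq B -> 0 < t ->
  Ex l (fun w => ind R (exists v, t <= cl w B v)) <= 4^-1 ->
  Ex l (fun w => cl w B x) <= 9 * Ex l (fun w => Num.min (cl w B x) t).
Proof.
move=> nl uB t0 hmax.
set m := Ex l (fun w => Num.min (cl w B x) t).
pose p s := Ex l (fun w => ind R (s <= cl w B x)).
have three k : 3 ^+ k.+1 * t = 3 ^+ k * t + 3 ^+ k * t + 3 ^+ k * t.
  by rewrite exprS; ring.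
have gek k : t <= 3 ^+ k * t.
  by apply: ler_peMl; [exact: ltW|apply: exprn_ege1; rewrite ler1n].
have pk k : p (3 ^+ k * t) <= 4^-1 ^+ k * p t.
  elim: k => [|k IH]; first by rewrite !expr0 !mul1r.
  have s0 : 0 < 3 ^+ k * t by rewrite mulr_gt0// exprn_gt0.
  apply: (@le_trans _ _ (p (3 ^+ k * t) * 4^-1)).
    rewrite three; apply: le_trans (tight_at x nl uB s0) _.
    apply: ler_wpM2l; first by apply: Ex_ge0 => // w; exact: ind_ge0.
    apply: le_trans hmax; apply: Ex_le => // w; apply: ind_le => -[v hv].
    by exists v; apply: le_trans hv.
  by rewrite exprS -mulrA mulrC ler_pM2l// invr_gt0.
have pm : t * p t <= m.
  rewrite -ExZ; apply: Ex_le => // w.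
  have [h|h] := pselect (t <= cl w B x); first by rewrite (indT _ h) mulr1 le_min lexx h.
  by rewrite (indF _ h) mulr0 le_min cl_ge0 ltW.
have mk k : Ex l (fun w => Num.min (cl w B x) (3 ^+ k * t))
    <= (9 - 8 * (3 / 4) ^+ k) * m.
  elim: k => [|k IH]; first by rewrite !expr0 mul1r mulr1 -/m; lra.
  have q0 : 0 <= (3 / 4 : R) ^+ k by rewrite exprn_ge0//; lra.
  have st : Ex l (fun w => Num.min (cl w B x) (3 ^+ k.+1 * t)) <=
     Ex l (fun w => Num.min (cl w B x) (3 ^+ k * t) +
         (2 * (3 ^+ k * t)) * ind R (3 ^+ k * t <= cl w B x)).
    apply: Ex_le => // w; rewrite three.
    have s0 : 0 <= 3 ^+ k * t by apply: le_trans (gek k); exact: ltW.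
    move: (3 ^+ k * t) s0 => s s0.
    have [h|h] := pselect (s <= cl w B x).
      rewrite (indT _ h) mulr1.
      by rewrite (min_r h) ge_min; apply/orP; right; lra.
    rewrite (indF _ h) mulr0 addr0 [in leRHS]min_l ?ge_min ?lexx//.
    by move/negP: h; rewrite -ltNge => /ltW.
  apply: le_trans st _; rewrite ExD ExZ -/(p _).
  have h1 : 2 * (3 ^+ k * t) * p (3 ^+ k * t) <= 2 * (3 / 4) ^+ k * m.
    rewrite -!mulrA ler_pM2l//.
    apply: (@le_trans _ _ (3 ^+ k * (t * (4^-1 ^+ k * p t)))).
      rewrite ler_pM2l ?exprn_gt0// ler_pM2l//.
    rewrite (_ : _ * _ = (3 / 4) ^+ k * (t * p t)); last first.
      by rewrite [(3 / 4) ^+ k]exprMn -!mulrA (mulrCA t).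
    by apply: ler_wpM2l.
  apply: le_trans (lerD IH h1) _.
  have -> : (3 / 4 : R) ^+ k.+1 = 3 / 4 * (3 / 4) ^+ k by rewrite exprS.
  have m0 : 0 <= m.
    by apply: Ex_ge0 => // w; rewrite le_min cl_ge0 ltW.
  by move: ((3 / 4) ^+ k) => q; lra.
pose k := (Num.truncn ((size B)%:R / t)).+1.
have hk : (size B)%:R <= 3 ^+ k * t.
  have : (size B)%:R / t <= 3 ^+ k.
    apply: le_trans (ltW (truncnS_gt _)) _.
    rewrite -natrX ler_nat; apply: ltnW; exact: ltn_expl.
  by rewrite ler_pdivrMr.
have -> : Ex l (fun w => cl w B x) = Ex l (fun w => Num.min (cl w B x) (3 ^+ k * t)).
  apply: Ex_ext => w; apply/esym/min_idPl.
  exact: le_trans (cl_le_size _ _ _) hk.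
apply: le_trans (mk k) _.
have m0 : 0 <= m.
  by apply: Ex_ge0 => // w; rewrite le_min cl_ge0 ltW.
apply: ler_wpM2r => //.
have : 0 <= (3 / 4 : R) ^+ k by rewrite exprn_ge0//; lra.
lra.
Qed.

(** Clocks of [h] are added one at a time. A connection that needs the new edge splits into disjoint
    connections to its two ends, and the edge opens with probability at most its intensity. The
    function [T] bounds connections in the full configuration, hence at every intermediate stage. *)
Lemma Ex_conn_add h g (T : V -> V -> R) x y : nneg h -> nneg g ->
  (forall u v, Ex (h ++ g) (fun w => ind R (conn w u v)) <= T u v) ->
  Ex (h ++ g) (fun w => ind R (conn w x y)) <=
  Ex g (fun w => ind R (conn w x y)) +
  \sum_(p <- h) p.2 * (T x p.1.1 * T p.1.2 y + T x p.1.2 * T p.1.1 y).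
Proof.
move=> nh ng; elim: h nh => [|[e a] h IH] nh hT.
  by rewrite big_nil addr0.
have [a0 nh'] := nneg_cons nh.
have nhg : nneg (h ++ g) by apply/nneg_cat.
have hT' u v : Ex (h ++ g) (fun w => ind R (conn w u v)) <= T u v.
  apply: le_trans (hT u v); apply: Ex_cons_ge; last exact: incr_conn.
  by apply/(nneg_cat ((e, a) :: h) g); split.
have T0 u v : 0 <= T u v.
  by apply: le_trans (hT' u v); apply: Ex_ge0 => // w; exact: ind_ge0.
have IH' := IH nh' hT'.
rewrite big_cons /= (addrC (a * _)) addrA.
have /andP[q0 q1] := expRN_itv a0.
pose S := T x e.1 * T e.2 y + T x e.2 * T e.1 y.
have step : Ex (h ++ g) (fun w => ind R (conn (e |` w) x y)) <=
    Ex (h ++ g) (fun w => ind R (conn w x y)) + S.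
  apply: (@le_trans _ _ (Ex (h ++ g) (fun w => ind R (conn w x y) +
     (ind R (box_event (fun v1 v2 => conn v1 x e.1 /\ conn v2 e.2 y) w) +
      ind R (box_event (fun v1 v2 => conn v1 x e.2 /\ conn v2 e.1 y) w))))).
    apply: Ex_le => // w.
    have [c|nc] := pselect (conn w x y).
      rewrite (indT _ c); apply: le_trans (ind_le1 _ _) _.
      by rewrite lerDl addr_ge0// ind_ge0.
    rewrite (indF _ nc) add0r.
    have [c|c] := pselect (conn (e |` w) x y); last first.
      by rewrite (indF _ c) addr_ge0// ind_ge0.
    rewrite (indT _ c).
    by case: (conn_setU1_box c nc) => h'; rewrite (indT _ h') ?lerDl ?lerDr ind_ge0.
  rewrite !ExD lerD2l; apply: lerD.
    apply: le_trans (Ex_BK_prod (P := fun v => conn v x e.1)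
      (Q := fun v => conn v e.2 y) nhg _ _) _;
      try by move=> v w vw; exact: conn_sub.
    by apply: ler_pM; rewrite ?hT' ?Ex_ge0// => w; exact: ind_ge0.
  apply: le_trans (Ex_BK_prod (P := fun v => conn v x e.2)
    (Q := fun v => conn v e.1 y) nhg _ _) _;
    try by move=> v w vw; exact: conn_sub.
  by apply: ler_pM; rewrite ?hT' ?Ex_ge0// => w; exact: ind_ge0.
apply: (@le_trans _ _ (Ex (h ++ g) (fun w => ind R (conn w x y)) + a * S)); last first.
  by apply: lerD.
have S0 : 0 <= S by rewrite addr_ge0// mulr_ge0.
have qa : 1 - expR (- a) <= a by have := expR_ge1Dx (- a); lra.
move: step qa q0 q1 => /=.
set E1 := Ex _ (fun w => ind R (conn (e |` w) x y)).
set E0 := Ex _ (fun w => ind R (conn w x y)).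
move: (expR (- a)) => q step qa q0 q1.
have h1 : (1 - q) * E1 <= (1 - q) * (E0 + S) by apply: ler_wpM2l; rewrite ?subr_ge0.
have h2 : (1 - q) * S <= a * S by apply: ler_wpM2r.
lra.
Qed.

End Tightness.

(** * Percolation on the pairs of a finite vertex set *)

Section Edges.
Variables (R : realType) (V : eqType).
Implicit Types (W : V -> V -> R) (w : set (V * V)) (x y z : V) (A B : seq V).
Local Notation cl := (cl R).

Definition pairs A : seq (V * V) := [seq (x, y) | x <- A, y <- A].
Definition edges A W := [seq (e, W e.1 e.2) | e <- pairs A].

Lemma mem_pairs A e : (e \in pairs A) = (e.1 \in A) && (e.2 \in A).
Proof.
case: e => x y /=; apply/allpairsP/andP => [[[a b] /= [aA bA [-> ->]]]//|[xA yA]].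
by exists (x, y).
Qed.

Lemma pairs_uniq A : uniq A -> uniq (pairs A).
Proof. by move=> uA; apply: allpairs_uniq => // -[a b] [c d]. Qed.

Lemma edges_nneg A W : (forall x y, 0 <= W x y) -> nneg (edges A W).
Proof. by move=> W0 p /mapP[e _ ->]; exact: W0. Qed.

Lemma sum_edges A W (F : V * V -> R -> R) :
  \sum_(p <- edges A W) F p.1 p.2 = \sum_(x <- A) \sum_(y <- A) F (x, y) (W x y).
Proof. by rewrite big_map /= big_allpairs_dep. Qed.

Lemma Ex_edges_weight A W1 W2 f : (forall x y, 0 <= W1 x y <= W2 x y) ->
  incr f -> Ex (edges A W1) f <= Ex (edges A W2) f.
Proof.
move=> W12 fi; exact: (Ex_mono_weight (W1 := fun e => W1 e.1 e.2)
  (W2 := fun e => W2 e.1 e.2) _ (fun e => W12 e.1 e.2) fi).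
Qed.

Lemma Ex_edges_add A W1 W2 f :
  Ex (edges A (fun x y => W1 x y + W2 x y)) f = Ex (edges A W1 ++ edges A W2) f.
Proof.
exact: (Ex_superpose (pairs A) (fun e => W1 e.1 e.2) (fun e => W2 e.1 e.2)).
Qed.

Lemma edges_split A B W : uniq A -> uniq B -> {subset A <= B} ->
  perm_eq (edges B W)
    (edges A W ++ [seq (e, W e.1 e.2) | e <- pairs B & e \notin pairs A]).
Proof.
move=> uA uB AB; rewrite -map_cat; apply: perm_map.
have hp : perm_eq [seq e <- pairs B | e \in pairs A] (pairs A).
  apply: uniq_perm; rewrite ?filter_uniq ?pairs_uniq// => e.
  rewrite mem_filter; case: (boolP (e \in pairs A)) => //=.
  by rewrite !mem_pairs => /andP[/AB -> /AB ->].
rewrite perm_sym; apply: perm_trans (permEl (perm_filterC (mem (pairs A)) _)).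
by rewrite perm_cat2r perm_sym.
Qed.

Lemma Ex_edges_sub A B W f : uniq A -> uniq B -> {subset A <= B} ->
  (forall x y, 0 <= W x y) -> incr f -> Ex (edges A W) f <= Ex (edges B W) f.
Proof.
move=> uA uB AB W0 fi; rewrite (Ex_perm _ (edges_split W uA uB AB)).
by apply: Ex_incr_cat => // p /mapP[e _ ->]; exact: W0.
Qed.

Lemma Ex_map (E1 E2 : eqType) (phi : E1 -> E2) (l : seq (E1 * R)) f :
  Ex [seq (phi p.1, p.2) | p <- l] f = Ex l (fun s : set E1 => f (phi @` s)).
Proof.
elim: l f => [|[e a] l IH] f /=; first by rewrite image_set0.
rewrite !IH; congr (_ * _ + _); apply: Ex_ext => w.
by rewrite image_setU image_set1.
Qed.

Lemma conn_image (phi : V -> V) w x y : injective phi ->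
  conn ((fun e => (phi e.1, phi e.2)) @` w) (phi x) (phi y) <-> conn w x y.
Proof.
move=> phi_inj; split.
  move=> h; have : exists2 v, phi y = phi v & conn w x v.
    elim: h => [|_ z _ [v -> xv] yz]; first by exists x => //; exact: conn0.
    case: yz => -[[a b] wab] /= [e1 e2].
      by exists b => //; apply: connS xv _; left; rewrite -(phi_inj _ _ e1).
    by exists a => //; apply: connS xv _; right; rewrite -(phi_inj _ _ e2).
  by move=> [v /phi_inj ->].
elim=> [|y' z _ h yz]; first exact: conn0.
by apply: connS h _; case: yz => ?; [left; exists (y', z)|right; exists (z, y')].
Qed.

End Edges.

(** * Finite-volume comparison *)

Section Support.
Variables (R : realType) (E : eqType).

Lemma Ex_le_supp (l : seq (E * R)) f g : nneg l ->
  (forall w, w `<=` [set` unzip1 l] -> f w <= g w) -> Ex l f <= Ex l g.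
Proof.
elim: l f g => [|[e a] l IH] f g /=; first by move=> _; apply.
move=> /nneg_cons[a0 nl] fg; have /andP[h0 h1] := expRN_itv a0.
apply: lerD; apply: ler_wpM2l; rewrite ?subr_ge0//; apply: IH => // w wl; apply: fg.
  by move=> e' [->|/wl] /=; rewrite inE ?eqxx// => ->; rewrite orbT.
by move=> e' /wl /=; rewrite inE => ->; rewrite orbT.
Qed.

Lemma Ex_eq_supp (l : seq (E * R)) f g : nneg l ->
  (forall w, w `<=` [set` unzip1 l] -> f w = g w) -> Ex l f = Ex l g.
Proof.
by move=> nl fg; apply/le_anti/andP; split; apply: Ex_le_supp => // w /fg ->.
Qed.

End Support.

(** * Gluing by sprinkling, and the finite-size criterion for the susceptibility *)

Section Sprinkling.
Variables (R : realType) (V : eqType).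
Implicit Types (W : V -> V -> R) (w : set (V * V)) (x y z : V) (A B S : seq V).
Local Notation cl := (cl R).

Lemma unzip1_edges A W : unzip1 (edges A W) = pairs A.
Proof. by rewrite /unzip1 -map_comp map_id_in. Qed.

Lemma Ex_edges_ins A S W f : uniq A -> uniq S -> {subset S <= A} ->
  (forall x y, 0 <= W x y) ->
  Ex (edges A W) (fun w => f (ins w [set` S])) = Ex (edges S W) f.
Proof.
move=> uA uS SA W0.
rewrite (Ex_perm _ (edges_split W uS uA SA)) Ex_cat.
apply: Ex_eq_supp; first exact: edges_nneg.
rewrite unzip1_edges => v vS.
rewrite -[RHS](Ex_cst [seq (e, W e.1 e.2) | e <- pairs A & e \notin pairs S]).
apply: Ex_eq_supp; first by move=> p /mapP[e _ ->]; exact: W0.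
move=> w wS; congr f; apply/seteqP; split => e.
  move=> [[//|/wS /=]]; rewrite /unzip1 -map_comp map_id_in// mem_filter !mem_pairs.
  by move=> /andP[/negP h _] h1 h2; case: h; apply/andP; split.
move=> ve; have := vS _ ve; rewrite /= mem_pairs => /andP[h1 h2].
by split => //; left.
Qed.

Lemma Ex_edges_ins_le A S W f : uniq A -> uniq S ->
  (forall x y, 0 <= W x y) -> incr f ->
  Ex (edges A W) (fun w => f (ins w [set` S])) <= Ex (edges S W) f.
Proof.
move=> uA uS W0 fi.
rewrite -(@Ex_edges_ins (undup (A ++ S)) S W f) ?undup_uniq//; last first.
  by move=> x xS; rewrite mem_undup mem_cat xS orbT.
apply: Ex_edges_sub => //; first exact: undup_uniq.
  by move=> x xS; rewrite mem_undup mem_cat xS.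
by move=> v w vw; apply: fi => e [/vw ? ? ?]; split.
Qed.

(** If [v] and [v'] are not yet connected, their clusters are disjoint, so all the pairs between
    them consist of distinct points and carry intensity at least [eps]; one open pair is enough. *)
Lemma sprinkle A B1 B2 W w v v' (eps : R) : uniq B1 -> uniq B2 ->
  {subset B1 <= A} -> {subset B2 <= A} -> (forall x y, 0 <= W x y) ->
  {in B1 & B2, forall x y, x != y -> eps <= W x y} ->
  1 - expR (- (eps * cl w B1 v * cl w B2 v')) <=
  Ex (edges A W) (fun w2 => ind R (conn (w `|` w2) v v')).
Proof.
move=> u1 u2 s1 s2 W0 Weps.
have nA : nneg (edges A W) by exact: edges_nneg.
have [cvv|ncvv] := pselect (conn w v v').
  rewrite (Ex_ext (fun=> 1)) ?Ex_cst ?gerBl ?expR_ge0// => w2.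
  by rewrite indT//; apply: conn_sub cvv; exact: subsetUl.
pose Q (e : V * V) := conn w v e.1 /\ conn w v' e.2.
have h : Ex (edges A W) (fun w2 => 1 - ind R (forall e, Q e -> ~ w2 e)) <=
    Ex (edges A W) (fun w2 => ind R (conn (w `|` w2) v v')).
  apply: Ex_le => // w2; rewrite -ind_not; apply: ind_le => h.
  apply: contrapT => nc; apply: h => -[a b] [/= ha hb] w2ab; apply: nc.
  apply: conn_trans (conn_sym (conn_sub (@subsetUl _ _ _) hb)).
  apply: connS (conn_sub (@subsetUl _ _ _) ha) _.
  by left; right.
apply: le_trans h; rewrite ExB Ex_cst Ex_none lerD2l lerN2 ler_expR lerN2.
rewrite (sum_edges A W (fun e a => ind R (Q e) * a)).
have F0 x y : 0 <= ind R (Q (x, y)) * W x y by rewrite mulr_ge0 ?ind_ge0.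
rewrite /cl -mulrA big_distrlr /= mulr_sumr.
apply: (@le_trans _ _ (\sum_(x <- B1) \sum_(y <- A) ind R (Q (x, y)) * W x y)); last first.
  by apply: ler_sum_sub => // [x xB _|x]; [exact: s1|exact: sumr_ge0].
rewrite big_seq_cond [leRHS]big_seq_cond; apply: ler_sum => x /andP[xB _].
rewrite mulr_sumr.
apply: (@le_trans _ _ (\sum_(y <- B2) ind R (Q (x, y)) * W x y)); last first.
  by apply: ler_sum_sub => // y yB _; exact: s2.
rewrite big_seq_cond [leRHS]big_seq_cond; apply: ler_sum => y /andP[yB _].
rewrite ind_and /=.
have [hx|hx] := pselect (conn w v x); last by rewrite (indF _ hx) !mul0r mulr0.
have [hy|hy] := pselect (conn w v' y); last by rewrite (indF _ hy) !mulr0 mul0r.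
rewrite (indT _ hx) (indT _ hy) !mulr1 mul1r; apply: Weps => //.
apply: contra_notN ncvv => /eqP xy; rewrite xy in hx.
exact: conn_trans hx (conn_sym hy).
Qed.

Lemma one_minus_exp_ge (z z0 M : R) : 0 <= z0 -> z0 <= z -> z0 <= M ->
  z0 / (1 + M) <= 1 - expR (- z).
Proof.
move=> z00 z0z z0M.
have h1 : expR (- z) <= (1 + z0)^-1.
  rewrite expRN lef_pV2 ?posrE ?expR_gt0//; last lra.
  by apply: le_trans (expR_ge1Dx _); lra.
have h2 : 1 - (1 + z0)^-1 = z0 / (1 + z0) by field; lra.
apply: (@le_trans _ _ (z0 / (1 + z0))); last by rewrite -h2 lerD2l lerN2.
by apply: ler_wpM2l => //; rewrite lef_pV2 ?posrE; lra.
Qed.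

(** Truncation replaces the exponential by a product of two increasing functions of [w], to which
    Harris can be applied. *)
Lemma sprinkle_trunc A B1 B2 W w v v' (eps t : R) : uniq B1 -> uniq B2 ->
  {subset B1 <= A} -> {subset B2 <= A} -> (forall x y, 0 <= W x y) ->
  {in B1 & B2, forall x y, x != y -> eps <= W x y} -> 0 <= eps -> 0 <= t ->
  eps * (Num.min (cl w B1 v) t * Num.min (cl w B2 v') t) / (1 + eps * t ^+ 2) <=
  Ex (edges A W) (fun w2 => ind R (conn (w `|` w2) v v')).
Proof.
move=> u1 u2 s1 s2 W0 Weps e0 t0; apply: le_trans (sprinkle w v v' u1 u2 s1 s2 W0 Weps).
have m1 : 0 <= Num.min (cl w B1 v) t by rewrite le_min cl_ge0.
have m2 : 0 <= Num.min (cl w B2 v') t by rewrite le_min cl_ge0.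
apply: one_minus_exp_ge.
- by rewrite !mulr_ge0.
- by rewrite -mulrA ler_wpM2l// ler_pM// ge_min lexx.
- by rewrite ler_wpM2l// expr2 ler_pM// ge_min lexx orbT.
Qed.

Lemma Ex_adj A W a b : uniq A -> (forall x y, 0 <= W x y) ->
  Ex (edges A W) (fun w => ind R (adj w a b)) <= W a b + W b a.
Proof.
move=> uA W0.
have nA : nneg (edges A W) by exact: edges_nneg.
pose Q (c d : V) (e : V * V) := e = (c, d).
have one c d : Ex (edges A W) (fun w => ind R (w (c, d))) <= W c d.
  apply: (@le_trans _ _ (Ex (edges A W) (fun w => ind R (exists2 e, Q c d e & w e)))).
    by apply: Ex_le => // w; apply: ind_le => h; exists (c, d).
  apply: le_trans (Ex_some (Q c d) nA) _.
  rewrite big_map /=.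
  have [cdA|cdA] := boolP ((c, d) \in pairs A).
    rewrite (bigD1_seq (c, d)) ?pairs_uniq//= indT// mul1r big1 ?addr0// => e ecd.
    by rewrite indF ?mul0r// => ee; rewrite ee eqxx in ecd.
  rewrite big_seq big1// => e eA; rewrite indF ?mul0r// => ee.
  by rewrite -ee eA in cdA.
apply: le_trans (lerD (one a b) (one b a)); rewrite -ExD.
apply: Ex_le => // w; have [h|h] := pselect (adj w a b); last first.
  by rewrite (indF _ h) addr_ge0 ?ind_ge0.
by rewrite (indT _ h); case: h => h; rewrite (indT _ h) ?lerDl ?lerDr ind_ge0.
Qed.

(** A Simon--Lieb inequality: a connection leaving [S] contains disjointly a path to some [a] inside
    [S], an edge from [a] to some [b] outside, and a path from [b] to [y]. *)
Lemma exit_bound A S W z y : uniq A -> uniq S -> (forall a b, 0 <= W a b) ->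
  z \in S -> y \notin S ->
  Ex (edges A W) (fun w => ind R (conn w z y)) <=
  \sum_(a <- S) \sum_(b <- A | b \notin S)
    Ex (edges S W) (fun w => ind R (conn w z a)) * (W a b + W b a) *
    Ex (edges A W) (fun w => ind R (conn w b y)).
Proof.
move=> uA uS W0 zS yS.
have nA : nneg (edges A W) by exact: edges_nneg.
pose P2 a b := fun v2 => box_event (fun u1 u2 => adj u1 a b /\ conn u2 b y) v2.
pose P1 a := fun v1 => conn (ins v1 [set` S]) z a.
have P1i a : forall v w, v `<=` w -> P1 a v -> P1 a w.
  by move=> v w vw; apply: conn_sub => e [/vw ? ? ?]; split.
have P2i a b : forall v w, v `<=` w -> P2 a b v -> P2 a b w.
  move=> v w vw [u1 [u2 [h1 h2 dj h]]]; exists u1, u2; split=> //;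
    exact: subset_trans vw.
apply: (@le_trans _ _ (Ex (edges A W) (fun w => \sum_(a <- S) \sum_(b <- A | b \notin S)
    ind R (box_event (fun v1 v2 => P1 a v1 /\ P2 a b v2) w)))).
  apply: Ex_le_supp => // w; rewrite unzip1_edges => wA.
  have [zy|zy] := pselect (conn w z y); last first.
    by rewrite (indF _ zy); apply: sumr_ge0 => a _; apply: sumr_ge0 => b _; exact: ind_ge0.
  (* The cluster of [z] is explored within [S] only, so an edge leaving [C] must leave [S] as
     well. *)
  pose C := conn (ins w [set` S]) z.
  have CS c : C c -> c \in S.
    by elim=> // c1 c2 _ _ [[]|[]].
  have nCy : ~ C y by move/CS; apply/negP.
  have [a [b [Ca nCb ab h]]] := conn_exit (conn0 _ z : C z) zy nCy.
  have aS := CS _ Ca.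
  have bS : b \notin S.
    apply/negP => bS; apply: nCb; apply: connS Ca _.
    by case: ab => ?; [left|right].
  have bA : b \in A.
    by case: ab => /wA /=; rewrite mem_pairs => /andP[].
  rewrite (indT _ zy) (big_rem a)//= (big_rem b)//= bS indT.
    rewrite -addrA lerDl addr_ge0//; first by apply: sumr_ge0 => *; exact: ind_ge0.
    by apply: sumr_ge0 => *; apply: sumr_ge0 => *; exact: ind_ge0.
  pose e0 := if `[< w (a, b) >] then (a, b) else (b, a).
  have e0w : w e0 by rewrite /e0; case: asboolP => //; case: ab.
  have e0a : adj [set e0] a b.
    by rewrite /e0; case: asboolP => _; [left|right].
  have e0ab : e0 = (a, b) \/ e0 = (b, a) by rewrite /e0; case: asboolP; [left|right].
  exists (ins w C), (e0 |` off w C); split.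
  - exact: ins_sub.
  - by move=> e [->//|[]].
  - apply/seteqP; split=> // e [[_ h1 h2] [ee|[_ h3 _]]] //.
    by case: e0ab => e0E; rewrite ee e0E /= in h1 h2.
  - split.
      have : C a := Ca; rewrite /P1.
      suff sub : ins (ins w [set` S]) C `<=` ins (ins w C) [set` S].
        by move=> /conn_ins_cluster; apply: conn_sub.
      by move=> e [[we h1 h2] h3 h4]; split=> //; split.
    exists [set e0], (off w C); split.
    + exact: subsetUl.
    + exact: subsetUr.
    + apply/seteqP; split=> // e [-> [_ h1 h2]].
      by case: e0ab => e0E; rewrite e0E /= in h1 h2.
    + by split.
rewrite Ex_sum; apply: ler_sum => a _; rewrite Ex_sum; apply: ler_sum => b _.
apply: le_trans (Ex_BK_prod nA (P1i a) (P2i a b)) _.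
rewrite -mulrA; apply: ler_pM.
- by apply: Ex_ge0 => // w; exact: ind_ge0.
- by apply: Ex_ge0 => // w; exact: ind_ge0.
- exact: (Ex_edges_ins_le (f := fun w => ind R (conn w z a)) uA uS W0 (@incr_conn _ _ _ _)).
apply: le_trans (Ex_BK_prod (P := fun v => adj v a b) (Q := fun v => conn v b y) nA _ _) _.
- by move=> v w; exact: adj_sub.
- by move=> v w; exact: conn_sub.
apply: ler_wpM2r; last exact: Ex_adj.
by apply: Ex_ge0 => // w; exact: ind_ge0.
Qed.

(** On a finite vertex set the largest mean [M] is a finite number, and splitting the points into
    those inside and outside [S z] gives [M <= n0 + phi * M]. *)
Lemma susceptibility_bound W (S : V -> seq V) (n0 : nat) (phi : R) :
  (forall a b, 0 <= W a b) -> (forall z, uniq (S z)) -> (forall z, z \in S z) ->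
  (forall z, size (S z) = n0) -> phi < 1 ->
  (forall z A, uniq A -> \sum_(a <- S z) \sum_(b <- A | b \notin S z)
     Ex (edges (S z) W) (fun w => ind R (conn w z a)) * (W a b + W b a) <= phi) ->
  forall A, uniq A -> {in A, forall z, Ex (edges A W) (fun w => cl w A z) <= n0%:R / (1 - phi)}.
Proof.
move=> W0 uS zS sS phi1 hphi A uA.
have nA : nneg (edges A W) by exact: edges_nneg.
pose F z := Ex (edges A W) (fun w => cl w A z).
pose M := \big[Order.max/0]_(z <- A) F z.
have FM : {in A, forall z, F z <= M}.
  by move=> z zA; exact: le_bigmax_seq.
have M0 : 0 <= M by exact: bigmax_ge_id.
have phi0 : A = [::] \/ 0 <= phi.
  case: A {FM M0 M F nA uA} => [|z A]; first by left.
  by right; apply: le_trans (hphi z [::] _) => //; rewrite big1// => a _; rewrite big_nil.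
have key z : z \in A -> F z <= n0%:R + phi * M.
  move=> zA; rewrite /F Ex_sum (bigID (mem (S z))) /=; apply: lerD.
    apply: (@le_trans _ _ (\sum_(y <- A | y \in S z) 1)).
      apply: ler_sum => y _; apply: Ex_le_cst => // w; exact: ind_le1.
    apply: (@le_trans _ _ (\sum_(y <- S z) 1)).
      by apply: ler_sum_sub.
    by rewrite -(sS z) big_const_seq count_predT iter_addr_0.
  apply: (@le_trans _ _ (\sum_(y <- A | y \notin S z) \sum_(a <- S z) \sum_(b <- A | b \notin S z)
    Ex (edges (S z) W) (fun w => ind R (conn w z a)) * (W a b + W b a) *
    Ex (edges A W) (fun w => ind R (conn w b y)))).
    by apply: ler_sum => y yS; exact: exit_bound.
  apply: (@le_trans _ _ ((\sum_(a <- S z) \sum_(b <- A | b \notin S z)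
     Ex (edges (S z) W) (fun w => ind R (conn w z a)) * (W a b + W b a)) * M)); last first.
    by apply: ler_wpM2r => //; exact: hphi.
  rewrite exchange_big /= mulr_suml; apply: ler_sum => a _.
  rewrite exchange_big /= mulr_suml big_seq_cond [leRHS]big_seq_cond.
  apply: ler_sum => b /andP[bA bS].
  rewrite -mulr_sumr; apply: ler_wpM2l.
    by rewrite mulr_ge0 ?addr_ge0// Ex_ge0//; exact: edges_nneg.
  apply: le_trans (FM b bA); rewrite /F Ex_sum.
  apply: ler_sum_sub => // y; apply: Ex_ge0 => // w; exact: ind_ge0.
move=> z zA; apply: le_trans (FM z zA) _.
have p0 : 0 <= phi by case: phi0 zA => // ->.
have : M <= n0%:R + phi * M.
  rewrite {1}/M big_seq_cond; apply: bigmax_le => [|y /andP[yA _]]; last exact: key.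
  by rewrite addr_ge0// mulr_ge0.
rewrite ler_pdivlMr ?subr_gt0//; lra.
Qed.

End Sprinkling.

(** * Sharpness *)

Section Sharpness.
Variables (R : realType) (V : eqType) (D : set V).
Implicit Types (W : V -> V -> R) (w : set (V * V)) (x y z : V) (A B S : seq V).

Definition out w : set V := [set x | exists2 y, D y & conn w x y].

Lemma out_sub v w x : v `<=` w -> out v x -> out w x.
Proof. by move=> vw [y Dy xy]; exists y => //; exact: conn_sub xy. Qed.

Lemma out_conn w x y : conn w x y -> out w y -> out w x.
Proof. by move=> xy [z Dz yz]; exists z => //; exact: conn_trans yz. Qed.

(* Whether a set is the set of points of [A] not connected to [D] is decided
   by the edges having an endpoint outside of it. *)
Lemma not_out_setD w A S : w `<=` [set` pairs A] -> {subset S <= A} ->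
  let T := [set e : V * V | e.1 \in S /\ e.2 \in S] in
  {in A, forall x, x \in S <-> ~ out w x} <->
  {in A, forall x, x \in S <-> ~ out (w `\` T) x}.
Proof.
move=> wA SA T.
have sub : w `\` T `<=` w by move=> e [].
split=> h x xA.
  split=> [/(h x xA) nx /(out_sub sub)//|nx].
  apply/(h x xA) => -[y Dy xy]; apply: nx; exists y => //.
  apply: conn_sub (conn_ins_cluster xy) => e [we c1 c2]; split=> // -[e1 e2].
  have eA : e.1 \in A by have := wA _ we; rewrite /= mem_pairs => /andP[].
  have [+ _] := h _ eA; apply=> //.
  by exists y => //; apply: conn_trans (conn_sym c1) xy.
split=> [xS|nx]; last by apply/(h x xA) => /(out_sub sub).
have nx : ~ out (w `\` T) x by apply/(h x xA).
move=> [y Dy xy].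
have nSy : ~ y \in S.
  move=> yS; have [+ _] := h y (SA y yS); apply=> //.
  by exists y => //; exact: conn0.
have [a [b [aS bS ab hby]]] := @conn_exit _ w [set` S] x y xS xy nSy.
have [+ _] := h a (SA a aS); apply=> //.
apply: (@out_conn _ _ b); last first.
  exists y => //; apply: conn_sub hby => e [we h1 h2]; split=> // -[h3 _].
  exact: h1.
apply: conn1; case: ab => wab; [left|right]; split=> // -[/= h1 h2]; exact: bS.
Qed.

Lemma exp_half (z : R) : 0 <= z <= 2^-1 -> expR (- z) <= 1 - z / 2.
Proof.
move=> /andP[z0 z1]; apply: (@le_trans _ _ (1 + z)^-1).
  rewrite expRN lef_pV2 ?posrE ?expR_gt0//; last lra.
  exact: expR_ge1Dx.
by rewrite -div1r ler_pdivrMr; nra.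
Qed.

Lemma ind_sum_tuple (n : nat) (m : n.-tuple bool) (F : R) :
  F = \sum_(m' : n.-tuple bool) ind R (m = m') * F.
Proof.
rewrite (bigD1 m)//= indT// mul1r big1 ?addr0// => m' mm'.
by rewrite indF ?mul0r// => h; rewrite h eqxx in mm'.
Qed.

(** A discrete form of the Duminil-Copin--Tassion differential inequality. Let [S] be the set of
    points of [A] not joined to [D] under [W]. Revealing [S] leaves the edges inside it fresh, so
    the clocks of [W2] join the cluster of [z] to the outside of [S] with mean intensity at least
    [kappa]. The bound on their total makes [1 - exp(-Z)] at least [Z / 2]. *)
Lemma isolated_decrease A W W2 z (kappa : R) : uniq A -> z \in A ->
  (forall x y, 0 <= W x y) -> (forall x y, 0 <= W2 x y) ->
  \sum_(x <- A) \sum_(y <- A) W2 x y <= 2^-1 ->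
  (forall m, let S := mask m A in z \in S -> {in S, forall x, ~ D x} ->
     kappa <= \sum_(a <- S) \sum_(b <- A | b \notin S)
       Ex (edges S W) (fun w => ind R (conn w z a)) * W2 a b) ->
  Ex (edges A (fun x y => W x y + W2 x y)) (fun w => ind R (~ out w z)) <=
  (1 - kappa / 2) * Ex (edges A W) (fun w => ind R (~ out w z)).
Proof.
move=> uA zA W0 W20 D2 hk.
have nA : nneg (edges A W) by exact: edges_nneg.
pose Q w (e : V * V) := conn w z e.1 /\ out w e.2.
pose Z w := \sum_(a <- A) \sum_(b <- A) ind R (Q w (a, b)) * W2 a b.
rewrite Ex_edges_add Ex_cat.
have term0 w a b : 0 <= ind R (Q w (a, b)) * W2 a b by rewrite mulr_ge0 ?ind_ge0.
have Z0 w : 0 <= Z w by apply: sumr_ge0 => a _; exact: sumr_ge0.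
have Z1 w : Z w <= 2^-1.
  apply: le_trans D2; apply: ler_sum => a _; apply: ler_sum => b _.
  by rewrite ler_piMl ?ind_le1.
have step1 w : Ex (edges A W2) (fun w2 => ind R (~ out (w `|` w2) z)) <=
    ind R (~ out w z) - ind R (~ out w z) * Z w / 2.
  have [ow|ow] := pselect (out w z).
    rewrite (Ex_ext (fun=> 0)).
      by rewrite Ex_cst indF ?mul0r ?subr0//; exact.
    move=> w2; rewrite indF//; apply: contrapT => /contrapT h; apply: h.
    by apply: out_sub ow; exact: subsetUl.
  rewrite (indT _ ow) mul1r; apply: le_trans (@exp_half _ _); last by rewrite Z0 Z1.
  rewrite /Z -(sum_edges A W2 (fun e a => ind R (Q w e) * a)) -Ex_none.
  apply: Ex_le; first exact: edges_nneg.
  move=> w2; apply: ind_le => h [a b] [/= h1 h2] w2ab; apply: h.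
  apply: (@out_conn _ _ b); last by apply: out_sub h2; exact: subsetUl.
  apply: connS; first by apply: conn_sub h1; exact: subsetUl.
  by left; right.
apply: (@le_trans _ _ (Ex (edges A W) (fun w =>
   ind R (~ out w z) - ind R (~ out w z) * Z w / 2))).
  by apply: Ex_le.
rewrite ExB ExZr mulrBl mul1r lerD2l lerN2 -mulrA (mulrC 2^-1) mulrA ler_pM2r ?invr_gt0//.
(* The random set [S] is encoded as a bit mask of [A], so that conditioning on it is a finite
   sum. *)
pose mk w : (size A).-tuple bool := [tuple of map (fun x => ~~ `[< out w x >]) (in_tuple A)].
pose F w := ind R (~ out w z) * Z w.
rewrite -ExZ -/(F _).
rewrite (Ex_ext (fun w => \sum_m ind R (mk w = m) * (kappa * ind R (~ out w z)))); last first.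
  by move=> w; exact: ind_sum_tuple.
rewrite (Ex_ext (l := edges A W) (f := F) (fun w => \sum_m ind R (mk w = m) * F w)); last first.
  by move=> w; exact: ind_sum_tuple.
rewrite !Ex_sum; apply: ler_sum => m _.
pose S := mask m A.
have SA : {subset S <= A} by move=> x; exact: mem_mask.
have uS : uniq S by exact: mask_uniq.
have mkE w : mk w = m <-> {in A, forall x, x \in S <-> ~ out w x}.
  have mS w' : mk w' = m -> S = [seq x <- A | ~~ `[< out w' x >]].
    by move=> h; rewrite /S -h filter_mask.
  split=> [h x xA|h].
    by rewrite (mS w h) mem_filter xA andbT; split=> [/negP|nx];
      [rewrite asboolE|apply/negP; rewrite asboolE].
  apply: val_inj => /=; apply: (@eq_from_nth _ false).
    by rewrite size_map size_tuple.
  move=> i; rewrite size_map => iA; rewrite (nth_map z)//.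
  have xA : nth z A i \in A by exact: mem_nth.
  have -> : nth false m i = (nth z A i \in S).
    by rewrite in_mask// xA index_uniq.
  apply/idP/idP => [/negP|/(h _ xA)].
    by rewrite asboolE => /(h _ xA).
  by move=> nx; apply/negP; rewrite asboolE.
have [zS|zS] := boolP (z \in S); last first.
  have zero w (G : R) : ind R (mk w = m) * (ind R (~ out w z) * G) = 0.
    have [h|h] := pselect (mk w = m); last by rewrite (indF _ h) mul0r.
    rewrite [ind R (~ _)]indF ?mul0r ?mulr0// => nz.
    by move/negP: zS; apply; apply/(iffLR (mkE w) h z zA).
  rewrite (Ex_ext (fun=> 0)) ?Ex_cst; last by move=> w; rewrite (mulrC kappa) zero.
  by rewrite (Ex_ext (fun=> 0)) ?Ex_cst// => w; rewrite zero.
have [nDS|DS] := pselect ({in S, forall x, ~ D x}); last first.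
  have zero w : ind R (mk w = m) = 0.
    rewrite indF// => /mkE h; apply: DS => x xS Dx.
    by have [+ _] := h x (SA x xS); apply=> //; exists x => //; exact: conn0.
  rewrite (Ex_ext (fun=> 0)) ?Ex_cst; last by move=> w; rewrite zero mul0r.
  by rewrite (Ex_ext (fun=> 0)) ?Ex_cst// => w; rewrite zero mul0r.
pose T := [set e : V * V | e.1 \in S /\ e.2 \in S].
pose G w := \sum_(a <- S) \sum_(b <- A | b \notin S) ind R (conn w z a) * W2 a b.
have lhsE : Ex (edges A W) (fun w => ind R (mk w = m) * (kappa * ind R (~ out w z))) =
    Ex (edges A W) (fun w => kappa * ind R (mk (w `\` T) = m)).
  apply: Ex_eq_supp => // w; rewrite unzip1_edges => wA.
  have <- : ind R (mk w = m) = ind R (mk (w `\` T) = m).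
    by apply: ind_eq; split=> /mkE /(not_out_setD wA SA) /mkE.
  have [h|h] := pselect (mk w = m); last by rewrite (indF _ h) mul0r mulr0.
  rewrite (indT _ h) [ind R (~ _)]indT ?mul1r//.
  exact/(iffLR (mkE w) h z zA).
rewrite lhsE ExZ.
have rhs : Ex (edges A W) (fun w => G (w `&` T) * ind R (mk (w `\` T) = m)) <=
    Ex (edges A W) (fun w => ind R (mk w = m) * F w).
  apply: Ex_le_supp => // w; rewrite unzip1_edges => wA.
  have <- : ind R (mk w = m) = ind R (mk (w `\` T) = m).
    by apply: ind_eq; split=> /mkE /(not_out_setD wA SA) /mkE.
  have [h|h] := pselect (mk w = m); last by rewrite (indF _ h) mul0r mulr0.
  have hm := iffLR (mkE w) h.
  rewrite (indT _ h) mulr1 mul1r /F [ind R (~ _)]indT ?mul1r; last first.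
    exact/(hm z zA).
  apply: (@le_trans _ _ (\sum_(a <- S) \sum_(b <- A) ind R (Q w (a, b)) * W2 a b)); last first.
    by apply: ler_sum_sub => // [x xS _|x]; [exact: SA|exact: sumr_ge0].
  rewrite /G; apply: ler_sum => a _.
  rewrite [leRHS](bigID (mem S)) /= big_seq_cond.
  rewrite [X in _ + X]big_seq_cond -[leLHS]add0r; apply: lerD; first exact: sumr_ge0.
  apply: ler_sum => b /andP[bA bS]; apply: ler_wpM2r => //.
  apply: ind_le => za; split; first by apply: conn_sub za; exact: subIsetl.
  by apply: contrapT => /= nb; move/negP: bS; apply; apply/(hm b bA).
(* The value of the mask is decided by edges outside [T], while [G] only looks at edges in [T]. *)
apply: le_trans rhs; rewrite (Ex_indep _ T G (fun w => ind R (mk w = m))).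
apply: ler_wpM2r; first by apply: Ex_ge0 => // w; exact: ind_ge0.
apply: le_trans (hk m zS nDS) _; rewrite /G Ex_sum; apply: ler_sum => a _.
rewrite Ex_sum; apply: ler_sum => b _; rewrite ExZr.
rewrite -(Ex_edges_ins _ uA uS SA W0) le_eqVlt; apply/orP; left; apply/eqP.
congr (_ * _); apply: Ex_ext => w; congr (ind R (conn _ z a)).
by apply/seteqP; split=> e; [move=> [we h1 h2]|move=> [we [h1 h2]]].
Qed.

(** The lower bound [kappa] is assumed at [W] only: connection probabilities increase with the
    intensity, so it persists through all the increments. *)
Lemma isolated_iter A W W2 z (kappa : R) n : uniq A -> z \in A -> kappa <= 2 ->
  (forall x y, 0 <= W x y) -> (forall x y, 0 <= W2 x y) ->
  \sum_(x <- A) \sum_(y <- A) W2 x y <= 2^-1 ->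
  (forall m, let S := mask m A in z \in S -> {in S, forall x, ~ D x} ->
     kappa <= \sum_(a <- S) \sum_(b <- A | b \notin S)
       Ex (edges S W) (fun w => ind R (conn w z a)) * W2 a b) ->
  Ex (edges A (fun x y => W x y + W2 x y *+ n)) (fun w => ind R (~ out w z)) <=
  (1 - kappa / 2) ^+ n.
Proof.
move=> uA zA k2 W0 W20 D2 hk; elim: n => [|n IH].
  rewrite expr0; apply: Ex_le_cst => [|w]; last exact: ind_le1.
  by apply: edges_nneg => x y; rewrite mulr0n addr0.
have Wn x y : 0 <= W x y + W2 x y *+ n by rewrite addr_ge0// mulrn_wge0.
have -> : (fun x y => W x y + W2 x y *+ n.+1) =
          (fun x y => (W x y + W2 x y *+ n) + W2 x y).
  by apply/funext => x; apply/funext => y; rewrite mulrSr addrA.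
apply: le_trans (isolated_decrease uA zA Wn W20 D2 _) _.
  move=> m S zS nD; apply: le_trans (hk m zS nD) _.
  apply: ler_sum => a _; apply: ler_sum => b _; apply: ler_wpM2r => //.
  apply: Ex_edges_weight; last exact: incr_conn.
  by move=> x y; rewrite W0 lerDl mulrn_wge0.
by rewrite exprS; apply: ler_wpM2l => //; lra.
Qed.

End Sharpness.

(** * Boxes of the lattice *)

Section Boxes.
Variable d : nat.
Implicit Types x y z : Zd d.

Lemma linf_leP x n : reflect (forall i, (`|x ord0 i| <= n)%N) (linf x <= n)%N.
Proof.
by apply: (iffP (@bigmax_leqP _ _ _ _)) => [h i|h i _]; exact: h.
Qed.

Lemma linf0 : linf (0 : Zd d) = 0%N.
Proof. by apply/eqP; rewrite -leqn0; apply/linf_leP => i; rewrite mxE. Qed.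

Lemma linf_eq0 x : linf x = 0%N -> x = 0.
Proof.
move=> x0; apply/rowP => i; rewrite mxE; apply/eqP; rewrite -absz_eq0 -leqn0.
by move: i; apply/linf_leP; rewrite x0.
Qed.

Lemma linfN x : linf (- x) = linf x.
Proof. by apply: eq_bigr => i _; rewrite mxE abszN. Qed.

Lemma absz_add (a b : int) : (absz (a + b)%R <= absz a + absz b)%N.
Proof. lia. Qed.

Lemma linf_add x y : (linf (x + y)%R <= linf x + linf y)%N.
Proof.
apply/linf_leP => i; rewrite mxE; apply: leq_trans (absz_add _ _) _.
have/linf_leP/(_ i) hx := leqnn (linf x); have/linf_leP/(_ i) hy := leqnn (linf y).
exact: leq_add.
Qed.

Lemma linf_sub x y : (linf (x - y)%R <= linf x + linf y)%N.
Proof. by rewrite -(linfN y); exact: linf_add. Qed.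

Lemma absz_mulrn (a : int) n : absz (a *+ n) = (n * absz a)%N.
Proof. by rewrite -mulr_natl natz abszM. Qed.

Lemma linf_mulrn x n : linf (x *+ n)%R = (n * linf x)%N.
Proof.
apply/eqP; rewrite eqn_leq; apply/andP; split.
  apply/linf_leP => i; rewrite mulmxnE absz_mulrn leq_mul2l.
  by apply/orP; right; have/linf_leP := leqnn (linf x); exact.
case: n => [|n]; first by [].
rewrite mulnC -leq_divRL//; apply/linf_leP => i; rewrite leq_divRL//.
have/linf_leP/(_ i) := leqnn (linf (x *+ n.+1)).
by rewrite mulmxnE absz_mulrn mulnC.
Qed.

Definition bx (n : nat) : seq (Zd d) :=
  [seq \row_i (((f : {ffun 'I_d -> 'I_(n.*2.+1)}) i : nat)%:Z - n%:Z) | f <- enum {ffun 'I_d -> 'I_(n.*2.+1)}].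

Lemma mem_bx n x : (x \in bx n) = (linf x <= n)%N.
Proof.
have aux1 (k : nat) : (k < n.*2.+1 -> `|k%:Z - n%:Z| <= n)%N by lia.
have aux2 (a : int) : (`|a| <= n -> absz (a + n%:Z)%R < n.*2.+1)%N by lia.
have aux3 (a : int) : (`|a| <= n)%N -> a = (absz (a + n%:Z))%:Z - n%:Z by lia.
apply/mapP/linf_leP => [[f _ ->] i|h].
  by rewrite mxE; apply: aux1; exact: ltn_ord.
exists [ffun i => inord (absz (x ord0 i + n%:Z))]; first by rewrite mem_enum.
apply/rowP => i; rewrite mxE ffunE inordK; first by apply: aux3; exact: h.
by apply: aux2; exact: h.
Qed.

Lemma bx_uniq n : uniq (bx n).
Proof.
have aux (a b : nat) : a%:Z - n%:Z = b%:Z - n%:Z -> a = b by lia.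
rewrite map_inj_uniq ?enum_uniq// => f g /rowP fg.
by apply/ffunP => i; apply: val_inj; have := fg i; rewrite !mxE => /aux.
Qed.

Lemma size_bx n : size (bx n) = (n.*2.+1 ^ d)%N.
Proof. by rewrite size_map -cardE card_ffun !card_ord. Qed.

Definition transl y (A : seq (Zd d)) := [seq x + y | x <- A].

Lemma mem_transl y A x : (x \in transl y A) = (x - y \in A).
Proof.
apply/mapP/idP => [[z zA ->]|h]; first by rewrite addrK.
by exists (x - y) => //; rewrite subrK.
Qed.

Lemma transl_uniq y A : uniq (transl y A) = uniq A.
Proof. by rewrite map_inj_uniq//; exact: addIr. Qed.

Variable R : realType.
Implicit Types (W : Zd d -> Zd d -> R) (A B : seq (Zd d)).

Definition translc y (w : set (Zd d * Zd d)) : set (Zd d * Zd d) :=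
  (fun e => (e.1 + y, e.2 + y)) @` w.

Lemma conn_transl y w u v : conn (translc y w) (u + y) (v + y) <-> conn w u v.
Proof. exact: (conn_image (phi := fun z => z + y) w u v (@addIr _ y)). Qed.

Lemma cl_transl y w B x : cl R (translc y w) (transl y B) (x + y) = cl R w B x.
Proof.
by rewrite /cl big_map; apply: eq_bigr => z _; apply: ind_eq; exact: conn_transl.
Qed.

Lemma Ex_transl y A W f :
  Ex (edges (transl y A) W) f =
  Ex (edges A (fun u v => W (u + y) (v + y))) (fun w => f (translc y w)).
Proof.
rewrite -(Ex_map (fun e => (e.1 + y, e.2 + y))).
congr Ex; rewrite /edges -map_comp /pairs /transl.
rewrite [in LHS](_ : [seq (x, y0) | x <- [seq x + y | x <- A], y0 <- [seq x + y | x <- A]] =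
  [seq (e.1 + y, e.2 + y) | e <- [seq (x, y0) | x <- A, y0 <- A]]).
  by rewrite -map_comp.
rewrite allpairs_mapl allpairs_mapr map_allpairs.
by [].
Qed.

End Boxes.

(** * Renormalization *)

(** The number of points times the gluing probability in [bigmean_step], with [K = 1 + K2]; the 81
    is the square of the 9 lost by truncation. *)
Lemma mean_arith (R : realFieldType) (l b e A K : R) (d m : nat) :
  0 < l -> 0 < b -> 0 < e -> 0 < K ->
  l ^+ m.+1 ^+ d * (e / (l ^+ d * b) ^+ m * (A * b ^+ m / e / 9) ^+ 2 / K)
  = (A * b ^+ m / e) * (l ^+ d * (A / (81 * K))).
Proof.
move=> l0 b0 e0 K0; rewrite exprMn -exprM mulnC exprM exprS.
have : 0 < (l ^+ d) ^+ m by rewrite !exprn_gt0.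
have : 0 < b ^+ m by rewrite exprn_gt0.
have : 0 < l ^+ d by rewrite exprn_gt0.
move: (l ^+ d) => p; move: (p ^+ m) (b ^+ m) => q r p0 r0 q0.
by field; rewrite !gt_eqF.
Qed.

(** The cost of restoring scale [n + k] in the box of scale [n]. It decays in [k] because the
    intensity falls like [(l^d b)^(-k)] while the square of the mean grows only like [b^(2k)]. *)
Lemma term_arith (R : realFieldType) (l b e A : R) (d n k : nat) :
  0 < l -> 0 < b -> 0 < e ->
  3 ^+ d * (l ^+ n) ^+ d * (2 * (e / (l ^+ d * b) ^+ (n + k)) *
    (A * b ^+ (n + k).+2 / e) ^+ 2)
  = 2 * 3 ^+ d * A ^+ 2 * b ^+ 4 / e * b ^+ n * (b / l ^+ d) ^+ k.
Proof.
move=> l0 b0 e0; rewrite (expr_div_n b).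
have -> : (l ^+ n) ^+ d = (l ^+ d) ^+ n by rewrite -!exprM mulnC.
have -> : b ^+ (n + k).+2 = b ^+ n * b ^+ k * b ^+ 2 by rewrite -!exprD addn2.
rewrite (exprMn (n + k)) !(exprD _ n k).
have : 0 < (l ^+ d) ^+ n by rewrite !exprn_gt0.
have : 0 < (l ^+ d) ^+ k by rewrite !exprn_gt0.
have : 0 < b ^+ n by rewrite exprn_gt0.
have : 0 < b ^+ k by rewrite exprn_gt0.
move: (b ^+ n) (b ^+ k) ((l ^+ d) ^+ n) ((l ^+ d) ^+ k) (3 ^+ d).
by move=> bn bk ln lk t3 bk0 bn0 lk0 ln0; field; rewrite !gt_eqF.
Qed.

Lemma double_sub_ge (p q : nat) : (4 * p <= q -> q <= (q - p).*2.+1)%N.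
Proof. lia. Qed.

Lemma radius_margin (p p1 p2 s q x : nat) :
  (x <= p -> s <= q -> p2 <= s -> 4 * p1 <= p2 -> 4 * p <= p1 ->
   4 * q - 2 * s + x <= 4 * q - 2 * p1)%N.
Proof. lia. Qed.

Lemma radius_fit (p p1 r r1 x y : nat) :
  (x <= p -> 4 * r <= r1 -> 4 * p <= p1 -> p1 <= r -> y <= 4 * r - 2 * p1 ->
   y + x <= r1)%N.
Proof. lia. Qed.

Lemma double_le_triple (p : nat) : (0 < p -> p.*2.+1 <= 3 * p)%N.
Proof. lia. Qed.

Section Renormalization.
Variables (R : realType) (d : nat) (h : Zd d -> Zd d -> R).
Variables (Z M : nat) (eps0 b g T K2 A0 X : R).
Local Notation L := (3 * Z + 1)%N.
Local Notation cl := (cl R).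
Local Notation bx := (bx d).
Implicit Types (x y z u v : Zd d) (A B : seq (Zd d)) (w : set (Zd d * Zd d)).

Hypothesis Z1 : (1 <= Z)%N.
Hypothesis h0 : forall u v, 0 <= h u v.
Hypothesis hinv : forall z u v, h (u + z) (v + z) = h u v.
Hypothesis eps0_gt0 : 0 < eps0.
Hypothesis b_gt1 : 1 < b.
Hypothesis b_le : b <= L%:R ^+ d.
Hypothesis T_gt0 : 0 < T.
Hypothesis g_gt0 : 0 < g.
Hypothesis gE : g ^+ 2 = L%:R ^+ d * b.
Hypothesis TE : eps0 * T ^+ 2 = K2.
Hypothesis K2E : (Z.*2.+1 ^ d)%:R * expR (- K2) <= 2^-1.
Hypothesis gZ : 24 * g <= (Z.*2.+1 ^ d)%:R.
Hypothesis A0E : 81 * (1 + K2) <= A0.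

(** With [b = L^alpha], the intensity has the decay [L^(-(d+alpha)k)] of the kernel, [b^k] is the
    critical order of the mean and [thr k] that of the largest cluster. The relation [g^2 = L^d b]
    keeps [eps k * thr k ^+ 2] constant. *)
Definition eps (k : nat) : R := eps0 / (L%:R ^+ d * b) ^+ k.
Definition thr (k : nat) : R := T * g ^+ k.

Definition near_pair (r : nat) x u v : bool :=
  [&& u != v, linf (u - x)%R <= r & linf (v - x)%R <= r]%N.

(** Two points within [4 * L ^ k.+1] of a common centre are at most [8 * L ^ k.+1] apart, the range
    provided by [hlow]; for [m <= k] the radius is still at least [2 * L ^ k.+1]. *)
Definition Rad (k m : nat) : nat := (4 * L ^ k.+1 - 2 * L ^ m.+1)%N.

(* The part of the kernel set aside at scale [m] around [x]: for each [k >= m]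
   a uniform intensity [eps k] on the pairs of a box of radius about [L^k]. The
   radii shrink with [m], which leaves room to move the centre [x]. *)
Definition rem (m : nat) x u v : R :=
  \sum_(m <= k < M.+1) eps k *+ near_pair (Rad k m) x u v.

Definition spr (m : nat) u v : R := eps m *+ near_pair (L ^ m.+1) 0 u v.

Definition env m x u v : R := h u v - rem m x u v.
(** The kernel just before the sprinkling of scale [m]: it dominates [env m y] for all centres [y]
    of the next box simultaneously, and adding [spr m] gives [env m.+1 0]. *)
Definition envG m u v : R := h u v - (rem m.+1 0 u v + spr m u v).

Hypothesis hlow : forall u v, u != v ->
  \sum_(0 <= k < M.+1) eps k *+ (linf (u - v)%R <= 8 * L ^ k.+1)%N <= h u v.
Hypothesis chi : forall A, uniq A -> Ex (edges A h) (fun w => cl w A 0) <= X.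

Lemma eps_gt0 k : 0 < eps k.
Proof.
by rewrite divr_gt0// exprn_gt0// -gE exprn_gt0.
Qed.

Lemma thr_gt0 k : 0 < thr k.
Proof. by rewrite mulr_gt0// exprn_gt0. Qed.

Lemma eps_thr k : eps k * thr k ^+ 2 = K2.
Proof.
rewrite /eps /thr -gE -TE.
have -> : (g ^+ 2) ^+ k = (g ^+ k) ^+ 2 by rewrite -!exprM mulnC.
by field; rewrite gt_eqF// exprn_gt0.
Qed.

Lemma near_le r x r' y u v : (r + linf (x - y)%R <= r')%N ->
  near_pair r x u v -> near_pair r' y u v.
Proof.
move=> rr /and3P[uv hu hv]; apply/and3P; split=> //.
  have := linf_add (u - x) (x - y); rewrite addrA subrK => /leq_trans; apply.
  by apply: leq_trans rr; rewrite leq_add2r.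
have := linf_add (v - x) (x - y); rewrite addrA subrK => /leq_trans; apply.
by apply: leq_trans rr; rewrite leq_add2r.
Qed.

Lemma mulb_le (e : R) (p q : bool) : 0 <= e -> (p -> q) -> e *+ p <= e *+ q.
Proof. by case: p q => [] [] //= e0 pq; have := pq isT. Qed.

Lemma spr_ge0 m u v : 0 <= spr m u v.
Proof. by rewrite mulrn_wge0// ltW// eps_gt0. Qed.

Lemma pair_sum_le (m : nat) (r : nat -> nat) (x : Zd d) u v :
  (forall k, (r k <= 4 * L ^ k.+1)%N) ->
  \sum_(m <= k < M.+1) eps k *+ near_pair (r k) x u v <= h u v.
Proof.
move=> hr; have [->|uv] := eqVneq u v.
  by rewrite big1// => k _; rewrite /near_pair eqxx.
apply: le_trans (hlow uv).
have [mM|Mm] := leqP m M.+1; last first.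
  by rewrite big_geq ?(ltnW Mm)// sumr_ge0// => k _; rewrite mulrn_wge0// ltW// eps_gt0.
rewrite [leRHS](@big_cat_nat _ _ _ m)//= -[leLHS]add0r; apply: lerD.
  by apply: sumr_ge0 => k _; rewrite mulrn_wge0// ltW// eps_gt0.
apply: ler_sum_nat => k _; apply: mulb_le; first exact/ltW/eps_gt0.
move=> /and3P[_ hu hv]; have := linf_sub (u - x) (v - x).
have -> : u - x - (v - x) = u - v by rewrite opprB addrA subrK.
have := hr k; lia.
Qed.

Lemma rem_le m x u v : rem m x u v <= h u v.
Proof. by apply: (@pair_sum_le m (Rad^~ m)) => k; rewrite /Rad leq_subr. Qed.

Lemma L_gt0 : (0 < L)%N. Proof. by rewrite addn1. Qed.

Lemma L_ge4 : (4 <= L)%N. Proof. lia. Qed.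

Lemma expL_step k : (4 * L ^ k <= L ^ k.+1)%N.
Proof. by rewrite expnS leq_mul2r L_ge4 orbT. Qed.

Lemma expL_mono k m : (k <= m)%N -> (L ^ k <= L ^ m)%N.
Proof. by move=> km; rewrite leq_exp2l//; have := L_ge4; lia. Qed.

(** At [k = m] the radius [Rad m m = 2 * L ^ m.+1] covers the sprinkled box even after a shift by
    [y]. At [k > m] the shift is paid by the decrease of the radius from [Rad k m] to
    [Rad k m.+1]. *)
Lemma rem_step m y u v : (m <= M)%N -> (linf y <= L ^ m.+1)%N ->
  rem m.+1 0 u v + spr m u v <= rem m y u v.
Proof.
move=> mM yL; rewrite [leRHS]/rem big_ltn ?ltnS// addrC; apply: lerD.
  apply: mulb_le; first exact/ltW/eps_gt0.
  by apply: near_le; rewrite sub0r linfN /Rad; lia.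
apply: ler_sum_nat => k /andP[mk _]; apply: mulb_le; first exact/ltW/eps_gt0.
apply: near_le; rewrite sub0r linfN /Rad.
have h1 : (L ^ m.+2 <= L ^ k.+1)%N by exact: expL_mono.
have := expL_step m.+1; lia.
Qed.

Lemma env_ge0 m x u v : 0 <= env m x u v.
Proof. by rewrite subr_ge0 rem_le. Qed.

Lemma env_le_envG m y u v : (m <= M)%N -> (linf y <= L ^ m.+1)%N ->
  env m y u v <= envG m u v.
Proof. by move=> mM yL; rewrite lerD2l lerN2 rem_step. Qed.

Lemma envG_ge0 m u v : (m <= M)%N -> 0 <= envG m u v.
Proof.
move=> mM; apply: le_trans (env_ge0 m 0 u v) (env_le_envG _ _ mM _).
by rewrite linf0.
Qed.

Lemma envG_spr m : (fun u v => envG m u v + spr m u v) = env m.+1 0.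
Proof. by apply/funext => u; apply/funext => v; rewrite /envG /env; ring. Qed.

Lemma env_transl m y u v : env m y (u + y) (v + y) = env m 0 u v.
Proof.
rewrite /env hinv; congr (_ - _); apply: eq_bigr => k _; congr (_ *+ _).
by rewrite /near_pair !addrK !subr0 (inj_eq (@addIr _ y)).
Qed.

Lemma Ex_env_lift m y A A' f : uniq A -> uniq A' -> {subset transl y A <= A'} ->
  (m <= M)%N -> (linf y <= L ^ m.+1)%N -> incr f ->
  Ex (edges A (env m 0)) (fun w => f (translc y w)) <= Ex (edges A' (envG m)) f.
Proof.
move=> uA uA' AA' mM yL fi.
have -> : env m 0 = (fun u v => env m y (u + y) (v + y)).
  by apply/funext => u; apply/funext => v; rewrite env_transl.
rewrite -Ex_transl; apply: (@le_trans _ _ (Ex (edges A' (env m y)) f)).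
  by apply: Ex_edges_sub => //; [rewrite transl_uniq|move=> u v; exact: env_ge0].
by apply: Ex_edges_weight => // u v; rewrite env_ge0 env_le_envG.
Qed.

(* The two runaway alternatives: as soon as one of them holds at scale [m],
   one of them holds at scale [m.+1]. *)
Definition bigmean m := exists A, uniq A /\
  A0 * b ^+ m / eps0 <= Ex (edges A (env m 0)) (fun w => cl w (bx (L ^ m)) 0).
Definition bigmax m := exists A, uniq A /\
  4^-1 <= Ex (edges A (env m 0))
    (fun w => ind R (exists v, thr m <= cl w (bx (L ^ m)) v)).

Lemma spr_ge m B1 B2 :
  {in B1, forall x, (linf x <= L ^ m.+1)%N} ->
  {in B2, forall x, (linf x <= L ^ m.+1)%N} ->
  {in B1 & B2, forall x y, x != y -> eps m <= spr m x y}.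
Proof.
move=> h1 h2 x y /h1 xL /h2 yL xy.
by rewrite /spr /near_pair xy !subr0 xL yL.
Qed.

Lemma K2_ge0 : 0 <= K2.
Proof. by rewrite -TE mulr_ge0 ?ltW// exprn_gt0. Qed.

Lemma A0_ge0 : 0 <= A0.
Proof. by apply: le_trans A0E; have := K2_ge0; lra. Qed.

(** Since large clusters are unlikely, truncation at [thr m] loses only a factor 9. The truncated
    clusters of [0] and [y] are then glued with probability of order [eps m * Bd ^+ 2], and summing
    over [y] in the next box reproduces the mean with a gain of at least [b]. *)
Lemma bigmean_step m : (m <= M)%N -> bigmean m -> ~ bigmax m -> bigmean m.+1.
Proof.
move=> mM [A [uA hA]] nmax.
have nA : nneg (edges A (env m 0)) by apply: edges_nneg => u v; exact: env_ge0.
have t0 := thr_gt0 m.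
pose Bd := A0 * b ^+ m / eps0 / 9.
have Bd0 : 0 <= Bd.
  by rewrite !mulr_ge0 ?A0_ge0 ?exprn_ge0 ?invr_ge0 ?ltW// (lt_trans ltr01).
have hB : Bd <= Ex (edges A (env m 0)) (fun w => Num.min (cl w (bx (L ^ m)) 0) (thr m)).
  rewrite ler_pdivrMr// [leRHS]mulrC; apply: le_trans hA _.
  apply: tight_truncate => //; first exact: bx_uniq.
  by rewrite leNgt; apply/negP => hlt; apply: nmax; exists A; split=> //; exact: ltW.
(* The margin [L ^ m] keeps the small box around each [y] inside the next box. *)
pose Y := bx (L ^ m.+1 - L ^ m).
pose A' := undup (flatten [seq transl y A | y <- Y] ++ bx (L ^ m.+1)).
have uA' : uniq A' by exact: undup_uniq.
have nA' : nneg (edges A' (envG m)) by apply: edges_nneg => u v; exact: envG_ge0.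
have sY y : y \in Y -> {subset transl y A <= A'}.
  move=> yY x xA; rewrite mem_undup mem_cat; apply/orP; left.
  by apply/flattenP; exists (transl y A) => //; exact: map_f.
have sbx : {subset bx (L ^ m.+1) <= A'}.
  by move=> x xB; rewrite mem_undup mem_cat xB orbT.
have LL : (L ^ m <= L ^ m.+1)%N by exact: expL_mono.
have low y : y \in Y -> Bd <= Ex (edges A' (envG m))
    (fun w => Num.min (cl w (bx (L ^ m.+1)) y) (thr m)).
  move=> yY; have yL : (linf y <= L ^ m.+1 - L ^ m)%N by rewrite -mem_bx.
  apply: le_trans hB _.
  apply: le_trans (Ex_env_lift uA uA' (sY y yY) mM _ _); last exact: incr_min_cl.
    apply: Ex_le => // w; rewrite le_min !ge_min lexx orbT andbT.
    rewrite -(cl_transl R y) add0r cl_subset// ?transl_uniq ?bx_uniq// => x.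
    rewrite mem_transl !mem_bx => hx.
    have := linf_add (x - y) y; rewrite subrK => /leq_trans; apply.
    by rewrite -(subnKC LL) leq_add.
  by apply: leq_trans yL (leq_subr _ _).
exists A'; split=> //.
apply: (@le_trans _ _ (\sum_(y <- Y) Ex (edges A' (env m.+1 0)) (fun w => ind R (conn w 0 y)))); last first.
  rewrite Ex_sum; apply: ler_sum_sub => //; first exact: bx_uniq.
    by move=> y; rewrite !mem_bx => yL _; apply: leq_trans yL (leq_subr _ _).
  move=> y; apply: Ex_ge0 => [|w]; last exact: ind_ge0.
  by apply: edges_nneg => u v; exact: env_ge0.
have pt y : y \in Y -> eps m * Bd ^+ 2 / (1 + K2) <=
    Ex (edges A' (env m.+1 0)) (fun w => ind R (conn w 0 y)).
  move=> yY; rewrite -envG_spr Ex_edges_add Ex_cat.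
  apply: (@le_trans _ _ (Ex (edges A' (envG m)) (fun w =>
     eps m / (1 + K2) * (Num.min (cl w (bx (L ^ m.+1)) 0) (thr m) *
      Num.min (cl w (bx (L ^ m.+1)) y) (thr m))))); last first.
    apply: Ex_le => // w.
    apply: le_trans (@sprinkle_trunc R _ A' (bx (L ^ m.+1)) (bx (L ^ m.+1)) (spr m) w 0 y
       (eps m) (thr m) _ _ sbx sbx _ _ _ _).
    - by rewrite eps_thr mulrAC.
    - exact: bx_uniq.
    - exact: bx_uniq.
    - by move=> u v; exact: spr_ge0.
    - by apply: spr_ge => x; rewrite mem_bx.
    - exact/ltW/eps_gt0.
    - exact: ltW.
  rewrite ExZ mulrAC; apply: ler_wpM2l.
    by rewrite divr_ge0 ?ltW ?eps_gt0//; have := K2_ge0; lra.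
  apply: le_trans (Ex_harris nA' (incr_min_cl _ _ _) (incr_min_cl _ _ _)).
  by rewrite expr2; apply: ler_pM => //; apply: low => //; rewrite mem_bx linf0.
rewrite big_seq; apply: (@le_trans _ _ (\sum_(y <- Y | y \in Y) (eps m * Bd ^+ 2 / (1 + K2)))); last first.
  exact: ler_sum.
rewrite -big_seq big_const_seq count_predT iter_addr_0 size_bx -mulr_natl.
have cnt : L%:R ^+ m.+1 ^+ d <= ((L ^ m.+1 - L ^ m).*2.+1 ^ d)%:R :> R.
  rewrite natrX; apply: lerXn2r; rewrite ?nnegrE ?exprn_ge0//.
  by rewrite -natrX ler_nat; exact: double_sub_ge (expL_step m).
apply: le_trans (ler_wpM2r _ cnt); last first.
  apply: mulr_ge0; first by rewrite mulr_ge0 ?exprn_ge0// ltW// eps_gt0.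
  by rewrite invr_ge0; have := K2_ge0; lra.
have bm0 : 0 < b ^+ m by rewrite exprn_gt0// (lt_trans ltr01).
have l0 : 0 < L%:R :> R by rewrite ltr0n L_gt0.
have lm0 : 0 < (L%:R ^+ d) ^+ m :> R by rewrite !exprn_gt0.
have -> : L%:R ^+ m.+1 ^+ d * (eps m * Bd ^+ 2 / (1 + K2)) =
   (A0 * b ^+ m / eps0) * (L%:R ^+ d * (A0 / (81 * (1 + K2)))).
  rewrite /Bd /eps mean_arith//; first by rewrite (lt_trans ltr01).
  by have := K2_ge0; lra.
rewrite exprSr (mulrA A0) (mulrAC (A0 * _)).
apply: ler_wpM2l; first by rewrite divr_ge0 ?mulr_ge0 ?A0_ge0 ?(ltW bm0) ?(ltW eps0_gt0).
(* [A0] was taken at least [81 * (1 + K2)] precisely so that the gain is at least [L^d], hence at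
   least [b]. *)
apply: (le_trans b_le); apply: ler_peMr; first by rewrite exprn_ge0.
by rewrite ler_pdivlMr ?mul1r//; have := K2_ge0; lra.
Qed.

(** The spacing is the number of points on a side of the small box, so the translates are disjoint.
    They reach out to [L^m + Z * (2 * L^m + 1)], at most [(3 * Z + 1) * L^m]; hence the form of
    [L]. *)
Definition grid m : seq (Zd d) := [seq z *+ ((L ^ m).*2.+1) | z <- bx Z].

Lemma grid_box m j x : j \in grid m -> x \in transl j (bx (L ^ m)) ->
  (linf x <= L ^ m.+1)%N.
Proof.
move=> /mapP[z]; rewrite mem_bx => zZ ->; rewrite mem_transl mem_bx => hx.
have := linf_add (x - z *+ (L ^ m).*2.+1) (z *+ (L ^ m).*2.+1).
rewrite subrK linf_mulrn => /leq_trans; apply.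
apply: (@leq_trans (L ^ m + (L ^ m).*2.+1 * Z)%N).
  by rewrite leq_add// leq_mul.
have p1 : (0 < L ^ m)%N by rewrite expn_gt0 L_gt0.
rewrite expnS; move: (L ^ m)%N p1 => p p1; nia.
Qed.

Lemma grid_disjoint m j j' x y : j \in grid m -> j' \in grid m ->
  (linf x <= L ^ m)%N -> (linf y <= L ^ m)%N -> x + j = y + j' -> j = j' /\ x = y.
Proof.
move=> /mapP[z _ ->] /mapP[z' _ ->] xL yL e.
have e1 : (z' - z) *+ (L ^ m).*2.+1 = x - y.
  by rewrite mulrnBl; apply/eqP; rewrite subr_eq addrAC e addrAC subrr add0r.
have := linf_sub x y; rewrite -e1 linf_mulrn => hl.
have z0 : linf (z' - z) = 0%N.
  apply/eqP; rewrite -leqn0 leqNgt; apply/negP => zp.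
  have : (linf x + linf y <= (L ^ m).*2)%N by rewrite -addnn leq_add.
  move: (L ^ m)%N hl zp => p; nia.
have zz : z = z' by apply/esym/eqP; rewrite -subr_eq0; apply/eqP/linf_eq0.
split; first by rewrite zz.
by move: e; rewrite zz => /addIr.
Qed.

Lemma grid_uniq m : uniq (grid m).
Proof.
rewrite map_inj_in_uniq ?bx_uniq// => z z' _ _ /eqP.
rewrite -subr_eq0 -mulrnBl => /eqP zz.
apply/eqP; rewrite -subr_eq0; apply/eqP/linf_eq0.
have := linf_mulrn (z - z') (L ^ m).*2.+1; rewrite zz linf0 => /esym/eqP.
by rewrite muln_eq0 /= => /eqP.
Qed.

Lemma sum_cl_grid m w v : \sum_(j <- grid m) cl w (transl j (bx (L ^ m))) v
  <= cl w (bx (L ^ m.+1)) v.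
Proof.
pose s := [seq x + j | j <- grid m, x <- bx (L ^ m)].
have -> : \sum_(j <- grid m) cl w (transl j (bx (L ^ m))) v = cl w s v.
  by rewrite /cl big_allpairs_dep; apply: eq_bigr => j _; rewrite big_map.
apply: cl_subset.
  apply: allpairs_uniq; [exact: grid_uniq|exact: bx_uniq|].
  move=> [j x] [j' y] /allpairsP[[j1 x1] /= [jg xb [-> ->]]].
  move=> /allpairsP[[j2 x2] /= [jg' xb' [-> ->]]] /= e.
  rewrite !mem_bx in xb xb'.
  by have [-> ->] := grid_disjoint jg jg' xb xb' e.
move=> x /allpairsP[[j y] /= [jg yb ->]].
by rewrite mem_bx; apply: (grid_box jg); rewrite mem_transl addrK.
Qed.

Lemma half_average (l : seq ((Zd d * Zd d) * R)) (N : set (Zd d * Zd d) -> R) (J : R) :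
  nneg l -> 0 < J -> (forall w, 0 <= N w <= J) -> J / 4 <= Ex l N ->
  8^-1 <= Ex l (fun w => ind R (J / 8 <= N w)).
Proof.
move=> nl J0 NJ hN.
have : Ex l N <= Ex l (fun w => J * ind R (J / 8 <= N w) + J / 8).
  apply: Ex_le => // w; have /andP[n0 n1] := NJ w.
  have [hw|hw] := pselect (J / 8 <= N w).
    by rewrite (indT _ hw) mulr1; apply: le_trans n1 _; lra.
  rewrite (indF _ hw) mulr0 add0r; apply: ltW; rewrite ltNge; exact/negP.
rewrite ExD ExZ Ex_cst; set p := Ex l (fun w => ind R _) => hp.
have : J * 8^-1 <= J * p by lra.
by rewrite ler_pM2l.
Qed.

(** With probability at least [1/8], an eighth of the [J] disjoint boxes contain a large cluster.
    Sprinkling fails to join each of these to a fixed one with probability at most [exp(-K2)], and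
    [K2E] bounds the sum by [1/2]. So size [J / 8 * thr m] has probability at least [1/16], which
    [tight_max] turns into [1/4] at a third of that size; by [gZ] this third is at least
    [thr m.+1]. *)
Lemma bigmax_step m : (m <= M)%N -> bigmax m -> bigmax m.+1.
Proof.
move=> mM [A [uA hA]].
have t0 := thr_gt0 m; have e0 := eps_gt0 m.
pose A' := undup (flatten [seq transl y A | y <- grid m] ++ bx (L ^ m.+1)).
have uA' : uniq A' by exact: undup_uniq.
have nA' : nneg (edges A' (envG m)) by apply: edges_nneg => u v; exact: envG_ge0.
have nS : nneg (edges A' (spr m)) by apply: edges_nneg => u v; exact: spr_ge0.
have sY y : y \in grid m -> {subset transl y A <= A'}.
  move=> yY x xA; rewrite mem_undup mem_cat; apply/orP; left.
  by apply/flattenP; exists (transl y A) => //; exact: map_f.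
have sbx : {subset bx (L ^ m.+1) <= A'}.
  by move=> x xB; rewrite mem_undup mem_cat xB orbT.
pose B j := transl j (bx (L ^ m)).
have uB j : uniq (B j) by rewrite transl_uniq bx_uniq.
have BL j : j \in grid m -> {in B j, forall x, (linf x <= L ^ m.+1)%N}.
  by move=> jg x; exact: grid_box.
have BA j : j \in grid m -> {subset B j <= A'}.
  by move=> jg x xB; apply: sbx; rewrite mem_bx; exact: BL xB.
pose good j w := exists v, thr m <= cl w (B j) v.
pose J : R := (Z.*2.+1 ^ d)%:R.
have sJ : \sum_(j <- grid m) 1 = J :> R.
  by rewrite big_const_seq count_predT iter_addr_0 size_map size_bx.
have J0 : 0 < J by rewrite ltr0n expn_gt0.
pose N w := \sum_(j <- grid m) ind R (good j w).
have gp j : j \in grid m -> 4^-1 <= Ex (edges A' (envG m)) (fun w => ind R (good j w)).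
  move=> jg; apply: le_trans hA _.
  apply: le_trans (Ex_env_lift uA uA' (sY j jg) mM _ _).
  - apply: Ex_le => [|w]; first by apply: edges_nneg => u v; exact: env_ge0.
    by apply: ind_le => -[v hv]; exists (v + j); rewrite cl_transl.
  - by apply: (BL j jg); rewrite mem_transl subrr mem_bx linf0.
  - exact: incr_clmax_ge.
have hN : 8^-1 <= Ex (edges A' (envG m)) (fun w => ind R (J / 8 <= N w)).
  apply: half_average => // [w|].
    rewrite sumr_ge0/=; last by move=> j _; exact: ind_ge0.
    by rewrite -sJ; apply: ler_sum => j _; exact: ind_le1.
  rewrite Ex_sum -sJ mulr_suml big_seq [leRHS]big_seq.
  by apply: ler_sum => j /gp; rewrite mul1r.
have nC : nneg (edges A' (env m.+1 0)) by apply: edges_nneg => u v; exact: env_ge0.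
pose s := J / 24 * thr m.
have s0 : 0 < s by rewrite mulr_gt0// divr_gt0.
have s3 : s + s + s = J / 8 * thr m by rewrite /s; lra.
have key : 16^-1 <= Ex (edges A' (env m.+1 0))
    (fun w => ind R (exists v, s + s + s <= cl w (bx (L ^ m.+1)) v)).
  rewrite -envG_spr Ex_edges_add Ex_cat.
  apply: (@le_trans _ _ (Ex (edges A' (envG m)) (fun w => ind R (J / 8 <= N w) * 2^-1))).
    by rewrite ExZr; move: hN; move: (Ex _ _) => p; lra.
  apply: Ex_le => // w.
  have [Jw|Jw] := pselect (J / 8 <= N w); last first.
    by rewrite (indF _ Jw) mul0r; apply: Ex_ge0 => // w2; exact: ind_ge0.
  rewrite (indT _ Jw) mul1r.
  have [j0 [j0g [v0 hv0]]] : exists j0, j0 \in grid m /\ good j0 w.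
    apply: contrapT => hn; have : N w = 0.
      rewrite /N big_seq big1// => j jg; rewrite indF// => gj.
      by apply: hn; exists j.
    by move=> N0; move: Jw; rewrite N0; lra.
  (* The representatives of the large clusters depend on [w] alone and are fixed before [w2] is
     sampled. *)
  have /choice[vf hvf] : forall j, exists v, good j w -> thr m <= cl w (B j) v.
    move=> j; have [[v hv]|ng] := pselect (good j w); first by exists v.
    by exists 0.
  have bad j : j \in grid m ->
     Ex (edges A' (spr m)) (fun w2 => ind R (good j w /\ ~ conn (w `|` w2) v0 (vf j)))
       <= expR (- K2).
    move=> jg; have [gj|gj] := pselect (good j w); last first.
      rewrite (Ex_ext (fun=> 0)) ?Ex_cst ?expR_ge0// => w2.
      by rewrite indF// => -[].
    apply: (@le_trans _ _ (1 - Ex (edges A' (spr m)) (fun w2 => ind R (conn (w `|` w2) v0 (vf j))))).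
      rewrite -[1](Ex_cst (edges A' (spr m))) -ExB; apply: Ex_le => // w2.
      by rewrite -ind_not; apply: ind_le => -[].
    rewrite lerBlDr addrC -lerBlDr.
    apply: le_trans (sprinkle (eps := eps m) w v0 (vf j) (uB j0) (uB j)
      (BA _ j0g) (BA _ jg) (@spr_ge0 m) _); last first.
      by exact: (spr_ge (BL _ j0g) (BL _ jg)).
    rewrite lerD2l lerN2 ler_expR lerN2 -(eps_thr m) -mulrA ler_pM2l// expr2.
    by apply: ler_pM; rewrite ?(ltW t0)// hvf.
  have sumbad : Ex (edges A' (spr m)) (fun w2 =>
     \sum_(j <- grid m) ind R (good j w /\ ~ conn (w `|` w2) v0 (vf j))) <= 2^-1.
    rewrite Ex_sum; apply: le_trans K2E; rewrite -/J -sJ mulr_suml big_seq [leRHS]big_seq.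
    by apply: ler_sum => j /bad; rewrite mul1r.
  rewrite -[leLHS](_ : 1 - 2^-1 = _); last lra.
  apply: (@le_trans _ _ (1 - Ex (edges A' (spr m)) (fun w2 =>
     \sum_(j <- grid m) ind R (good j w /\ ~ conn (w `|` w2) v0 (vf j))))).
    by rewrite lerD2l lerN2.
  rewrite -[1](Ex_cst (edges A' (spr m))) -ExB; apply: Ex_le => // w2.
  have [hc|hc] := pselect (forall j, j \in grid m -> good j w -> conn (w `|` w2) v0 (vf j)).
    rewrite indT.
      by rewrite lerBlDr lerDl sumr_ge0// => j _; exact: ind_ge0.
    exists v0; rewrite s3; apply: le_trans (sum_cl_grid _ _ _).
    apply: (@le_trans _ _ (N w * thr m)); first by rewrite ler_pM2r.
    rewrite /N mulr_suml big_seq [leRHS]big_seq; apply: ler_sum => j jg.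
    have [gj|gj] := pselect (good j w); last by rewrite (indF _ gj) mul0r cl_ge0.
    rewrite (indT _ gj) mul1r (cl_conn _ _ (hc j jg gj)).
    by apply: le_trans (hvf j gj) (cl_sub _ _ _ _); exact: subsetUl.
  apply: (@le_trans _ _ 0); last exact: ind_ge0.
  have [j [jg gj nj]] : exists j, [/\ j \in grid m, good j w & ~ conn (w `|` w2) v0 (vf j)].
    apply: contrapT => hn; apply: hc => j jg gj; apply: contrapT => nj.
    by apply: hn; exists j.
  rewrite subr_le0 (big_rem j)//= indT// lerDl sumr_ge0// => i _; exact: ind_ge0.
exists A'; split=> //.
have := le_trans key (tight_max nC (bx_uniq _ _) s0).
set p := Ex _ _ => hp.
have p0 : 0 <= p by apply: Ex_ge0 => // w; exact: ind_ge0.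
have hp4 : 4^-1 <= p.
  rewrite -(@ler_pXn2r _ 2) ?nnegrE ?invr_ge0//; apply: le_trans hp.
  by rewrite le_eqVlt; apply/orP; left; apply/eqP; rewrite exprVn; congr (_^-1); rewrite expr2; lra.
apply: le_trans hp4 _; apply: Ex_le => // w; apply: ind_le => -[v hv]; exists v.
apply: le_trans hv; rewrite /s /thr exprSr mulrA mulrC; apply: ler_wpM2r; first exact: ltW.
by rewrite ler_pdivlMr// mulrC.
Qed.

Lemma env_top x : env M.+1 x = h.
Proof.
by apply/funext => u; apply/funext => v; rewrite /env /rem big_geq// subr0.
Qed.

Lemma chi_box n A : uniq A -> Ex (edges A h) (fun w => cl w (bx n) 0) <= X.
Proof.
move=> uA; pose A' := undup (A ++ bx n).
have uA' : uniq A' by exact: undup_uniq.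
apply: le_trans (chi uA').
apply: (@le_trans _ _ (Ex (edges A' h) (fun w => cl w (bx n) 0))).
  apply: Ex_edges_sub => //; last exact: incr_cl.
  by move=> x xA; rewrite mem_undup mem_cat xA.
apply: Ex_le => [|w]; first exact: edges_nneg.
by apply: cl_subset => [|x xb]; [exact: bx_uniq|rewrite mem_undup mem_cat xb orbT].
Qed.

Lemma Ex_cl_transl x A B : Ex (edges A h) (fun w => cl w B x) =
  Ex (edges (transl (- x) A) h) (fun w => cl w (transl (- x) B) 0).
Proof.
rewrite Ex_transl; under [in RHS]Ex_ext do rewrite -(subrr x) cl_transl.
congr Ex; congr edges; apply/funext => u; apply/funext => v; by rewrite hinv.
Qed.

Lemma chi_at x A B : uniq A -> uniq B -> Ex (edges A h) (fun w => cl w B x) <= X.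
Proof.
move=> uA uB; rewrite Ex_cl_transl.
have uA1 : uniq (transl (- x) A) by rewrite transl_uniq.
pose A' := undup (transl (- x) A ++ transl (- x) B).
have uA' : uniq A' by exact: undup_uniq.
apply: le_trans (chi uA').
apply: (@le_trans _ _ (Ex (edges A' h) (fun w => cl w (transl (- x) B) 0))).
  apply: Ex_edges_sub => //; last exact: incr_cl.
  by move=> y yA; rewrite mem_undup mem_cat yA.
apply: Ex_le => [|w]; first exact: edges_nneg.
by apply: cl_subset => [|y yb]; [rewrite transl_uniq|rewrite mem_undup mem_cat yb orbT].
Qed.

Hypothesis XA : X < A0 * b ^+ M.+1 / eps0.
Hypothesis XT : ((L ^ M.+1).*2.+1 ^ d)%:R * X < thr M.+1 ^+ 2 / 4.

(** At the top nothing is set aside, and the bound [X] applies. For the largest cluster, each of its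
    at least [thr] points in the box sees at least [thr] points, so the cluster sizes summed over
    the box reach [thr ^+ 2], whereas their mean is at most the volume times [X]. *)
Lemma not_big_top : ~ bigmean M.+1 /\ ~ bigmax M.+1.
Proof.
rewrite /bigmean /bigmax env_top; split=> -[A [uA hA]].
  by have := lt_le_trans XA (le_trans hA (chi_box _ uA)); rewrite ltxx.
pose B := bx (L ^ M.+1); have t0 := thr_gt0 M.+1.
have nA : nneg (edges A h) by exact: edges_nneg.
have : thr M.+1 ^+ 2 / 4 <= Ex (edges A h) (fun w => \sum_(x <- B) cl w B x).
  apply: (@le_trans _ _ (Ex (edges A h) (fun w => thr M.+1 ^+ 2 *
      ind R (exists v, thr M.+1 <= cl w B v)))).
    by rewrite ExZ ler_pM2l// exprn_gt0.
  apply: Ex_le => // w; have [[v hv]|hn] := pselect (exists v, thr M.+1 <= cl w B v); last first.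
    by rewrite (indF _ hn) mulr0 sumr_ge0// => x _; exact: cl_ge0.
  rewrite indT; last by exists v.
  rewrite mulr1 expr2; apply: (@le_trans _ _ (cl w B v * thr M.+1)).
    by rewrite ler_pM2r.
  rewrite /cl mulr_suml; apply: ler_sum => x _.
  have [vx|vx] := pselect (conn w v x); last first.
    by rewrite (indF _ vx) mul0r; exact: cl_ge0.
  by rewrite (indT _ vx) mul1r -/(cl w B x) -(cl_conn R B vx).
rewrite Ex_sum leNgt => /negP; apply; apply: le_lt_trans XT.
apply: (@le_trans _ _ (\sum_(x <- B) X)).
  by apply: ler_sum => x _; apply: chi_at => //; exact: bx_uniq.
by rewrite big_const_seq count_predT iter_addr_0 size_bx mulr_natl.
Qed.

(** The runaway is read backwards from the top scale; [k] counts the scales below it. *)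
Lemma not_bigmean m : (m <= M.+1)%N -> ~ bigmean m.
Proof.
have [n1 n2] := not_big_top.
suff : forall k, (k <= M.+1)%N -> ~ bigmean (M.+1 - k) /\ ~ bigmax (M.+1 - k).
  by move=> hk mM; rewrite -(subKn mM); exact: (hk _ (leq_subr _ _)).1.
elim=> [|k IH] kM; first by rewrite subn0.
have [i1 i2] := IH (ltnW kM).
have e : (M.+1 - k)%N = (M.+1 - k.+1).+1 by rewrite subnSK.
rewrite e in i1 i2.
have kM' : (M.+1 - k.+1 <= M)%N by rewrite subSS leq_subr.
have j2 : ~ bigmax (M.+1 - k.+1) by move=> /(bigmax_step kM').
by split=> // j1; apply: i1; exact: bigmean_step.
Qed.

(** Scales beyond [M.+1] are included because restoring scale [M] calls for [m = M.+2]; there the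
    kernel is [h] itself. *)
Lemma env_bound m A : uniq A ->
  Ex (edges A (env m 0)) (fun w => cl w (bx (L ^ m)) 0) <= A0 * b ^+ m / eps0.
Proof.
move=> uA; have [mM|Mm] := leqP m M.+1.
  rewrite leNgt; apply/negP => hlt; apply: (not_bigmean mM); exists A; split=> //.
  exact: ltW.
have -> : env m 0 = h.
  by apply/funext => u; apply/funext => v; rewrite /env /rem big_geq ?subr0// ltnW.
apply: le_trans (chi_box _ uA) _; apply: le_trans (ltW XA) _.
apply: ler_wpM2r; first by rewrite invr_ge0 ltW.
apply: ler_wpM2l; first exact: A0_ge0.
by apply: ler_weXn2l; [exact: ltW|exact: ltnW].
Qed.

Hypothesis b_lt : b < L%:R ^+ d.

(** * Restoring the parts set aside, one scale at a time *)

Section Telescope.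
Variable n : nat.

(** What is still set aside once the scales below [m] are restored. The radii stay frozen at their
    values for scale [n], so consecutive [sigma] differ by exactly one scale and [sigma n] is
    [rem n 0]. *)
Definition sigma m u v : R :=
  \sum_(m <= k < M.+1) eps k *+ near_pair (Rad k n) 0 u v.

Lemma sigma_le m u v : sigma m u v <= h u v.
Proof. by apply: (@pair_sum_le m (Rad^~ n)) => k; rewrite /Rad leq_subr. Qed.

Lemma env_sigma_ge0 m u v : 0 <= h u v - sigma m u v.
Proof. by rewrite subr_ge0 sigma_le. Qed.

Lemma rem_le_sigma m x u v : (n <= m)%N -> (linf x <= L ^ n)%N ->
  rem m.+2 x u v <= sigma m.+1 u v.
Proof.
move=> nm xL; have [mM|Mm] := leqP m.+2 M.+1; last first.
  rewrite /rem big_geq ?(ltnW Mm)// sumr_ge0// => k _.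
  by rewrite mulrn_wge0// ltW// eps_gt0.
rewrite /sigma big_ltn// -[leLHS]add0r; apply: lerD.
  by rewrite mulrn_wge0// ltW// eps_gt0.
apply: ler_sum_nat => k /andP[mk _]; apply: mulb_le; first exact/ltW/eps_gt0.
apply: near_le; rewrite subr0 /Rad.
have h1 : (L ^ m.+3 <= L ^ k.+1)%N by exact: expL_mono.
have h2 : (L ^ n.+2 <= L ^ m.+3)%N by apply: expL_mono; rewrite !ltnS ltnW.
exact: radius_margin xL h1 h2 (expL_step n.+1) (expL_step n).
Qed.

(** After recentring at [x], the box of radius [Rad m n], at most [4 * L ^ m.+1], has to fit into a
    box of the hierarchy; this is why the bound of scale [m.+2] is used. *)
Lemma cl_sigma_bound m x A : uniq A -> (n <= m)%N -> (linf x <= L ^ n)%N ->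
  Ex (edges A (fun u v => h u v - sigma m.+1 u v)) (fun w => cl w (bx (Rad m n)) x)
  <= A0 * b ^+ m.+2 / eps0.
Proof.
move=> uA nm xL; pose A' := transl (- x) A.
have uA' : uniq A' by rewrite transl_uniq.
apply: le_trans (env_bound m.+2 uA').
have AE : A = transl x A'.
  by rewrite /A' /transl -map_comp map_id_in// => y _ /=; rewrite subrK.
have -> : env m.+2 0 = (fun u v => env m.+2 x (u + x) (v + x)).
  by apply/funext => u; apply/funext => v; rewrite env_transl.
rewrite [leRHS](Ex_ext (fun w => cl (translc x w) (transl x (bx (L ^ m.+2))) x)); last first.
  by move=> w; have := cl_transl R x w (bx (L ^ m.+2)) 0; rewrite add0r => ->.
rewrite -(Ex_transl x A' (env m.+2 x) (fun w => cl w (transl x (bx (L ^ m.+2))) x)) -AE.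
apply: (@le_trans _ _ (Ex (edges A (env m.+2 x)) (fun w => cl w (bx (Rad m n)) x))).
  apply: Ex_edges_weight; last exact: incr_cl.
  by move=> u v; rewrite env_sigma_ge0 lerD2l lerN2 rem_le_sigma.
apply: Ex_le => [|w]; first by apply: edges_nneg => u v; exact: env_ge0.
apply: cl_subset; first exact: bx_uniq.
move=> y; rewrite mem_transl !mem_bx /Rad => yR.
apply: leq_trans (linf_sub y x) _.
by apply: radius_fit xL (expL_step m.+1) (expL_step n) _ yR; exact: expL_mono.
Qed.

(** The restored edges join points [u], [v] of the box of radius [Rad m n]. In the bound of
    [Ex_conn_add] the sums over [u] and [v] therefore separate into two clusters truncated to that
    box, each of mean at most [Dm]. *)
Lemma telescope_step m A : uniq A -> (n <= m)%N -> (m <= M)%N ->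
  Ex (edges A (fun u v => h u v - sigma m.+1 u v)) (fun w => cl w (bx (L ^ n)) 0) <=
  Ex (edges A (fun u v => h u v - sigma m u v)) (fun w => cl w (bx (L ^ n)) 0) +
  ((L ^ n).*2.+1 ^ d)%:R * (2 * eps m * (A0 * b ^+ m.+2 / eps0) ^+ 2).
Proof.
move=> uA nm mM; set Dm := A0 * b ^+ m.+2 / eps0.
pose q u v : R := eps m *+ near_pair (Rad m n) 0 u v.
have q0 u v : 0 <= q u v by rewrite mulrn_wge0// ltW// eps_gt0.
have WE : (fun u v => h u v - sigma m.+1 u v) = (fun u v => q u v + (h u v - sigma m u v)).
  apply/funext => u; apply/funext => v; rewrite /sigma [X in _ = _ + (_ - X)]big_ltn ?ltnS//.
  by rewrite -/(q u v); ring.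
have nQ : nneg (edges A q) by exact: edges_nneg.
have nG : nneg (edges A (fun u v => h u v - sigma m u v)).
  by apply: edges_nneg => u v; exact: env_sigma_ge0.
pose tau u v := Ex (edges A (fun u v => h u v - sigma m.+1 u v)) (fun w => ind R (conn w u v)).
have nS : nneg (edges A (fun u v => h u v - sigma m.+1 u v)).
  by apply: edges_nneg => u v; exact: env_sigma_ge0.
have tau0 u v : 0 <= tau u v by apply: Ex_ge0 => // w; exact: ind_ge0.
have tauC u v : tau u v = tau v u.
  by apply: Ex_ext => w; apply: ind_eq; split; exact: conn_sym.
have tau_sum x : (linf x <= L ^ n)%N ->
    \sum_(u <- A | u \in bx (Rad m n)) tau x u <= Dm.
  move=> xL; apply: le_trans (cl_sigma_bound uA nm xL).
  by rewrite Ex_sum; apply: ler_sum_sub.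
have pt x : x \in bx (L ^ n) -> tau 0 x <=
    Ex (edges A (fun u v => h u v - sigma m u v)) (fun w => ind R (conn w 0 x)) +
    2 * eps m * Dm ^+ 2.
  rewrite mem_bx => xL; rewrite /tau WE Ex_edges_add.
  apply: le_trans (Ex_conn_add (T := tau) 0 x nQ nG _) _.
    by move=> u v; rewrite /tau WE Ex_edges_add.
  rewrite lerD2l (sum_edges A q (fun e a => a * (tau 0 e.1 * tau e.2 x + tau 0 e.2 * tau e.1 x))) /=.
  pose S y := \sum_(u <- A | u \in bx (Rad m n)) tau y u.
  have S0 y : 0 <= S y by exact: sumr_ge0.
  apply: (@le_trans _ _ (eps m * (S 0 * S x + S x * S 0))); last first.
    have h1 : S 0 <= Dm by apply: tau_sum; rewrite linf0.
    have h2 : S x <= Dm by exact: tau_sum.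
    have -> : 2 * eps m * Dm ^+ 2 = eps m * (Dm * Dm + Dm * Dm) by ring.
    by apply: ler_wpM2l; [exact/ltW/eps_gt0|apply: lerD; apply: ler_pM].
  rewrite [S 0 * S x]big_distrlr [S x * S 0]big_distrlr /= -big_split mulr_sumr /=.
  rewrite [leRHS]big_mkcond; apply: ler_sum => u _.
  case: ifPn => [uR|uR]; last first.
    rewrite big1// => v _; rewrite /q /near_pair !subr0 -!mem_bx (negbTE uR) andbF.
    by rewrite mul0r.
  rewrite -big_split mulr_sumr /= [leRHS]big_mkcond; apply: ler_sum => v _.
  case: ifPn => [vR|vR]; last first.
    by rewrite /q /near_pair !subr0 -!mem_bx (negbTE vR) !andbF mul0r.
  rewrite (tauC v x) (mulrC (tau 0 v)) (tauC u x); apply: ler_wpM2r.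
    by rewrite addr_ge0// mulr_ge0.
  by rewrite /q; case: near_pair => //; exact/ltW/eps_gt0.
rewrite Ex_sum big_seq; apply: le_trans (ler_sum _ pt) _.
rewrite -big_seq big_split /= -Ex_sum lerD2l.
by rewrite big_const_seq count_predT iter_addr_0 size_bx -[leLHS]mulr_natl.
Qed.

(** The costs of the scales above [n] form a geometric series of ratio [b / L^d], below one since
    [alpha < d], and the total is again of order [b^n]. *)
Lemma mean_cluster_bound A : uniq A -> (n <= M.+1)%N ->
  Ex (edges A h) (fun w => cl w (bx (L ^ n)) 0) <=
  b ^+ n / eps0 * (A0 + 2 * 3 ^+ d * A0 ^+ 2 * b ^+ 4 / (1 - b / L%:R ^+ d)).
Proof.
move=> uA nM.
have l0 : 0 < L%:R :> R by rewrite ltr0n L_gt0.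
have ld0 : 0 < L%:R ^+ d :> R by rewrite exprn_gt0.
have b0 : 0 < b by rewrite (lt_trans ltr01).
set th := b / L%:R ^+ d.
have th0 : 0 <= th by rewrite divr_ge0 ?ltW.
have th1 : th < 1 by rewrite ltr_pdivrMr ?mul1r.
pose C := 2 * 3 ^+ d * A0 ^+ 2 * b ^+ 4 / eps0.
have C0 : 0 <= C.
  by rewrite divr_ge0 ?(ltW eps0_gt0)// mulr_ge0 ?exprn_ge0 ?(ltW b0)// mulr_ge0 ?exprn_ge0 ?A0_ge0// mulr_ge0 ?exprn_ge0.
have step k : ((L ^ n).*2.+1 ^ d)%:R * (2 * eps (n + k) * (A0 * b ^+ (n + k).+2 / eps0) ^+ 2)
    <= C * b ^+ n * th ^+ k.
  have hL : ((L ^ n).*2.+1 ^ d)%:R <= 3 ^+ d * (L%:R ^+ n) ^+ d :> R.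
    rewrite -exprMn natrX; apply: lerXn2r; rewrite ?nnegrE ?mulr_ge0 ?exprn_ge0//.
    rewrite -natrX -natrM ler_nat.
    by apply: double_le_triple; rewrite expn_gt0 L_gt0.
  apply: le_trans (ler_wpM2r _ hL) _.
    by apply: mulr_ge0; rewrite ?sqr_ge0// mulr_ge0// ltW// eps_gt0.
  by rewrite /eps term_arith.
have ind k : (n + k <= M.+1)%N ->
   Ex (edges A (fun u v => h u v - sigma (n + k) u v)) (fun w => cl w (bx (L ^ n)) 0) <=
   A0 * b ^+ n / eps0 + C * b ^+ n * ((1 - th ^+ k) / (1 - th)).
  elim: k => [|k IH] kM.
    by rewrite addn0 expr0 subrr mul0r mulr0 addr0; exact: env_bound.
  rewrite addnS in kM *.
  apply: le_trans (telescope_step uA (leq_addr _ _) kM) _.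
  apply: le_trans (lerD (IH (ltnW kM)) (step k)) _.
  rewrite -addrA lerD2l -mulrDr; apply: ler_wpM2l.
    by rewrite mulr_ge0// exprn_ge0// ltW.
  rewrite le_eqVlt; apply/orP; left; apply/eqP; rewrite exprS.
  by move: (th ^+ k) => tk; field; lra.
have := ind (M.+1 - n)%N; rewrite subnKC// => /(_ (leqnn _)).
have -> : (fun u v => h u v - sigma M.+1 u v) = h.
  by apply/funext => u; apply/funext => v; rewrite /sigma big_geq// subr0.
move=> /le_trans; apply.
have -> : b ^+ n / eps0 * (A0 + 2 * 3 ^+ d * A0 ^+ 2 * b ^+ 4 / (1 - th)) =
   A0 * b ^+ n / eps0 + C * b ^+ n * (1 / (1 - th)).
  by rewrite /C; move: (3 ^+ d) (b ^+ n) => t3 bn; field; rewrite !gt_eqF ?subr_gt0.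
rewrite lerD2l; apply: ler_wpM2l; first by rewrite mulr_ge0// exprn_ge0// ltW.
by apply: ler_wpM2r; rewrite ?invr_ge0 ?gerBl ?exprn_ge0// subr_ge0 ltW.
Qed.

End Telescope.

End Renormalization.

(** * Choice of the constants *)

Lemma expr_unbounded (R : realType) (b C : R) (n : nat) : 1 < b ->
  exists2 m, (n <= m)%N & C < b ^+ m.
Proof.
move=> b1; pose m0 := (Num.truncn (C / (b - 1))).+1.
exists (maxn n m0); first exact: leq_maxl.
have h1 : C < m0%:R * (b - 1).
  by rewrite -ltr_pdivrMr ?subr_gt0//; exact: truncnS_gt.
have h2 : m0%:R * (b - 1) <= b ^+ m0.
  elim: (m0) => [|k IH]; first by rewrite mul0r.
  rewrite exprS -natr1 mulrDl mul1r.
  have : 1 <= b ^+ k by apply: exprn_ege1; exact: ltW.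
  by move: IH; move: (b ^+ k) (k%:R * (b - 1)) => p q; nra.
apply: lt_le_trans h1 (le_trans h2 _).
by apply: ler_weXn2l; [exact: ltW|exact: leq_maxr].
Qed.

Lemma geometric_tail (R : realType) (a Y : R) (P : pred nat) (N : nat) : 2 <= a ->
  0 <= Y -> (forall k, P k -> (a ^+ k)^-1 <= Y) ->
  \sum_(0 <= k < N) (a ^+ k)^-1 *+ P k <= 2 * Y.
Proof.
move=> a2 Y0 hP.
have ap k : 0 < (a ^+ k)^-1 by rewrite invr_gt0 exprn_gt0//; lra.
have as_ k : 2 * (a ^+ k.+1)^-1 <= (a ^+ k)^-1.
  rewrite exprS invfM mulrA; apply: ler_piMl; first exact: ltW.
  by rewrite ler_pdivrMr; lra.
(* Once the sum is nonzero, the slack [2 * (a ^+ N)^-1] pays for all the later terms. *)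
suff : \sum_(0 <= k < N) (a ^+ k)^-1 *+ P k = 0 \/
    \sum_(0 <= k < N) (a ^+ k)^-1 *+ P k <= 2 * Y - 2 * (a ^+ N)^-1.
  by case=> [->|]; [rewrite mulr_ge0|have := ap N; lra].
elim: N => [|N IH]; first by left; rewrite big_geq.
rewrite big_nat_recr//=; have := as_ N; have := ap N.
case: (boolP (P N)) => [/hP pN|_].
  by move=> h1 h2; right; case: IH => [->|]; rewrite ?mulr1n; lra.
by move=> h1 h2; rewrite mulr0n addr0; case: IH => [->|h3]; [left|right; lra].
Qed.

Lemma triple_le_double (n : nat) : (3 * n + 1 <= n.*2.+1 * 2)%N.
Proof. lia. Qed.

(** [A1] is fixed before [h]: the constant [kappa] enters only through [eps0], and [X] only through
    the number [M] of scales. *)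
Lemma truncated_susceptibility (R : realType) (d : nat) (al : R) :
  (1 <= d)%N -> 0 < al -> al < d%:R -> exists2 A1 : R, 0 <= A1 &
  forall (h : Zd d -> Zd d -> R) (kappa X : R),
    (forall u v, 0 <= h u v) ->
    (forall z u v, h (u + z) (v + z) = h u v) -> 0 < kappa ->
    (forall u v, u != v -> kappa * (linf (u - v))%:R `^ (- (d%:R + al)) <= h u v) ->
    (forall A, uniq A -> Ex (edges A h) (fun w => cl R w A 0) <= X) ->
  forall A, uniq A -> forall n, (1 <= n)%N ->
    Ex (edges A h) (fun w => cl R w (bx d n) 0) <= A1 / kappa * n%:R `^ al.
Proof.
move=> d1 al0 ald.
have dpos : 0 < d%:R :> R by rewrite ltr0n.
set s := d%:R + al.
have s0 : 0 < s by rewrite addr_gt0.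
pose Q : R := 24 * 2 ^+ d.
have Q0 : 0 < Q by rewrite mulr_gt0// exprn_gt0.
(* As [2 * Z + 1] is at least [l / 2] and [g = l^((d+al)/2)], the condition [gZ] reduces to
   [l^((d-al)/2) >= Q], which [al < d] makes possible. *)
pose Z := (Num.truncn (Q `^ (2 / (d%:R - al)))).+1.
have Z1 : (1 <= Z)%N by [].
pose l : R := (3 * Z + 1)%:R.
have l4 : 4 <= l by rewrite ler_nat; lia.
have l0 : 0 < l by lra.
pose b := l `^ al.
have l1 r : 0 < r -> 1 < l `^ r.
  move=> r0; have -> : 1 = 1 `^ r :> R by rewrite powR1.
  by apply: gt0_ltr_powR => //; rewrite ?nnegrE; lra.
have b1 : 1 < b by exact: l1.
have b0 : 0 < b by lra.
have lds : l ^+ d * b = l `^ s.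
  by rewrite /b /s powRD ?powR_mulrn ?ltW//; apply/implyP => _; rewrite gt_eqF.
have bd : b < l ^+ d.
  rewrite -powR_mulrn ?ltW// -[d%:R](subrK al) powRD; last first.
    by apply/implyP => _; rewrite gt_eqF.
  by rewrite -/b ltr_pMl// l1// subr_gt0.
pose g := l `^ (s / 2).
have g0 : 0 < g by rewrite powR_gt0.
have gE : g ^+ 2 = l ^+ d * b.
  by rewrite lds /g -powR_mulrn ?ltW// -powRrM; congr (_ `^ _); field.
have gZ : 24 * g <= (Z.*2.+1 ^ d)%:R.
  have h1 : l ^+ d / 2 ^+ d <= (Z.*2.+1 ^ d)%:R.
    rewrite -expr_div_n natrX; apply: lerXn2r; rewrite ?nnegrE ?divr_ge0 ?(ltW l0)//.
    by rewrite ler_pdivrMr// -natrM ler_nat; exact: triple_le_double.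
  apply: le_trans h1; rewrite ler_pdivlMr ?exprn_gt0// mulrAC -/Q.
  have -> : l ^+ d = l `^ ((d%:R - al) / 2) * g.
    rewrite -powR_mulrn ?(ltW l0)// /g -powRD ?(gt_eqF l0) ?implybT//.
    by congr (_ `^ _); rewrite /s; field.
  apply: ler_wpM2r; first exact: ltW.
  have dal : 0 < d%:R - al by lra.
  rewrite -[leLHS](_ : (Q `^ (2 / (d%:R - al))) `^ ((d%:R - al) / 2) = Q); last first.
    rewrite -powRrM (_ : _ * _ = 1) ?powRr1 ?ltW//.
    by field; rewrite gt_eqF.
  apply: ge0_ler_powR; rewrite ?nnegrE ?powR_ge0 ?(ltW l0)//; first lra.
  apply: le_trans (ltW (truncnS_gt _)) _.
  by rewrite -/Z ler_nat addn1 leqW// leq_pmull.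
pose J : R := (Z.*2.+1 ^ d)%:R.
have J1 : 1 <= J by rewrite ler1n expn_gt0.
(* This makes the union bound over [J] boxes equal to one half. *)
pose K2 := ln (2 * J).
have K20 : 0 < K2 by rewrite ln_gt0//; lra.
have K2E : J * expR (- K2) <= 2^-1.
  rewrite expRN lnK ?posrE; last lra.
  by rewrite invfM mulrCA divff ?mulr1//; lra.
pose A0 := 81 * (1 + K2).
have A00 : 0 < A0 by rewrite mulr_gt0// addr_gt0.
pose C := A0 + 2 * 3 ^+ d * A0 ^+ 2 * b ^+ 4 / (1 - b / l ^+ d).
have th1 : 0 < 1 - b / l ^+ d by rewrite subr_gt0 ltr_pdivrMr ?exprn_gt0// mul1r.
have C0 : 0 <= C.
  rewrite addr_ge0 ?(ltW A00)// divr_ge0 ?(ltW th1)//.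
  by rewrite mulr_ge0 ?(exprn_ge0 4 (ltW b0))// mulr_ge0 ?sqr_ge0// mulr_ge0 ?exprn_ge0.
have l8 : 0 < (8 * l) `^ s by rewrite powR_gt0// mulr_gt0.
exists (b * C * (2 * (8 * l) `^ s)).
  by rewrite !mulr_ge0 ?(ltW b0) ?(ltW l8).
move=> h kappa X h0 hinv k0 hlow chi A uA n n1.
(* At scale [k] pairs are up to [8 * l * l^k] apart, whence [(8 * l)^s]; the 2 pays for the
   geometric sum over the scales using the same pair. *)
pose eps0 := kappa / (2 * (8 * l) `^ s).
have e0 : 0 < eps0 by rewrite divr_gt0// mulr_gt0.
pose T := Num.sqrt (K2 / eps0).
have T0 : 0 < T by rewrite sqrtr_gt0 divr_gt0.
have TE : eps0 * T ^+ 2 = K2.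
  have KE : 0 <= K2 / eps0 by apply: divr_ge0; exact: ltW.
  by rewrite (sqr_sqrtr KE); field; rewrite gt_eqF.
pose j := up_log (3 * Z + 1) n.
(* The two entries of the maximum are what [hXA] and [hXT] require. In the second one the volume
   [L^(dM)] cancels against the same factor in the square of [thr]. *)
have [M1 jM CM] := @expr_unbounded R b (Num.max (X * eps0 / A0) (4 * 3 ^+ d * X / T ^+ 2)) j.+1 b1.
case: M1 jM CM => // M jM; rewrite gt_max => /andP[CM1 CM2].
have hl u v : u != v ->
  \sum_(0 <= k < M.+1) eps d Z eps0 b k *+ (linf (u - v)%R <= 8 * (3 * Z + 1) ^ k.+1)%N <= h u v.
  move=> uv; apply: le_trans (hlow u v uv).
  set D := linf _.
  have D0 : (0 < D)%N.
    rewrite lt0n; apply: contra_neqN uv => /eqP /linf_eq0 /eqP; rewrite subr_eq0.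
    by move=> /eqP.
  have Dp : 0 < D%:R :> R by rewrite ltr0n.
  pose Y := (8 * l) `^ s * D%:R `^ (- s).
  have Y0 : 0 <= Y by rewrite mulr_ge0 ?powR_ge0.
  have -> : kappa * D%:R `^ (- s) = eps0 * (2 * Y).
    by rewrite /eps0 /Y; field; rewrite gt_eqF.
  have -> : \sum_(0 <= k < M.+1) eps d Z eps0 b k *+ (D <= 8 * (3 * Z + 1) ^ k.+1)%N
     = eps0 * \sum_(0 <= k < M.+1) ((l ^+ d * b) ^+ k)^-1 *+ (D <= 8 * (3 * Z + 1) ^ k.+1)%N.
    by rewrite mulr_sumr; apply: eq_bigr => k _; rewrite mulrnAr.
  apply: ler_wpM2l; first exact: ltW.
  apply: (@geometric_tail _ _ _ (fun k => (D <= 8 * (3 * Z + 1) ^ k.+1)%N)) => //.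
    have : 1 <= l ^+ d by apply: exprn_ege1; lra.
    have : 4 <= l ^+ d.
      apply: (le_trans l4); rewrite -[leLHS]expr1; apply: ler_weXn2l => //; lra.
    by nra.
  move=> k Dk; rewrite lds -powR_mulrn ?powR_ge0// -powRrM mulrC powRrM powR_mulrn ?(ltW l0)//.
  rewrite /Y powRN -ler_pdivrMr ?invr_gt0 ?powR_gt0// invrK mulrC.
  rewrite ler_pdivrMr ?powR_gt0 ?exprn_gt0// -powRM ?exprn_ge0 ?mulr_ge0 ?(ltW l0)//.
  apply: ge0_ler_powR; rewrite ?nnegrE ?mulr_ge0 ?exprn_ge0 ?(ltW l0)//; first exact: ltW.
  rewrite -mulrA -exprS -natrX -natrM ler_nat//.
have hXA : X < A0 * b ^+ M.+1 / eps0.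
  by rewrite ltr_pdivlMr// [ltRHS]mulrC -ltr_pdivrMr.
have hXT : (((3 * Z + 1) ^ M.+1).*2.+1 ^ d)%:R * X < thr g T M.+1 ^+ 2 / 4.
  have X0 : 0 <= X.
    by apply: le_trans (chi [::] isT); apply: Ex_ge0 => // w; exact: cl_ge0.
  rewrite /thr exprMn (_ : (g ^+ M.+1) ^+ 2 = (l ^+ M.+1) ^+ d * b ^+ M.+1); last first.
    by rewrite -exprM mulnC exprM gE exprMn -!exprM mulnC.
  have hL : (((3 * Z + 1) ^ M.+1).*2.+1 ^ d)%:R <= 3 ^+ d * (l ^+ M.+1) ^+ d :> R.
    rewrite -exprMn natrX; apply: lerXn2r; rewrite ?nnegrE ?mulr_ge0 ?exprn_ge0 ?(ltW l0)//.
    rewrite -natrX -natrM ler_nat.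
    by apply: double_le_triple; rewrite expn_gt0 addn1.
  apply: le_lt_trans (ler_wpM2r X0 hL) _.
  have lM : 0 < (l ^+ M.+1) ^+ d by rewrite !exprn_gt0.
  move: CM2; rewrite ltr_pdivrMr ?exprn_gt0//.
  move: ((l ^+ M.+1) ^+ d) lM (3 ^+ d) (b ^+ M.+1) (T ^+ 2) => p p0 t bM T2 hh.
  rewrite -subr_gt0.
  have -> : T2 * (p * bM) / 4 - t * p * X = p * (bM * T2 / 4 - t * X) by field.
  by rewrite mulr_gt0//; lra.
have := @mean_cluster_bound R d h Z M eps0 b g T K2 A0 X Z1 h0 hinv e0 b1 (ltW bd) T0 g0 gE TE
  K2E gZ (lexx _) hl chi hXA hXT bd j A uA _.
have jM' : (j <= M.+1)%N by apply: ltnW.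
move=> /(_ jM') hj.
have nj : (n <= (3 * Z + 1) ^ j)%N by apply: up_logP; rewrite addn1.
apply: (@le_trans _ _ (Ex (edges A h) (fun w => cl R w (bx d ((3 * Z + 1) ^ j)) 0))).
  apply: Ex_le; first exact: edges_nneg.
  move=> w; apply: cl_subset; first exact: bx_uniq.
  by move=> x; rewrite !mem_bx => /leq_trans; apply.
apply: (le_trans hj); rewrite -/C.
have bj : b ^+ j <= b * n%:R `^ al.
  have [n1'|n2] := leqP n 1.
    have n1e : n = 1%N by apply/eqP; rewrite eqn_leq n1' n1.
    by rewrite /j n1e up_log1 expr0 powR1 mulr1 ltW.
  have L1 : (1 < 3 * Z + 1)%N by rewrite addn1 ltnS muln_gt0.
  have := up_log_bounds L1 n2; rewrite -/j => /andP[hjn _].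
  have j0 : (0 < j)%N by rewrite up_log_gt0; apply/andP.
  rewrite -(prednK j0) exprS ler_pM2l// /b -powR_mulrn ?powR_ge0// -powRrM mulrC powRrM.
  rewrite powR_mulrn ?(ltW l0)//.
  apply: ge0_ler_powR; rewrite ?nnegrE ?exprn_ge0 ?(ltW l0) ?(ltW al0)//.
  by rewrite -natrX ler_nat ltnW.
have -> : b * C * (2 * (8 * l) `^ s) / kappa * n%:R `^ al = b * n%:R `^ al / eps0 * C.
  by rewrite /eps0; field; rewrite !gt_eqF.
by apply: ler_wpM2r => //; apply: ler_wpM2r => //; rewrite invr_ge0 ltW.
Qed.

(** * The percolation kernel and the sharpness dichotomy *)

Section HalfKernel.
Variables (R : realType) (d : nat) (J : Zd d -> Zd d -> R).
Hypothesis J0 : kernel_nonneg J.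
Hypothesis Jsym : kernel_symmetric J.
Hypothesis Jinv : kernel_transl_inv J.
Local Notation cl := (cl R).

(* Each unordered edge is represented by its two orientations, which carry
   half of its intensity. *)
Definition halfw (beta : R) (x y : Zd d) : R :=
  if x == y then 0 else beta * J x y / 2.

Lemma halfw_ge0 beta x y : 0 <= beta -> 0 <= halfw beta x y.
Proof. by move=> b0; rewrite /halfw; case: eqP => // _; rewrite divr_ge0// mulr_ge0. Qed.

Lemma halfw_sym beta x y : halfw beta x y = halfw beta y x.
Proof. by rewrite /halfw eq_sym Jsym. Qed.

Lemma halfw_transl beta z x y : halfw beta (x + z) (y + z) = halfw beta x y.
Proof.
rewrite /halfw (inj_eq (@addIr _ z)) (Jinv (x + z)) [in RHS]Jinv.
by rewrite opprD addrACA subrr addr0.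
Qed.

Lemma halfwD b1 b2 x y : halfw (b1 + b2) x y = halfw b1 x y + halfw b2 x y.
Proof. by rewrite /halfw; case: eqP => _; rewrite ?addr0//; ring. Qed.

(** The Duminil-Copin--Tassion functional of [S], with intensities in place of opening probabilities
    and the outer endpoints restricted to a finite set [A]. *)
Definition Phi beta S A := \sum_(a <- S) \sum_(b <- A | b \notin S)
  Ex (edges S (halfw beta)) (fun w => ind R (conn w 0 a)) * (halfw beta a b + halfw beta b a).

Lemma finite_susceptibility beta S : 0 <= beta -> uniq S -> 0 \in S ->
  (forall A, uniq A -> Phi beta S A <= 2^-1) ->
  exists X, forall A, uniq A -> Ex (edges A (halfw beta)) (fun w => cl w A 0) <= X.
Proof.
move=> b0 uS S0 hP.
have W0 x y : 0 <= halfw beta x y by exact: halfw_ge0.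
exists ((size S)%:R / (1 - 2^-1)) => A uA.
have key : forall B, uniq B -> {in B, forall z, Ex (edges B (halfw beta)) (fun w => cl w B z)
    <= (size S)%:R / (1 - 2^-1)}.
  apply: (@susceptibility_bound R _ (halfw beta) (fun z => transl z S)) => //.
  - by move=> z; rewrite transl_uniq.
  - by move=> z; rewrite mem_transl subrr.
  - by move=> z; rewrite size_map.
  - lra.
  move=> z B uB.
  have uB' : uniq (transl (- z) B) by rewrite transl_uniq.
  apply: le_trans (hP _ uB'); rewrite le_eqVlt; apply/orP; left; apply/eqP.
  rewrite /Phi big_map; apply: eq_bigr => a _.
  rewrite [in RHS]big_map.
  apply: eq_big => [b|b _]; first by rewrite mem_transl.
  congr (_ * (_ + _)).
  - rewrite Ex_transl.
    rewrite [LHS](Ex_ext (fun w => ind R (conn w 0 a))); last first.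
      by move=> w; apply: ind_eq; have := conn_transl z w 0 a; rewrite add0r.
    by congr (Ex (edges _ _) _); apply/funext => u; apply/funext => v; rewrite halfw_transl.
  - by rewrite -[RHS](halfw_transl _ z) subrK.
  - by rewrite -[RHS](halfw_transl _ z) subrK.
pose A' := undup (0 :: A).
have uA' : uniq A' by exact: undup_uniq.
apply: le_trans (key A' uA' 0 _); last by rewrite mem_undup mem_head.
apply: (@le_trans _ _ (Ex (edges A' (halfw beta)) (fun w => cl w A 0))).
  apply: Ex_edges_sub => //; last exact: incr_cl.
  by move=> x xA; rewrite mem_undup inE xA orbT.
apply: Ex_le => [|w]; first exact: edges_nneg.
by apply: cl_subset => // x xA; rewrite mem_undup inE xA orbT.
Qed.

Lemma power_decay (kappa : R) N : 0 <= kappa -> kappa <= 2 ->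
  (1 - kappa / 2) ^+ N <= (1 + N%:R * kappa / 2)^-1.
Proof.
move=> k0 k2.
have h1 : 1 + N%:R * kappa / 2 <= (1 + kappa / 2) ^+ N.
  elim: N => [|N IH]; first by rewrite !mul0r addr0 expr0.
  have n0 : 0 <= N%:R * kappa by rewrite mulr_ge0.
  rewrite exprS -natr1; apply: (@le_trans _ _ ((1 + kappa / 2) * (1 + N%:R * kappa / 2))).
    by move: (N%:R) n0 => n n0; nra.
  by apply: ler_wpM2l => //; lra.
have p0 : 0 <= (1 - kappa / 2) ^+ N by apply: exprn_ge0; lra.
have nk : 0 <= N%:R * kappa by rewrite mulr_ge0.
rewrite -[leRHS]div1r ler_pdivlMr; last lra.
apply: le_trans (ler_wpM2l p0 h1) _.
rewrite -exprMn; apply: exprn_ile1; nra.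
Qed.

Lemma half_bound (x q n : R) : 2 * x + q < n -> 0 < q -> x <= n * 2^-1.
Proof. lra. Qed.

Lemma quarter_bound (p b S : R) : 2^-1 <= p -> p <= 2 * b * S -> 1 <= S * (4 * b).
Proof. lra. Qed.

(** The interval from [b0] to [b1] is cut into [N] increments, each of which multiplies the
    probability of staying in the box by [1 - kappa / 2]. Since [N * kappa] does not depend on the
    box, the bound is uniform in [n]. *)
Lemma long_connections b0 b1 : 0 < b0 -> b0 < b1 ->
  (forall S, uniq S -> 0 \in S -> exists A, uniq A /\ 2^-1 <= Phi b0 S A) ->
  forall n, exists A, uniq A /\
   1 - (1 + (b1 - b0) / (8 * b0))^-1 <=
   Ex (edges A (halfw b1)) (fun w => ind R (exists2 y, (n < linf y)%N & conn w 0 y)).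
Proof.
move=> b00 b01 hS n.
pose D := [set y : Zd d | (n < linf y)%N].
pose sub (m : (size (bx d n)).-tuple bool) := mask m (bx d n).
(* A single vertex set must serve every [S] in the box, so the sets found for the finitely many
   masks are united. *)
have /choice[Af hAf] : forall m, exists A, uniq A /\ (0 \in sub m -> 2^-1 <= Phi b0 (sub m) A).
  move=> m; have [m0|m0] := boolP (0 \in sub m); last by exists [::].
  by have [A [uA hA]] := hS _ (mask_uniq (bx_uniq d n) m) m0; exists A.
pose rest := undup [seq x <- flatten [seq Af m | m <- enum {: (size (bx d n)).-tuple bool}]
   | x \notin bx d n].
pose A := bx d n ++ rest.
have uA : uniq A.
  rewrite cat_uniq bx_uniq undup_uniq andbT /=; apply/hasPn => x.
  by rewrite mem_undup mem_filter => /andP[].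
have AfA m : {subset Af m <= A}.
  move=> x xm; rewrite mem_cat mem_undup mem_filter.
  case: (boolP (x \in bx d n)) => //= _; apply/flattenP; exists (Af m) => //.
  by apply: map_f; rewrite mem_enum.
have W0 x y : 0 <= halfw b0 x y by apply: halfw_ge0; exact: ltW.
pose Jt := \sum_(x <- A) \sum_(y <- A) halfw 1 x y.
have Jt0 : 0 <= Jt by apply: sumr_ge0 => x _; apply: sumr_ge0 => y _; exact: halfw_ge0.
have db : 0 < b1 - b0 by rewrite subr_gt0.
(* The first summand keeps the total intensity of an increment below [1/2], the second one ensures
   [kappa <= 2]. *)
pose N := (Num.truncn (2 * (b1 - b0) * Jt + (b1 - b0) / (8 * b0))).+1.
have N0 : 0 < N%:R :> R by rewrite ltr0n.
have hN : 2 * (b1 - b0) * Jt + (b1 - b0) / (8 * b0) < N%:R by exact: truncnS_gt.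
have q0 : 0 < (b1 - b0) / (8 * b0) by rewrite divr_gt0// mulr_gt0.
pose delta := (b1 - b0) / N%:R.
have d0 : 0 < delta by rewrite divr_gt0.
(* [Phi >= 1/2] at [b0] is [2 * b0] times a sum with unit intensity, which is therefore at least
   [1 / (4 * b0)]; an increment carries [delta] times it. *)
pose kappa := delta / (4 * b0).
have k0 : 0 < kappa by rewrite divr_gt0// mulr_gt0.
have t1 : 0 <= 2 * (b1 - b0) * Jt by rewrite !mulr_ge0// ltW.
have Nk : N%:R * kappa / 2 = (b1 - b0) / (8 * b0).
  by rewrite /kappa /delta; field; rewrite !gt_eqF.
have k2 : kappa <= 2.
  have : N%:R * kappa <= N%:R * 2 by lra.
  by rewrite ler_pM2l.
have halfM b x y : halfw b x y = b * halfw 1 x y.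
  by rewrite /halfw; case: eqP => _; rewrite ?mulr0//; ring.
have hiter := @isolated_iter R _ D A (halfw b0) (halfw delta) 0 kappa N uA.
have A0 : 0 \in A by rewrite mem_cat mem_bx linf0.
have := hiter A0 k2 W0 (fun x y => halfw_ge0 x y (ltW d0)) _ _.
have -> : (fun x y => halfw b0 x y + halfw delta x y *+ N) = halfw b1.
  apply/funext => x; apply/funext => y; rewrite (halfM delta) (halfM b0) (halfM b1) -mulr_natl.
  by rewrite /delta; field; rewrite gt_eqF.
have -> : (fun w => ind R (exists2 y, (n < linf y)%N & conn w 0 y)) =
    (fun w => 1 - ind R (~ out D w 0)).
  apply/funext => w; rewrite -ind_not; apply: ind_eq; split=> [h|/contrapT//].
  exact.
move=> hlast; exists A; split=> //; rewrite ExB Ex_cst lerD2l lerN2 -Nk.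
apply: le_trans (power_decay N (ltW k0) k2); apply: hlast.
- rewrite -[leLHS](_ : delta * Jt = _); last first.
    rewrite mulr_sumr; apply: eq_bigr => x _; rewrite mulr_sumr; apply: eq_bigr => y _.
    by rewrite -halfM.
  have : N%:R * (delta * Jt) <= N%:R * 2^-1.
    have -> : N%:R * (delta * Jt) = (b1 - b0) * Jt by rewrite /delta; field; rewrite gt_eqF.
    by move: hN; rewrite -mulrA => /half_bound; apply.
  by rewrite ler_pM2l.
move=> m S S0 nD.
have SE : S = [seq x <- bx d n | x \in S].
  have h : S = [seq x <- A | x \in S].
    exact: mask_filter.
  rewrite {1}h filter_cat [X in _ ++ X](_ : _ = [::]) ?cats0//.
  apply/eqP; rewrite -(negbK (_ == _)) -has_filter; apply/hasPn => x.
  rewrite mem_undup mem_filter => /andP[+ _]; apply: contra => xS.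
  by rewrite mem_bx leqNgt; apply/negP => h1; exact: (nD x xS).
pose m' : (size (bx d n)).-tuple bool := [tuple of map (mem S) (in_tuple (bx d n))].
have Sm : S = sub m' by rewrite {1}SE filter_mask.
have [uAf hm] := hAf m'; rewrite -Sm in hm.
have := hm S0; set Ph := Phi _ _ _ => hPh.
have : Ph <= 2 * b0 * \sum_(a <- S) \sum_(b <- A | b \notin S)
   Ex (edges S (halfw b0)) (fun w => ind R (conn w 0 a)) * halfw 1 a b.
  rewrite /Ph /Phi mulr_sumr; apply: ler_sum => a _; rewrite mulr_sumr.
  have F0 b : 0 <= 2 * b0 *
     (Ex (edges S (halfw b0)) (fun w => ind R (conn w 0 a)) * halfw 1 a b).
    rewrite mulr_ge0 ?mulr_ge0 ?(ltW b00)// ?halfw_ge0//.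
    by apply: Ex_ge0; first exact: edges_nneg.
  apply: (@le_trans _ _ (\sum_(b <- Af m' | b \notin S) 2 * b0 *
     (Ex (edges S (halfw b0)) (fun w => ind R (conn w 0 a)) * halfw 1 a b))).
    apply: ler_sum => b _; rewrite (halfw_sym _ b a) halfM le_eqVlt; apply/orP; left.
    by apply/eqP; ring.
  rewrite -big_filter -[leRHS]big_filter; apply: ler_sum_sub => //.
    exact: filter_uniq.
  by move=> x; rewrite !mem_filter => /andP[-> /AfA ->].
set Sg := \sum_(a <- S) _ => h1.
rewrite -[leRHS](_ : delta * Sg = _); last first.
  rewrite mulr_sumr; apply: eq_bigr => a _; rewrite mulr_sumr; apply: eq_bigr => b _.
  by rewrite (halfM delta); ring.
rewrite /kappa ler_pdivrMr ?mulr_gt0// -mulrA -[leLHS]mulr1 ler_pM2l//.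
exact: quarter_bound hPh h1.
Qed.

Lemma susceptibility_or_long b0 b1 : 0 < b0 -> b0 < b1 ->
  (exists X, forall A, uniq A -> Ex (edges A (halfw b0)) (fun w => cl w A 0) <= X) \/
  (exists2 theta : R, 0 < theta & forall n, exists A, uniq A /\ theta <=
   Ex (edges A (halfw b1)) (fun w => ind R (exists2 y, (n < linf y)%N & conn w 0 y))).
Proof.
move=> b00 b01.
have [[S [uS S0 hS]]|hn] := pselect (exists S, [/\ uniq S, 0 \in S &
    forall A, uniq A -> Phi b0 S A <= 2^-1]).
  by left; apply: finite_susceptibility hS => //; exact: ltW.
right; exists (1 - (1 + (b1 - b0) / (8 * b0))^-1).
  have q0 : 0 < (b1 - b0) / (8 * b0) by rewrite divr_gt0 ?subr_gt0// mulr_gt0.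
  by rewrite subr_gt0 invf_lt1; lra.
apply: long_connections => // S uS S0.
apply: contrapT => h; apply: hn; exists S; split=> // A uA.
by rewrite leNgt; apply/negP => /ltW hlt; apply: h; exists A.
Qed.

End HalfKernel.

(** * Infinite volume *)

Lemma Ex_zero (R : realType) (E : eqType) (l : seq (E * R)) f :
  (forall p, p \in l -> p.2 = 0) -> Ex l f = f set0.
Proof.
elim: l f => [|[e a] l IH] f //= h.
have -> : a = 0 by exact: (h (e, a) (mem_head _ _)).
rewrite oppr0 expR0 subrr mul0r add0r mul1r; apply: IH => p pl.
by apply: h; rewrite inE pl orbT.
Qed.

(** * Finite-dimensional law of the model *)

Section Law.
Variables (R : realType) (d : nat) (J : Zd d -> Zd d -> R) (beta : R).
Variables (dT : measure_display) (T : measurableType dT) (P : probability T R).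
Variable w : T -> Zd d -> Zd d -> bool.
Hypothesis Hw : lrp_model J beta P w.
Local Notation V := (Zd d).

Definition om (t : T) : set (V * V) := [set e | w t e.1 e.2].

Definition distinct_edges (l : seq (V * V)) :=
  [/\ uniq l, {in l, forall e, e.1 != e.2} &
      {in l &, forall e f, e != f -> ~~ same_edge e f}].

Lemma distinct_edges_perm l1 l2 : perm_eq l1 l2 -> distinct_edges l1 -> distinct_edges l2.
Proof.
move=> p12 [u h1 h2]; split; first by rewrite -(perm_uniq p12).
  by move=> e; rewrite -(perm_mem p12); exact: h1.
by move=> e f; rewrite -!(perm_mem p12); exact: h2.
Qed.

Lemma distinct_edges_sub l1 l2 : uniq l1 -> {subset l1 <= l2} ->
  distinct_edges l2 -> distinct_edges l1.
Proof.
move=> u1 s12 [u h1 h2]; split=> //; first by move=> e /s12; exact: h1.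
by move=> e f /s12 ? /s12 ?; exact: h2.
Qed.

Definition popen (e : V * V) : R := 1 - expR (- (beta * J e.1 e.2)).

Lemma measurable_open (u : seq (V * V)) : measurable [set t | forall e, e \in u -> om t e].
Proof.
have [_ _ me _ _] := Hw.
elim: u => [|e u IH].
  by rewrite (_ : [set _ | _] = setT)//; apply/seteqP; split=> // t _ e.
rewrite (_ : [set _ | _] = edge_event w e.1 e.2 `&` [set t | forall e, e \in u -> om t e]).
  by apply: measurableI.
apply/seteqP; split=> t.
  move=> h; split; first by apply: (h e); rewrite mem_head.
  by move=> e' eu; apply: h; rewrite inE eu orbT.
by move=> [h1 h2] e'; rewrite inE => /orP[/eqP ->|/h2].
Qed.

Lemma prob_open (u : seq (V * V)) : distinct_edges u ->
  P [set t | forall e, e \in u -> om t e] = (\prod_(e <- u) popen e)%:E.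
Proof.
move=> [uu h1 h2]; have [_ _ me pe prod] := Hw.
have pw : pairwise (fun e f => ~~ same_edge e f) u.
  move: uu; rewrite uniq_pairwise.
  by apply: (sub_in_pairwise (P := mem u)); [exact: h2|apply/allP].
have ad : all (fun e => e.1 != e.2) u by apply/allP.
have := prod u ad pw.
rewrite (_ : \bigcap_(i in _) _ = [set t | forall e, e \in u -> om t e]); last first.
  apply/seteqP; split=> t.
    move=> h e eu; have := h (index e u); rewrite /= index_mem => /(_ eu).
    by rewrite nth_index.
  by move=> h i /= iu; apply: h; exact: mem_nth.
move=> ->; move: h1 => {h2 uu pw ad}; elim: u => [|e u IH] h1; first by rewrite !big_nil.
rewrite !big_cons pe; last by apply: h1; rewrite mem_head.
by rewrite IH ?EFinM// => f fu; apply: h1; rewrite inE fu orbT.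
Qed.

Lemma law_measurable (s : seq (V * V)) (ev : set (V * V) -> Prop) :
  measurable [set t | ev (om t `&` [set` s])].
Proof.
have [_ _ me _ _] := Hw.
elim: s ev => [|e s IH] ev.
  have [h|h] := pselect (ev set0).
    rewrite (_ : [set _ | _] = setT)//; apply/seteqP; split=> // t _ /=.
    by rewrite (_ : _ `&` _ = set0)//; apply/seteqP; split=> // e [].
  rewrite (_ : [set _ | _] = set0)//; apply/seteqP; split=> // t /=.
  by rewrite (_ : _ `&` _ = set0)//; apply/seteqP; split=> // e [].
have hIn t : om t e -> om t `&` [set` e :: s] = e |` (om t `&` [set` s]).
  move=> te; apply/seteqP; split=> f /=.
    by move=> [tf]; rewrite inE => /orP[/eqP ->|fs]; [left|right].
  by move=> [->|[tf fs]]; split=> //=; rewrite inE ?eqxx// (fs : f \in s) orbT.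
have hOut t : ~ om t e -> om t `&` [set` e :: s] = om t `&` [set` s].
  move=> te; apply/seteqP; split=> f /=.
    by move=> [tf]; rewrite inE => /orP[/eqP fe|fs]; [case: te; rewrite -fe|].
  by move=> [tf fs]; split=> //=; rewrite inE (fs : f \in s) orbT.
rewrite (_ : [set _ | _] =
  (edge_event w e.1 e.2 `&` [set t | ev (e |` (om t `&` [set` s]))]) `|`
  ([set t | ev (om t `&` [set` s])] `\` edge_event w e.1 e.2)).
  apply: measurableU; first by apply: measurableI => //; exact: (IH (fun v => ev (e |` v))).
  by apply: measurableD.
apply/seteqP; split=> t /=.
  have [te|te] := pselect (om t e); first by rewrite hIn//; left.
  by rewrite hOut//; right.
by move=> [[te]|[h te]]; [rewrite hIn|rewrite hOut].
Qed.

(** The model prescribes only the probability that given edges are all open. Closed edges are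
    reached by subtraction, one at a time, so the list [u] of edges required open has to be carried
    through the induction. *)
Lemma law (s u : seq (V * V)) (ev : set (V * V) -> Prop) :
  distinct_edges (u ++ s) ->
  P [set t | (forall e, e \in u -> om t e) /\ ev (om t `&` [set` s])] =
  (\prod_(e <- u) popen e * Ex [seq (e, beta * J e.1 e.2) | e <- s] (fun v => ind R (ev v)))%:E.
Proof.
have [_ _ me _ _] := Hw.
elim: s u ev => [|e s IH] u ev.
  rewrite cats0 /= => gu.
  have E0 t : om t `&` [set` [::]] = set0 by apply/seteqP; split=> // f [].
  have [h|h] := pselect (ev set0).
    rewrite (indT _ h) mulr1 -prob_open//; congr (P _).
    by apply/seteqP; split=> t /= => [[]//|h']; rewrite E0.
  rewrite (indF _ h) mulr0 (_ : [set _ | _] = set0) ?measure0//.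
  by apply/seteqP; split=> // t /= [_]; rewrite E0.
move=> gus.
have p1 : perm_eq (u ++ e :: s) ((e :: u) ++ s) by rewrite -(cat1s e s) perm_catCA.
have g1 := distinct_edges_perm p1 gus.
have g2 : distinct_edges (u ++ s).
  apply: distinct_edges_sub gus => [|f].
    by have [/= /andP[]] := g1.
  by rewrite !mem_cat inE => /orP[->//|->]; rewrite !orbT.
pose B ev' := [set t | (forall f, f \in u -> om t f) /\ ev' (om t `&` [set` s])].
pose O := edge_event w e.1 e.2.
have mO : measurable O by exact: me.
have mB ev' : measurable (B ev').
  rewrite (_ : B ev' = [set t | forall f, f \in u -> om t f] `&`
     [set t | ev' (om t `&` [set` s])]); last by apply/seteqP; split=> t.
  by apply: measurableI; [exact: measurable_open|exact: law_measurable].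
have hIn t : om t e -> om t `&` [set` e :: s] = e |` (om t `&` [set` s]).
  move=> te; apply/seteqP; split=> f /=.
    by move=> [tf]; rewrite inE => /orP[/eqP ->|fs]; [left|right].
  by move=> [->|[tf fs]]; split=> //=; rewrite inE ?eqxx// (fs : f \in s) orbT.
have hOut t : ~ om t e -> om t `&` [set` e :: s] = om t `&` [set` s].
  move=> te; apply/seteqP; split=> f /=.
    by move=> [tf]; rewrite inE => /orP[/eqP fe|fs]; [case: te; rewrite -fe|].
  by move=> [tf fs]; split=> //=; rewrite inE (fs : f \in s) orbT.
have hBO ev' : P (B ev' `&` O) = (popen e * \prod_(f <- u) popen f *
    Ex [seq (e, beta * J e.1 e.2) | e <- s] (fun v => ind R (ev' v)))%:E.
  have := IH (e :: u) ev' g1; rewrite big_cons => <-; congr (P _).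
  apply/seteqP; split=> t /=.
    move=> [[h1 h2] h3]; split=> // f; rewrite inE => /orP[/eqP ->//|]; exact: h1.
  move=> [h1 h2]; split; last by apply: (h1 e); rewrite mem_head.
  by split=> // f fu; apply: h1; rewrite inE fu orbT.
have -> : [set t | (forall f, f \in u -> om t f) /\ ev (om t `&` [set` e :: s])] =
    (B (fun v => ev (e |` v)) `&` O) `|` (B ev `\` O).
  apply/seteqP; split=> t /=.
    move=> [h1]; have [te|te] := pselect (om t e); first by rewrite hIn//; left.
    by rewrite hOut//; right.
  by move=> [[[h1 h2] te]|[[h1 h2] te]]; split=> //; [rewrite hIn|rewrite hOut].
rewrite measureU; first last.
- by apply/seteqP; split=> // t [[_ h1] [_ h2]].
- exact: measurableD.
- exact: measurableI.
rewrite measureD//; last by rewrite ltey_eq fin_num_measure.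
have e1 := hBO (fun v => ev (e |` v)); have e2 := hBO ev.
have e3 : P (B ev) = _ := IH u ev g2.
apply: etrans (congr2 adde e1 (congr2 (fun a b : \bar R => (a - b)%E) e3 e2)) _.
by rewrite /= /popen; apply: (congr1 EFin); ring.
Qed.

Definition symmetric_event (ev : set (V * V) -> Prop) :=
  forall v v', (forall x y, adj v x y <-> adj v' x y) -> ev v -> ev v'.

Hypothesis J0 : kernel_nonneg J.
Hypothesis Jsym : kernel_symmetric J.

Definition up_edges (A : seq V) := [seq e <- pairs A | (choice.pickle e.1 < choice.pickle e.2)%N].

Lemma up_edges_distinct A : uniq A -> distinct_edges (up_edges A).
Proof.
move=> uA; split.
- by rewrite filter_uniq// pairs_uniq.
- by move=> e; rewrite mem_filter => /andP[h _]; apply: contraTneq h => ->; rewrite ltnn.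
move=> e f; rewrite !mem_filter => /andP[he _] /andP[hf _] ef.
rewrite /same_edge negb_or ef /=; apply: contraTneq he => ->.
by rewrite -leqNgt ltnW.
Qed.

(** The pickling order selects one orientation of each pair. The two half clocks superpose into one
    of full intensity, and loops have intensity zero. *)
Lemma Ex_edges_half A (ev : set (V * V) -> Prop) : uniq A -> 0 <= beta -> symmetric_event ev ->
  Ex (edges A (halfw J beta)) (fun v => ind R (ev v)) =
  Ex [seq (e, beta * J e.1 e.2) | e <- up_edges A] (fun v => ind R (ev v)).
Proof.
move=> uA b0 sev.
pose sw (e : V * V) := (e.2, e.1).
pose u := up_edges A.
pose dg := [seq e <- pairs A | e.1 == e.2].
have swK : involutive sw by case.
have pm : perm_eq (pairs A) (u ++ [seq sw e | e <- u] ++ dg).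
  apply: uniq_perm; first exact: pairs_uniq.
    rewrite !cat_uniq filter_uniq ?pairs_uniq// (map_inj_uniq (inv_inj swK)).
    rewrite filter_uniq ?pairs_uniq//= filter_uniq ?pairs_uniq// andbT.
    rewrite has_cat negb_or -andbA; apply/and3P; split.
    - apply/hasPn => e /mapP[f + ->]; rewrite mem_filter => /andP[h _].
      apply/negP => /=; rewrite mem_filter /= => /andP[h2 _].
      by have := ltn_trans h h2; rewrite ltnn.
    - apply/hasPn => e; rewrite mem_filter => /andP[/eqP h _].
      by apply/negP => /=; rewrite mem_filter h ltnn.
    - apply/hasPn => e; rewrite mem_filter => /andP[/eqP h _].
      apply/negP => /= /mapP[f]; rewrite mem_filter => /andP[hf _] ee.
      by move: h; rewrite ee /= => h; rewrite h ltnn in hf.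
  move=> e; rewrite !mem_cat !mem_filter.
  have -> : (e \in [seq sw e0 | e0 <- u]) = (sw e \in u).
    by rewrite -{1}(swK e) (mem_map (inv_inj swK)).
  rewrite mem_filter !mem_pairs /=.
  rewrite (andbC (e.2 \in A)).
  case: (boolP ((e.1 \in A) && (e.2 \in A))) => h; last by rewrite !andbF.
  rewrite !andbT.
  case: ltngtP => //= hp; apply/esym/eqP.
  exact: (pcan_inj choice.pickleK).
rewrite (Ex_perm _ (perm_map (fun e => (e, halfw J beta e.1 e.2)) pm)) !map_cat.
rewrite Ex_cat.
under Ex_ext do rewrite Ex_cat.
have hz (p : (V * V) * R) : p \in [seq (e, halfw J beta e.1 e.2) | e <- dg] -> p.2 = 0.
  by move=> /mapP[e]; rewrite mem_filter => /andP[h _] -> /=; rewrite /halfw h.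
under Ex_ext do under Ex_ext do rewrite (Ex_zero _ hz) setU0.
pose W (e : V * V) := halfw J beta e.1 e.2.
have -> : [seq (e, halfw J beta e.1 e.2) | e <- [seq sw e | e <- u]] =
   [seq (sw p.1, p.2) | p <- [seq (e, W e) | e <- u]].
  by rewrite -!map_comp; apply: eq_map => e /=; rewrite halfw_sym.
under Ex_ext do rewrite Ex_map.
have -> : [seq (e, beta * J e.1 e.2) | e <- up_edges A] = [seq (e, W e + W e) | e <- u].
  apply/eq_in_map => e; rewrite mem_filter => /andP[h _].
  rewrite /W /halfw; case: eqP => [ee|_]; first by rewrite ee ltnn in h.
  by congr pair; field.
rewrite Ex_superpose Ex_cat; apply: Ex_ext => v; apply: Ex_ext => v'.
have hadj x y : adj (v `|` (fun p => sw p) @` v') x y <-> adj (v `|` v') x y.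
  rewrite /adj; split.
    move=> [[h|[[a c] h [<- <-]]]|[h|[[a c] h [<- <-]]]].
    - by left; left.
    - by right; right.
    - by right; left.
    - by left; right.
  by move=> [[h|h]|[h|h]]; [left; left|right; right; exists (x, y)|right; left|left; right; exists (y, x)].
by apply: ind_eq; split; apply: sev => x y; have [] := hadj x y.
Qed.

Lemma law_half A (ev : set (V * V) -> Prop) : uniq A -> 0 <= beta -> symmetric_event ev ->
  P [set t | ev (om t `&` [set` up_edges A])] =
  (Ex (edges A (halfw J beta)) (fun v => ind R (ev v)))%:E.
Proof.
move=> uA b0 sev; rewrite Ex_edges_half//.
have := @law (up_edges A) [::] ev (up_edges_distinct uA).
rewrite big_nil mul1r => <-; congr (P _).
by apply/seteqP; split=> t /=; [split|move=> []].
Qed.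

End Law.

Import numFieldNormedType.Exports.

(** * Exhaustion by boxes and infinite clusters *)

Section InfiniteVolume.
Variables (R : realType) (d : nat) (J : Zd d -> Zd d -> R) (beta : R).
Variables (dT : measure_display) (T : measurableType dT) (P : probability T R).
Variable w : T -> Zd d -> Zd d -> bool.
Hypothesis Hw : lrp_model J beta P w.
Hypothesis J0 : kernel_nonneg J.
Hypothesis Jsym : kernel_symmetric J.
Hypothesis beta0 : 0 <= beta.
Local Notation V := (Zd d).
Local Notation cl := (cl R).
Local Notation om := (om w).
Implicit Types (x y : V) (t : T).

Lemma om_adj t x y : adj (om t) x y <-> w t x y.
Proof. by have [ws _ _ _ _] := Hw; split=> [[//|/=]|]; [rewrite ws|left]. Qed.

Lemma connectedE t x y : Defs.connected w t x y <-> conn (om t) x y.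
Proof.
split=> [[s [ps <-]]|].
  elim: s x ps => [|z s IH] x /=; first by move=> _; exact: conn0.
  by move=> /andP[xz /IH]; apply: conn_trans; apply: conn1; left.
elim=> [|z u _ [s [ps ls]] /om_adj zu]; first by exists [::].
by exists (rcons s u); rewrite rcons_path last_rcons ps ls.
Qed.

Definition fom n t : set (V * V) := om t `&` [set` up_edges (bx d n)].

Lemma fom_sub n t : fom n t `<=` om t. Proof. by move=> e []. Qed.

Lemma fom_mono m n t : (m <= n)%N -> fom m t `<=` fom n t.
Proof.
move=> mn e [te]; rewrite /= mem_filter mem_pairs !mem_bx => /and3P[h h1 h2].
split=> //=; rewrite mem_filter mem_pairs !mem_bx h /=.
by rewrite (leq_trans h1)// (leq_trans h2).
Qed.

Lemma conn_fom t x y : conn (om t) x y <-> exists n, conn (fom n t) x y.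
Proof.
split=> [|[n]]; last exact: conn_sub (@fom_sub n t).
have [ws wi _ _ _] := Hw.
elim=> [|z u _ [n hn] /om_adj zu]; first by exists 0%N; exact: conn0.
pose m := maxn n (maxn (linf z) (linf u)).
have nm : (n <= m)%N by exact: leq_maxl.
exists m; apply: connS (conn_sub (fom_mono nm) hn) _.
have zB : z \in bx d m by rewrite mem_bx /m !leq_max leqnn orbT.
have uB : u \in bx d m by rewrite mem_bx /m !leq_max leqnn !orbT.
case: (ltngtP (choice.pickle z) (choice.pickle u)) => h.
- by left; split=> //=; rewrite mem_filter mem_pairs /= h zB uB.
- by right; split; rewrite /= ?mem_filter ?mem_pairs/= ?h ?zB ?uB// /om /= ws.
- have e : z = u by apply: (pcan_inj choice.pickleK).
  by move: zu; rewrite e wi.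
Qed.

Lemma symmetric_conn x y : symmetric_event (fun v => conn v x y).
Proof.
move=> v v' h; elim=> [|z u _ h1 /h]; [exact: conn0|exact: connS].
Qed.

Lemma conn_eventE x y : conn_event w x y = \bigcup_n [set t | conn (fom n t) x y].
Proof.
apply/seteqP; split=> t.
  by move=> /connectedE /conn_fom [n hn]; exists n.
by move=> [n _ hn]; apply/connectedE/conn_fom; exists n.
Qed.

Lemma measurable_fom_conn n x y : measurable [set t | conn (fom n t) x y].
Proof. exact: (law_measurable Hw _ (fun v => conn v x y)). Qed.

Lemma measurable_conn x y : measurable (conn_event w x y).
Proof.
by rewrite conn_eventE; apply: bigcup_measurable => n _; exact: measurable_fom_conn.
Qed.

Lemma cvg_conn x y :
  (fun n => Ex (edges (bx d n) (halfw J beta)) (fun v => ind R (conn v x y)))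
  @ \oo --> fine (P (conn_event w x y)).
Proof.
have := @nondecreasing_cvg_mu _ _ _ P (fun n => [set t | conn (fom n t) x y])
  (fun n => measurable_fom_conn n x y).
rewrite -conn_eventE => /(_ (measurable_conn x y)) h.
have {}h := h _.
have : P \o (fun n => [set t | conn (fom n t) x y]) @ \oo --> P (conn_event w x y).
  apply: h; apply/nondecreasing_seqP => n; apply/subsetPset => t /=.
  by apply: conn_sub; exact: fom_mono.
rewrite -[P (conn_event w x y)]fineK ?fin_num_measure//; last exact: measurable_conn.
move=> /fine_cvg; apply: cvg_trans; apply: near_eq_cvg; apply: nearW => n /=.
by rewrite (law_half Hw Jsym (bx_uniq d n) beta0 (@symmetric_conn x y)).
Qed.

Lemma sum_conn_le (B : seq V) x (C : R) :
  (forall n, Ex (edges (bx d n) (halfw J beta)) (fun v => cl v B x) <= C) ->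
  \sum_(y <- B) fine (P (conn_event w x y)) <= C.
Proof.
move=> hC.
have hc : (fun n => \sum_(y <- B) Ex (edges (bx d n) (halfw J beta)) (fun v => ind R (conn v x y)))
    @ \oo --> \sum_(y <- B) fine (P (conn_event w x y)).
  elim: B {hC} => [|y B IH].
    under eq_fun do rewrite big_nil.
    by rewrite big_nil; exact: cvg_cst.
  under eq_fun do rewrite big_cons.
  by rewrite big_cons; apply: cvgD; [exact: cvg_conn|exact: IH].
apply: (cvgr_to_le hc); apply: nearW => n.
by rewrite -Ex_sum; exact: hC.
Qed.

Definition far n x : set T := [set t | exists2 y, (n < linf y)%N & Defs.connected w t x y].

Definition inf_cluster x : set T := [set t | ~ finite_set [set y | Defs.connected w t x y]].

Lemma inf_clusterE x : inf_cluster x = \bigcap_n far n x.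
Proof.
apply/seteqP; split=> t.
  move=> hinf n _; apply: contrapT => hn; apply: hinf.
  apply: (@sub_finite_set _ _ [set` bx d n]); last exact: finite_seq.
  move=> y xy /=; rewrite mem_bx leqNgt; apply/negP => ny.
  by apply: hn; exists y.
move=> h /finite_seqP[s hs].
have [y ny xy] := h (\max_(z <- s) linf z)%N I.
have ys : y \in s by have : [set` s] y by rewrite -hs.
by move: ny; rewrite ltnNge leq_bigmax_seq.
Qed.

Lemma farE n x : far n x = \bigcup_j
  (if choice.pickle_inv j is Some y then
     if (n < linf (y : V))%N then conn_event w x y else set0 else set0).
Proof.
apply/seteqP; split=> t.
  by move=> [y ny xy]; exists (choice.pickle y) => //; rewrite choice.pickleK_inv ny.
by move=> [j _]; case: choice.pickle_inv => // y; case: ifP => // ny xy; exists y.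
Qed.

Lemma measurable_far n x : measurable (far n x).
Proof.
rewrite farE; apply: bigcup_measurable => j _; case: choice.pickle_inv => // y.
by case: ifP => // _; exact: measurable_conn.
Qed.

Lemma measurable_inf_cluster x : measurable (inf_cluster x).
Proof. by rewrite inf_clusterE; apply: bigcap_measurable => // n _; exact: measurable_far. Qed.

Lemma infinite_cluster_eventE : infinite_cluster_event w = \bigcup_j
  (if choice.pickle_inv j is Some x then inf_cluster x else set0).
Proof.
apply/seteqP; split=> t.
  by move=> [x hx]; exists (choice.pickle x) => //; rewrite choice.pickleK_inv.
by move=> [j _]; case: choice.pickle_inv => // x hx; exists x.
Qed.

Lemma measurable_infinite_cluster : measurable (infinite_cluster_event w).
Proof.
rewrite infinite_cluster_eventE; apply: bigcup_measurable => j _.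
by case: choice.pickle_inv => // x; exact: measurable_inf_cluster.
Qed.

(** Borel--Cantelli over an enumeration of the lattice: for fixed [x] the connection probabilities
    sum to at most [X], so almost surely only finitely many points are joined to [x]. *)
Lemma no_infinite_cluster (X : R) :
  (forall x (B A : seq V), uniq A -> uniq B -> Ex (edges A (halfw J beta)) (fun v => cl v B x) <= X) ->
  P (infinite_cluster_event w) = 0.
Proof.
move=> hX; apply: measure_negligible; first exact: measurable_infinite_cluster.
rewrite infinite_cluster_eventE; apply: negligible_bigcup => j.
case: choice.pickle_inv => [x|]; last exact: negligible_set0.
pose F j : set T := if choice.pickle_inv j is Some y then conn_event w x y else set0.
have mF k : measurable (F k).
  by rewrite /F; case: choice.pickle_inv => // y; exact: measurable_conn.
exists (lim_sup_set F); split.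
- by apply: bigcap_measurable => // n _; apply: bigcup_measurable => k _; exact: mF.
- apply: lim_sup_set_cvg0 => //.
  apply: (@le_lt_trans _ _ X%:E); last exact: ltry.
  apply: lime_le; first by apply: is_cvg_nneseries => *; exact: measure_ge0.
  apply: nearW => n.
  pose B := pmap (@choice.pickle_inv V) (iota 0 n).
  have uB : uniq B.
    by apply: (pmap_uniq (@choice.pickle_invK V)); exact: iota_uniq.
  have := @sum_conn_le B x X (fun m => hX x B _ (bx_uniq d m) uB).
  rewrite -lee_fin; apply: le_trans.
  rewrite -sumEFin /B big_mkord -(big_mkord xpredT (fun i => P (F i))) /index_iota subn0.
  elim: (iota 0 n) => [|k s IH] /=; first by rewrite !big_nil.
  rewrite big_cons {1}/F; case: choice.pickle_inv => [y|] /=.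
    by rewrite big_cons fineK ?fin_num_measure//; [exact: leeD2l|exact: measurable_conn].
  by rewrite measure0 add0e.
move=> t hinf n _ /=; apply: contrapT => hn; apply: hinf.
apply: (@sub_finite_set _ _ [set` pmap (@choice.pickle_inv V) (iota 0 n)]); last exact: finite_seq.
move=> y xy /=; rewrite mem_pmap; apply/mapP; exists (choice.pickle y).
  rewrite mem_iota add0n /= ltnNge; apply/negP => ny.
  by apply: hn; exists (choice.pickle y) => //; rewrite /F choice.pickleK_inv.
by rewrite choice.pickleK_inv.
Qed.

(** The events [far n 0] decrease to the event that the origin has an infinite cluster, so the bound
    [theta] passes to the limit. *)
Lemma infinite_cluster_pos (theta : R) : 0 < theta ->
  (forall n, exists A, uniq A /\ theta <=
   Ex (edges A (halfw J beta)) (fun v => ind R (exists2 y, (n < linf y)%N & conn v 0 y))) ->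
  (0 < P (infinite_cluster_event w))%E.
Proof.
move=> th0 hth.
have hfar n : (theta%:E <= P (far n 0%R))%E.
  have [A [uA hA]] := hth n.
  pose ev v := exists2 y : V, (n < linf y)%N & conn v 0 y.
  have sev : symmetric_event ev.
    by move=> v v' h [y ny hy]; exists y => //; exact: (symmetric_conn h).
  apply: (@le_trans _ _ (P [set t | ev (om t `&` [set` up_edges A])])).
    by rewrite (law_half Hw Jsym uA beta0 sev) lee_fin.
  apply: le_measure; rewrite ?inE; [exact: (law_measurable Hw)|exact: measurable_far|].
  move=> t [y ny hy]; exists y => //; apply/connectedE.
  by apply: conn_sub hy => e [].
apply: (@lt_le_trans _ _ theta%:E); first by rewrite lte_fin.
apply: (@le_trans _ _ (P (inf_cluster 0))); last first.
  apply: le_measure; rewrite ?inE; [exact: measurable_inf_cluster|exact: measurable_infinite_cluster|].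
  by move=> t ht; exists 0.
rewrite inf_clusterE.
have hc : P \o (fun n => far n 0) @ \oo --> P (\bigcap_n far n 0).
  apply: nonincreasing_cvg_mu.
  - by rewrite ltey_eq fin_num_measure//; exact: measurable_far.
  - by move=> i; exact: measurable_far.
  - by rewrite -inf_clusterE; exact: measurable_inf_cluster.
  - apply/nonincreasing_seqP => n; apply/subsetPset => t [y ny hy]; exists y => //.
    exact: ltnW.
rewrite -(cvg_lim _ hc)//; apply: lime_ge; first by apply/cvg_ex; eexists; exact: hc.
by apply: nearW => n; exact: hfar.
Qed.

End InfiniteVolume.

(** * Existence of the model *)

Section Bernoulli.
Variables (R : realType) (p : nat -> R).
Hypothesis p01 : forall n, 0 <= p n <= 1.

(* The interval [a, a + l[ is cut at [a + p k * l]; the bit says on which side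
   [t] falls, and the next bits are read in the piece containing [t]. *)
Fixpoint bit_from (k : nat) (a l : R) (n : nat) (t : R) : bool :=
  if n is n'.+1 then
    if t < a + p k * l then bit_from k.+1 a (p k * l) n' t
    else bit_from k.+1 (a + p k * l) ((1 - p k) * l) n' t
  else t < a + p k * l.

Definition bits_on (k : nat) (a l : R) (n : nat) (Q : pred nat) : set R :=
  [set t | a <= t < a + l /\ forall i, (i < n)%N -> Q (k + i)%N -> bit_from k a l i t].

Lemma bits_on0 k a l Q : bits_on k a l 0 Q = `[a, a + l[%classic.
Proof.
by apply/seteqP; split=> t; rewrite /bits_on /= in_itv /=; [case|split].
Qed.

Lemma bits_onS k a l n Q : 0 <= l ->
  bits_on k a l n.+1 Q = bits_on k.+1 a (p k * l) n Q `|`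
    (if Q k then set0 else bits_on k.+1 (a + p k * l) ((1 - p k) * l) n Q).
Proof.
move=> l0; have /andP[q0 q1] := p01 k.
have pl0 : 0 <= p k * l by rewrite mulr_ge0.
have pl1 : p k * l <= l by rewrite ler_piMl.
have e : a + p k * l + (1 - p k) * l = a + l by ring.
apply/seteqP; split=> t.
  move=> [/andP[at_ tl] hb]; have [tp|tp] := ltP t (a + p k * l).
    left; split; first by rewrite at_ tp.
    move=> i iN Qi; have := hb i.+1; rewrite ltnS addnS -addSn /= tp; exact.
  right; case: ifPn => Qk.
    by have := hb 0%N (ltn0Sn n); rewrite addn0 => /(_ Qk) /=; rewrite ltNge tp.
  split; first by rewrite tp e tl.
  move=> i iN Qi; have := hb i.+1; rewrite ltnS addnS -addSn /= ltNge tp /=; exact.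
move=> [[/andP[at_ tp] hb]|].
  split; first by rewrite at_ /=; lra.
  move=> [|i]; first by move=> _ _ /=.
  by rewrite ltnS addnS -addSn /= tp; exact: hb.
case: ifPn => // Qk [/andP[tp tl] hb]; rewrite e in tl.
split; first by rewrite tl andbT; lra.
move=> [|i]; first by rewrite addn0 (negbTE Qk).
by rewrite ltnS addnS -addSn /= ltNge tp /=; exact: hb.
Qed.

Lemma measurable_bits_on k a l n Q : 0 <= l ->
  measurable (bits_on k a l n Q : set (measurableTypeR R)).
Proof.
elim: n k a l => [|n IH] k a l l0; first by rewrite bits_on0; exact: measurable_itv.
have /andP[q0 q1] := p01 k.
rewrite bits_onS//; apply: measurableU; first by apply: IH; rewrite mulr_ge0.
by case: ifP => // _; apply: IH; rewrite mulr_ge0// subr_ge0.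
Qed.

Lemma bits_on_itv k a l n Q : bits_on k a l n Q `<=` `[a, a + l[%classic.
Proof. by move=> t [h _]; rewrite /= in_itv. Qed.

(** A prescribed bit keeps the fraction [p k] of the interval; a free bit keeps both pieces, whose
    fractions add up to one. *)
Lemma bits_on_measure k a l n Q : 0 <= l ->
  lebesgue_measure (bits_on k a l n Q : set (measurableTypeR R)) =
  (l * \prod_(k <= i < k + n | Q i) p i)%:E.
Proof.
elim: n k a l => [|n IH] k a l l0.
  rewrite bits_on0 addn0 big_geq// mulr1 lebesgue_measure_itv /= lte_fin.
  case: ifPn => [_|]; first by rewrite -EFinB; congr (_%:E); ring.
  by rewrite -leNgt gerDl => h; congr (_%:E); apply/eqP; rewrite eq_le l0 h.
have /andP[q0 q1] := p01 k.
have h1 : 0 <= p k * l by rewrite mulr_ge0.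
have h2 : 0 <= (1 - p k) * l by rewrite mulr_ge0// subr_ge0.
rewrite bits_onS// measureU; first last.
- case: ifP => _; first by rewrite setI0.
  apply/seteqP; split=> // t [/bits_on_itv + /bits_on_itv].
  by rewrite /= !in_itv /= => /andP[_ tlt] /andP[/(lt_le_trans tlt)]; rewrite ltxx.
- by case: ifP => // _; exact: measurable_bits_on.
- exact: measurable_bits_on.
rewrite [X in (X + _)%E](IH k.+1 a (p k * l) h1) addSnnS.
rewrite [in RHS]big_ltn_cond; last by rewrite addnS ltnS leq_addr.
case: ifP => Qk; first by rewrite measure0 adde0; congr (_%:E); ring.
rewrite [X in (_ + X)%E](IH k.+1 (a + p k * l) ((1 - p k) * l) h2) addSnnS -EFinD.
by congr (_%:E); ring.
Qed.

Let P01 : probability (measurableTypeR R) R := uniform_prob (@ltr01 R).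

Definition bit (n : nat) (t : R) : bool := (0 <= t < 1) && bit_from 0 0 1 n t.

Lemma prob_bits_on n Q :
  P01 (bits_on 0 0 1 n Q) = (\prod_(0 <= i < n | Q i) p i)%:E.
Proof.
have -> : P01 (bits_on 0 0 1 n Q) =
  (\int[lebesgue_measure]_(x in bits_on 0 0 1 n Q) (uniform_pdf 0 1 x)%:E)%E by [].
rewrite (eq_integral (fun=> 1%:E)); last first.
  move=> t; rewrite inE => /bits_on_itv; rewrite /= in_itv /= add0r => /andP[t0 t1].
  by rewrite /uniform_pdf t0 (ltW t1) subr0 invr1.
rewrite integral_cst; last exact: measurable_bits_on.
rewrite mul1e; apply: etrans (bits_on_measure 0 0 n Q ler01) _.
by rewrite mul1r.
Qed.

Lemma measurable_bit n : measurable ([set t | bit n t] : set (measurableTypeR R)).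
Proof.
rewrite (_ : [set _ | _] = bits_on 0 0 1 n.+1 (pred1 n)); first exact: measurable_bits_on.
apply/seteqP; split=> t; rewrite /bits_on /= add0r.
  by move=> /andP[h1 h2]; split=> // i _; rewrite add0n => /eqP ->.
by move=> [h1 h2]; rewrite /bit h1; exact: h2.
Qed.

Lemma prob_bits (s : seq nat) : uniq s ->
  P01 [set t | forall i, i \in s -> bit i t] = (\prod_(i <- s) p i)%:E.
Proof.
(* For the empty list the event is the whole line; any prescribed bit confines [t] to the unit
   interval. *)
move=> us; case: s us => [|i0 s0 us].
  move=> _; rewrite big_nil (_ : [set _ | _] = setT) ?probability_setT//.
  by apply/seteqP; split.
set s := i0 :: s0 in us *.
pose N := (\max_(i <- s) i).+1.
have sN i : i \in s -> (i < N)%N by move=> is_; rewrite ltnS leq_bigmax_seq.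
rewrite (_ : [set _ | _] = bits_on 0 0 1 N (mem s)).
  rewrite prob_bits_on; congr (_%:E); rewrite -big_filter; apply: perm_big.
  apply: uniq_perm; rewrite ?filter_uniq ?iota_uniq// => i.
  rewrite mem_filter mem_index_iota /=; case: (boolP (i \in s)) => //= is_.
  exact: sN.
apply/seteqP; split=> t; rewrite /bits_on /= add0r.
  move=> h; have /andP[t01 _] := h i0 (mem_head _ _).
  by split=> // i iN si; have /andP[] := h i si.
by move=> [t01 h] i si; rewrite /bit t01 h//; exact: sN.
Qed.

Lemma bernoulli_exists : exists (dT : measure_display) (T : measurableType dT)
    (P : probability T R) (b : nat -> T -> bool),
  (forall n, measurable [set t | b n t]) /\
  forall s : seq nat, uniq s ->
    P [set t | forall i, i \in s -> b i t] = (\prod_(i <- s) p i)%:E.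
Proof.
by exists _, (measurableTypeR R), P01, bit; split; [exact: measurable_bit|exact: prob_bits].
Qed.

End Bernoulli.

(** [percolates] asks for some model with an infinite cluster, so contradicting its negation
    requires a model to exhibit. *)
Lemma lrp_model_exists (R : realType) (d : nat) (J : Zd d -> Zd d -> R) (beta : R) :
  0 <= beta -> kernel_nonneg J -> kernel_symmetric J ->
  exists (dT : measure_display) (T : measurableType dT) (P : probability T R)
    (w : T -> Zd d -> Zd d -> bool), lrp_model J beta P w.
Proof.
move=> b0 J0 Jsym.
pose V := Zd d.
pose id (x y : V) : nat := if (choice.pickle x < choice.pickle y)%N
  then choice.pickle (x, y) else choice.pickle (y, x).
have idC x y : id x y = id y x.
  rewrite /id; case: ltngtP => // h.
  by have -> : x = y by apply: (pcan_inj choice.pickleK).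
pose p n : R := if choice.pickle_inv n is Some (x, y)
  then 1 - expR (- (beta * J (x : V) (y : V))) else 0.
have p01 n : 0 <= p n <= 1.
  rewrite /p; case: choice.pickle_inv => [[x y]|]; last by rewrite lexx ler01.
  have := expRN_itv (mulr_ge0 b0 (J0 x y)); lra.
have pE x y : p (id x y) = 1 - expR (- (beta * J x y)).
  by rewrite /p /id; case: ifP => _; rewrite choice.pickleK_inv// Jsym.
have id_inj x y x' y' : id x y = id x' y' -> same_edge (x, y) (x', y').
  rewrite /id /same_edge; case: ifP => _; case: ifP => _ /(pcan_inj choice.pickleK) [-> ->];
    by rewrite eqxx ?orbT.
have [dT [T [P [b [mb hb]]]]] := bernoulli_exists p01.
pose w t (x y : V) := (x != y) && b (id x y) t.
have me x y : measurable (edge_event w x y).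
  have [->|xy] := eqVneq x y.
    rewrite (_ : edge_event _ _ _ = set0)//; apply/seteqP; split=> // t.
    by rewrite /edge_event /= /w eqxx.
  rewrite (_ : edge_event _ _ _ = [set t | b (id x y) t])//.
  by apply/seteqP; split=> t; rewrite /edge_event /= /w xy.
have pe x y : x != y -> P (edge_event w x y) = (1 - expR (- (beta * J x y)))%:E.
  move=> xy; have := hb [:: id x y] isT; rewrite big_seq1 pE => <-; congr (P _).
  apply/seteqP; split=> t; rewrite /edge_event /= /w xy /=.
    by move=> h i; rewrite inE => /eqP ->.
  by move=> h; apply: h; rewrite mem_head.
exists dT, T, P, w; split=> //.
- by move=> t x y; rewrite /w eq_sym idC.
- by move=> t x; rewrite /w eqxx.
move=> s ad pw.
have us : uniq [seq id e.1 e.2 | e <- s].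
  elim: s ad pw => //= e s IH /andP[_ ad] /andP[es pw]; rewrite IH// andbT.
  apply/mapP => -[f fs] /id_inj; rewrite -!surjective_pairing => h.
  by move/allP: es => /(_ f fs); rewrite h.
have -> : \bigcap_(i in [set i | (i < size s)%N])
     edge_event w (nth (0, 0) s i).1 (nth (0, 0) s i).2 =
   [set t | forall i, i \in [seq id e.1 e.2 | e <- s] -> b i t].
  apply/seteqP; split=> t.
    move=> h i /mapP[e es ->]; have := h (index e s); rewrite /= index_mem => /(_ es).
    by rewrite nth_index// => /andP[].
  move=> h i /= iu; apply/andP; split; first exact: (allP ad) (mem_nth _ iu).
  by apply: h; apply/mapP; exists (nth (0, 0) s i) => //; exact: mem_nth.
rewrite hb// big_map.
move: ad => {pw us}; elim: s => [|e s IH]; first by rewrite !big_nil.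
by move=> /= /andP[e12 /IH h]; rewrite !big_cons EFinM h pe// pE.
Qed.

(** * The critical point *)

Lemma Ex_cat_le (R : realType) (E : eqType) (l1 l2 : seq (E * R)) f C :
  nneg l1 -> nneg l2 -> (forall w, 0 <= f w <= C) ->
  Ex (l1 ++ l2) f <= Ex l1 f + C * \sum_(p <- l2) p.2.
Proof.
move=> n1 n2 hf; rewrite Ex_cat -[leRHS](_ : Ex l1 (fun v => f v + C * \sum_(p <- l2) p.2) = _);
  last by rewrite ExD Ex_cst.
have C0 : 0 <= C by have /andP[] := hf set0; exact: le_trans.
apply: Ex_le => // v.
apply: (@le_trans _ _ (Ex l2 (fun w => f v + C * ind R (exists2 e, True & w e)))).
  apply: Ex_le => // w; have [h|h] := pselect (exists2 e, True & w e).
    rewrite (indT _ h) mulr1; have /andP[_ h1] := hf (v `|` w); have /andP[h2 _] := hf v.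
    exact: ler_wpDl.
  rewrite (indF _ h) mulr0 addr0 (_ : w = set0) ?setU0//.
  by apply/seteqP; split=> // e we; apply: h; exists e.
rewrite ExD Ex_cst ExZ lerD2l ler_wpM2l//.
apply: le_trans (Ex_some (fun=> True) n2) _.
by rewrite le_eqVlt; apply/orP; left; apply/eqP; apply: eq_bigr => p _; rewrite indT// mul1r.
Qed.

Lemma le_of_small_error (R : realType) (x K C b : R) : 0 < b ->
  (forall e, 0 < e < b -> x <= K + e * C) -> x <= K.
Proof.
move=> b0 h; rewrite leNgt; apply/negP => Kx.
pose e := Num.min (b / 2) ((x - K) / (2 * (`|C| + 1))).
have c0 : 0 < 2 * (`|C| + 1) by rewrite mulr_gt0// ltr_wpDl.
have e0 : 0 < e by rewrite lt_min !divr_gt0// subr_gt0.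
have eb : e < b by rewrite gt_min; apply/orP; left; lra.
have := h e; rewrite e0 eb => /(_ isT) h1.
have : e * (2 * (`|C| + 1)) <= x - K.
  by rewrite -ler_pdivlMr// ge_min lexx orbT.
have -> : e * (2 * (`|C| + 1)) = 2 * (e * `|C|) + 2 * e by ring.
move=> e2.
have : e * C <= e * `|C| by rewrite ler_pM2l// ler_norm.
move: (e * C) (e * `|C|) h1 e2 => p q; lra.
Qed.

Section Box.
Variables (R : realType) (d : nat).

Lemma box_bx (r : R) : 0 <= r -> @box R d r = [set` bx d (Num.truncn r)].
Proof.
move=> r0.
have [h1 h2] := andP (truncn_itv r0).
have aux (a : int) : (`|(a%:~R : R)| <= r) = (absz a <= Num.truncn r)%N.
  rewrite -intr_norm -abszE; apply/idP/idP => h; last first.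
    by apply: le_trans h1; rewrite ler_nat.
  by rewrite -ltnS -(ltr_nat R); exact: le_lt_trans h h2.
apply/seteqP; split => x /=; rewrite mem_bx => h.
  by apply/linf_leP => i; rewrite -aux; exact: h.
by move=> i; rewrite aux; exact: (linf_leP _ _ h).
Qed.

Lemma card_box n : #|` fset_set [set` bx d n]| = (n.*2.+1 ^ d)%N.
Proof.
rewrite -size_bx -[in RHS](undup_id (bx_uniq d n)) -card_fseq; congr (#|` _|).
apply/fsetP => x; rewrite in_fset_set; last exact: finite_seq.
by rewrite !inE mem_setE.
Qed.

End Box.

Section CriticalPoint.
Variables (R : realType) (d : nat) (J : Zd d -> Zd d -> R).
Hypothesis J0 : kernel_nonneg J.
Hypothesis Jsym : kernel_symmetric J.
Hypothesis Jinv : kernel_transl_inv J.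
Hypothesis Jint : kernel_integrable J.

Lemma kernel_sum_bounded : exists2 M : R, 0 <= M & forall B, uniq B -> \sum_(y <- B) J 0 y <= M.
Proof.
have h0 := Jint 0.
have e0 : (0 <= \esum_(y in [set: Zd d]) (J 0 y)%:E)%E.
  by apply: esum_ge0 => y _; rewrite lee_fin; exact: J0.
have efin : (\esum_(y in [set: Zd d]) (J 0 y)%:E)%E \is a fin_num by rewrite ge0_fin_numE.
exists (fine (\esum_(y in [set: Zd d]) (J 0 y)%:E)%E); first exact: fine_ge0.
move=> B uB; rewrite -lee_fin fineK//; apply: esum_ge.
exists [set` B]; first by split=> //; exact: finite_seq.
by rewrite -fsbig_seq// sumEFin.
Qed.

Lemma subcritical_not_percolates beta X : 0 <= beta ->
  (forall A, uniq A -> Ex (edges A (halfw J beta)) (fun w => cl R w A 0) <= X) ->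
  ~ percolates J beta.
Proof.
move=> b0 hX [dT [T [P [w [Hw]]]]].
rewrite (no_infinite_cluster Hw Jsym b0 (X := X)) ?ltxx// => x B A uA uB.
apply: (chi_at _ _ hX) => //.
  by move=> u v; exact: halfw_ge0.
by move=> z u v; exact: halfw_transl.
Qed.

(** For the singleton [S = {0}] the functional [Phi] is at most [beta] times the total mass of the
    kernel. This makes [beta_c] positive. *)
Lemma small_not_percolates M beta : 0 <= beta -> beta * M <= 2^-1 ->
  (forall B, uniq B -> \sum_(y <- B) J 0 y <= M) -> ~ percolates J beta.
Proof.
move=> b0 bM hM.
have [|X hX] := finite_susceptibility (S := [:: 0]) J0 Jinv b0 isT (mem_head _ _).
  move=> A uA; rewrite /Phi big_seq1.
  apply: (@le_trans _ _ (\sum_(b <- A | b \notin [:: 0]) beta * J 0 b)).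
    apply: ler_sum => b; rewrite inE => bn0.
    rewrite (halfw_sym Jsym _ b) {2 3}/halfw eq_sym (negbTE bn0) -splitr.
    rewrite ler_piMl// ?mulr_ge0//.
    by apply: Ex_le_cst => [|w]; [apply: edges_nneg => x y; exact: halfw_ge0|exact: ind_le1].
  rewrite -mulr_sumr -big_filter; apply: le_trans bM; apply: ler_wpM2l => //.
  by apply: hM; exact: filter_uniq.
exact: subcritical_not_percolates hX.
Qed.

Lemma finite_susceptibility_below b0 b1 : 0 < b0 -> b0 < b1 -> ~ percolates J b1 ->
  exists X, forall A, uniq A -> Ex (edges A (halfw J b0)) (fun w => cl R w A 0) <= X.
Proof.
move=> b00 b01 np; have [//|[theta th0 hth]] := susceptibility_or_long J0 Jsym Jinv b00 b01.
have b1_ge0 : 0 <= b1 by apply: ltW; exact: lt_trans b01.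
have [dT [T [P [w Hw]]]] := lrp_model_exists b1_ge0 J0 Jsym.
case: np; exists dT, T, P, w; split=> //.
exact: (infinite_cluster_pos Hw Jsym b1_ge0 th0 hth).
Qed.

Lemma not_percolates_below beta : 0 <= beta -> beta < beta_c J -> ~ percolates J beta.
Proof.
move=> b0 bc hp; move: bc; rewrite ltNge => /negP; apply; apply: ge_inf; last by [].
by exists 0 => x [].
Qed.

Lemma bound_at_limit (A : seq (Zd d)) n K b : 0 < b ->
  (forall beta, 0 < beta < b ->
     Ex (edges A (halfw J beta)) (fun w => cl R w (bx d n) 0) <= K / beta) ->
  Ex (edges A (halfw J b)) (fun w => cl R w (bx d n) 0) <= K / b.
Proof.
move=> b0 hb; set f := fun w => _; rewrite ler_pdivlMr//.
pose S := \sum_(x <- A) \sum_(y <- A) halfw J 1 x y.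
set e := Ex _ f.
pose C := (size (bx d n))%:R : R.
(* Lowering the parameter by [t] changes the mean by at most [C * S * t]; clearing the denominator
   [b - t] leaves an error linear in [t]. *)
apply: (@le_of_small_error _ _ K (b * (C * S) + e) b) => // t /andP[t0 tb].
have bt : 0 < b - t by rewrite subr_gt0.
have h : e <= K / (b - t) + C * (t * S).
  have -> : e = Ex (edges A (halfw J (b - t)) ++ edges A (halfw J t)) f.
    rewrite -Ex_edges_add /e; congr (Ex (edges A _) f); apply/funext => x; apply/funext => y.
    by rewrite -halfwD subrK.
  have -> : t * S = \sum_(p <- edges A (halfw J t)) p.2.
    rewrite (sum_edges A (halfw J t) (fun _ a => a)) /S mulr_sumr.
    apply: eq_bigr => x _; rewrite mulr_sumr; apply: eq_bigr => y _.
    by rewrite /halfw; case: eqP => _; rewrite ?mulr0//; ring.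
  apply: le_trans (Ex_cat_le _ _ (C := C) _) _.
  - by apply: edges_nneg => x y; apply: halfw_ge0 => //; exact: ltW.
  - by apply: edges_nneg => x y; apply: halfw_ge0 => //; exact: ltW.
  - by move=> w; rewrite cl_ge0 cl_le_size.
  by rewrite lerD2r; apply: hb; rewrite bt ltrBlDr ltrDl.
have S0 : 0 <= S by apply: sumr_ge0 => x _; apply: sumr_ge0 => y _; exact: halfw_ge0.
have CS : 0 <= C * S by rewrite mulr_ge0.
have : e * (b - t) <= K + (C * S) * t * (b - t).
  have := ler_wpM2r (ltW bt) h; rewrite mulrDl divfK ?gt_eqF//.
  by rewrite mulrCA (mulrC t).
have : 0 <= C * S * t * t by rewrite !mulr_ge0// ltW.
rewrite mulrDr; lra.
Qed.

End CriticalPoint.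

Section PowerKernel.
Variables (R : realType) (d : nat) (al : R).
Hypotheses (d1 : (1 <= d)%N) (al0 : 0 < al) (ald : al < d%:R).

Lemma critical_bound : exists2 A1 : R, 0 <= A1 & forall (J : Zd d -> Zd d -> R) (c : R),
  kernel_nonneg J -> kernel_symmetric J -> kernel_integrable J ->
  kernel_transl_inv J -> 0 < c ->
  (forall x y : Zd d, x != y -> c * ((linf (x - y))%:R `^ (- (d%:R + al))) <= J x y) ->
  0 < beta_c J /\ forall A, uniq A -> forall n, (1 <= n)%N ->
    Ex (edges A (halfw J (beta_c J))) (fun w => cl R w (bx d n) 0)
      <= A1 * n%:R `^ al / c / beta_c J.
Proof.
have [A1 A10 hA1] := truncated_susceptibility d1 al0 ald.
exists (A1 * 2); first by rewrite mulr_ge0.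
move=> J c J0 Jsym Jint Jinv c0 Jlow.
have sub b0 b1 : 0 < b0 -> b0 < b1 -> ~ percolates J b1 ->
    forall A, uniq A -> forall n, (1 <= n)%N ->
    Ex (edges A (halfw J b0)) (fun w => cl R w (bx d n) 0) <= A1 * 2 * n%:R `^ al / c / b0.
  move=> b00 b01 np A uA n n1.
  have [X hX] := finite_susceptibility_below J0 Jsym Jinv b00 b01 np.
  (* An oriented pair carries half of the intensity, so the kernel bound holds with
     [kappa = c * b0 / 2]. *)
  have -> : A1 * 2 * n%:R `^ al / c / b0 = A1 / (c * b0 / 2) * n%:R `^ al.
    by field; rewrite !gt_eqF.
  apply: hA1 hX _ uA _ n1.
  - by move=> u v; apply: halfw_ge0 => //; exact: ltW.
  - by move=> z u v; exact: halfw_transl.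
  - by rewrite divr_gt0// mulr_gt0.
  move=> u v uv; rewrite /halfw (negbTE uv) mulrAC ler_pM2r// (mulrC c) -mulrA.
  by rewrite ler_pM2l// Jlow.
(* Without percolation at any parameter the bound with [n = 1] would hold at [(2 * A1 + c) / c],
   where it is below one, although the cluster of the origin contains the origin. *)
have nonempty : [set beta : R | 0 <= beta /\ percolates J beta] !=set0.
  apply: contrapT => h.
  have b0 : 0 < (A1 * 2 + c) / c by rewrite divr_gt0// ltr_wpDl// mulr_ge0.
  have np : ~ percolates J ((A1 * 2 + c) / c + 1).
    by move=> hp; apply: h; exists ((A1 * 2 + c) / c + 1); split=> //; rewrite addr_ge0// ltW.
  have lt1 : (A1 * 2 + c) / c < (A1 * 2 + c) / c + 1 by rewrite ltrDl.
  have := sub _ _ b0 lt1 np [::] isT 1%N isT.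
  rewrite /= powR1 mulr1 => h1.
  have : 1 <= cl R set0 (bx d 1) 0.
    rewrite /cl; have z1 : 0 \in bx d 1 by rewrite mem_bx linf0.
    rewrite (perm_big _ (perm_to_rem z1)) big_cons indT; last exact: conn0.
    by rewrite lerDl; exact: cl_ge0.
  move=> /le_trans/(_ h1); rewrite -[leRHS](_ : A1 * 2 / (A1 * 2 + c) = _); last first.
    by field; rewrite !gt_eqF// ltr_wpDl// mulr_ge0.
  by rewrite ler_pdivlMr ?ltr_wpDl// ?mulr_ge0//; lra.
have [M M0 hM] := kernel_sum_bounded J0 Jint.
have bc0 : 0 < beta_c J.
  have m0 : 0 < (2 * (M + 1))^-1 by rewrite invr_gt0 mulr_gt0// ltr_wpDl.
  apply: lt_le_trans m0 _; apply: lb_le_inf => // beta [b0 hp].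
  rewrite leNgt; apply/negP => hb.
  apply: (small_not_percolates J0 Jsym Jinv b0 _ hM) hp.
  by move: hb; rewrite -div1r ltr_pdivlMr ?mulr_gt0// ?ltr_wpDl//; nra.
split=> // A uA n n1; apply: bound_at_limit => // beta /andP[b0 bc].
pose b1 := (beta + beta_c J) / 2.
apply: (sub _ b1) => //; rewrite /b1; first lra.
by apply: not_percolates_below; lra.
Qed.

End PowerKernel.

Theorem theorem1p1 (R : realType) (d : nat) (alpha : R) :
  (1 <= d)%N -> 0 < alpha -> alpha < d%:R ->
  exists A : R,
  forall (J : Zd d -> Zd d -> R) (c : R),
    kernel_nonneg J -> kernel_symmetric J -> kernel_integrable J ->
    kernel_transl_inv J -> 0 < c ->
    (forall x y : Zd d, x != y ->
       c * ((linf (x - y))%:R `^ (- (d%:R + alpha))) <= J x y) ->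
  forall (dT : measure_display) (T : measurableType dT)
         (P : probability T R) (w : T -> Zd d -> Zd d -> bool),
    lrp_model J (beta_c J) P w ->
  forall r : R, 1 <= r ->
    (\sum_(x \in box r) fine (P (conn_event w 0 x))) / (#|` fset_set (@box R d r)|%:R)
      <= A / (c * beta_c J) * r `^ (alpha - d%:R).
Proof.
move=> d1 al0 ald; have [A1 A10 hA1] := critical_bound d1 al0 ald.
exists A1 => J c J0 Jsym Jint Jinv c0 Jlow dT T P w Hw r r1.
have [bc0 hbc] := hA1 J c J0 Jsym Jint Jinv c0 Jlow.
have r0 : 0 < r by exact: lt_le_trans r1.
set n := Num.truncn r.
have /andP[nr rn] : n%:R <= r < n.+1%:R by exact: truncn_itv (ltW r0).
have n1 : (1 <= n)%N by rewrite -ltnS -(ltr_nat R); exact: le_lt_trans r1 rn.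
rewrite (box_bx _ (ltW r0)) -/n card_box -fsbig_seq ?bx_uniq//.
have N0 : 0 < r ^+ d by exact: exprn_gt0.
(* From [r < n + 1] and [n >= 1] the side [2 * n + 1] exceeds [r], so dividing by the volume gains
   [r^d]. *)
have Nr : r ^+ d <= (n.*2.+1 ^ d)%:R.
  rewrite natrX; apply: lerXn2r; rewrite ?nnegrE ?(ltW r0)//.
  apply: le_trans (ltW rn) _; rewrite ler_nat; lia.
set K := A1 / (c * beta_c J).
have K0 : 0 <= K by rewrite divr_ge0// mulr_ge0 ?(ltW c0) ?(ltW bc0).
have hS : \sum_(y <- bx d n) fine (P (conn_event w 0 y)) <= K * r `^ alpha.
  apply: (@le_trans _ _ (K * n%:R `^ alpha)); last first.
    by apply: ler_wpM2l => //; apply: ge0_ler_powR; rewrite ?nnegrE ?(ltW al0) ?(ltW r0).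
  apply: (sum_conn_le Hw Jsym (ltW bc0)) => m.
  apply: le_trans (hbc _ (bx_uniq d m) n n1) _.
  by rewrite le_eqVlt; apply/orP; left; apply/eqP; rewrite /K; field; rewrite !gt_eqF.
have -> : r `^ (alpha - d%:R) = r `^ alpha / r ^+ d.
  by rewrite powRD ?(gt_eqF r0) ?implybT// powRN powR_mulrn ?(ltW r0).
have N1 := lt_le_trans N0 Nr.
rewrite mulrA; apply: (@le_trans _ _ (K * r `^ alpha / (n.*2.+1 ^ d)%:R)).
  by rewrite ler_pM2r ?invr_gt0.
by apply: ler_wpM2l; [rewrite mulr_ge0 ?powR_ge0|rewrite lef_pV2].
Qed.
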